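(* Let $K$ be a field with $\operatorname{char} K=0$, let $X=(X_{ij})$ be an $m\times n$ matrix of indeterminates, and let $I\subset K[X]$ be an ideal. Then the following are equivalent: (a) $I$ is defined by shape; (b) $I$ is a sum of ideals of type $I^{(\sigma)}$, where the $\sigma$ are shapes; (c) $I$ has a standard basis, and $I$ is stable under the action of $\mathrm{GL}=\mathrm{GL}(m,K)\times\mathrm{GL}(n,K)$ on $K[X]$.
   Context: A minor is $[a_1,\dots,a_t\mid b_1,\dots,b_t]=\det(X_{a_ib_j})_{1\le i,j\le t}$ with $1\le a_1<\dots<a_t\le m$, $1\le b_1<\dots<b_t\le n$; its size is $t$, and the empty minor (size $0$) is $1$. A bitableau is a product $\Delta=\delta_1\cdots\delta_w$ of minors ordered so that the sizes are descending, $|\delta_1|\ge\dots\ge|\delta_w|$; its shape is $|\Delta|=(|\delta_1|,\dots,|\delta_w|)$ (up to trailing zeros). A shape $\sigma$ is a non-increasing finite sequence of non-negative integers $\le\min(m,n)$, considered up to trailing zeros. Partial order on minors: $[a_1,\dots,a_t\mid b_1,\dots,b_t]\preceq[c_1,\dots,c_u\mid d_1,\dots,d_u]$ iff $t\ge u$ and $a_i\le c_i$, $b_i\le d_i$ for $i=1,\dots,u$. A bitableau $\delta_1\cdots\delta_w$ is standard if $\delta_1\preceq\dots\preceq\delta_w$. The standard bitableaux form a $K$-basis of $K[X]$. An ideal $I$ has a standard basis if $I$ is the $K$-vector space spanned by the standard bitableaux contained in $I$. An ideal $I\subset K[X]$ is defined by shape if it is generated as an ideal by a set of bitableaux and, moreover,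 it depends only on $|\Delta|$ whether a bitableau $\Delta$ belongs to $I$. For $t\ge1$ and a sequence $\sigma=(s_1,\dots,s_w)$ put $\gamma_t(\sigma)=\sum_{i=1}^w\max(0,s_i-t+1)$, and $\gamma_t(\Delta)=\gamma_t(|\Delta|)$ for a bitableau $\Delta$. The ideal $I^{(\sigma)}$ is generated by all bitableaux $\Delta$ with $\gamma_t(\Delta)\ge\gamma_t(\sigma)$ for all $t$. The group $\mathrm{GL}(m,K)\times\mathrm{GL}(n,K)$ acts on $K[X]$ by linear substitutions of the variables: $(M,N)$ substitutes for $X_{ij}$ the $(i,j)$ entry of $MXN^{-1}$. *)

(* Defs.v *)
From mathcomp Require Export all_boot all_order all_algebra.
From mathcomp Require Export mpoly.

Set Implicit Arguments.
Unset Strict Implicit.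
Unset Printing Implicit Defensive.

Import GRing.Theory.
Local Open Scope ring_scope.

(* Ideals and subspaces are Prop-valued predicates: no decidability is
   assumed, and the unit ideal is allowed, unlike in [idealr_closed]. *)

Record is_ideal (R : comNzRingType) (I : R -> Prop) : Prop := IsIdeal {
  ideal0 : I 0;
  idealD : forall x y, I x -> I y -> I (x + y);
  idealM : forall a x, I x -> I (a * x)
}.

Definition ideal_gen (R : comNzRingType) (S : R -> Prop) : R -> Prop :=
  fun x => forall J : R -> Prop,
    is_ideal J -> (forall y, S y -> J y) -> J x.

Record is_subspace (K : fieldType) (V : lmodType K) (W : V -> Prop) : Prop :=
  IsSubspace {
    subspace0 : W 0;
    subspaceD : forall x y, W x -> W y -> W (x + y);
    subspaceZ : forall (a : K) x, W x -> W (a *: x)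
  }.

Definition lin_span (K : fieldType) (V : lmodType K) (S : V -> Prop) :
    V -> Prop :=
  fun x => forall W : V -> Prop,
    is_subspace W -> (forall y, S y -> W y) -> W x.

(* The sum of a possibly infinite (or empty) family of ideals: all finite sums
   of elements of the members. *)
Definition ideal_sum (R : comNzRingType) (T : Type) (P : T -> Prop)
    (J : T -> R -> Prop) : R -> Prop :=
  fun x => exists s : seq R,
    x = \sum_(y <- s) y /\
    forall y, y \in s -> exists i : T, P i /\ J i y.

(* Row and column indices are 0-based. *)
Record minor (m n : nat) := Minor {
  msize : nat;
  mrow : 'I_msize -> 'I_m;
  mcol : 'I_msize -> 'I_n;
  mrow_incr : {homo mrow : i j / (i < j)%N};
  mcol_incr : {homo mcol : i j / (i < j)%N}
}.

Arguments msize {m n} _.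
Arguments mrow {m n} _ _.
Arguments mcol {m n} _ _.

Definition minor_le m n (d e : minor m n) : bool :=
  (msize e <= msize d)%N &&
  [forall i : 'I_(msize d), forall j : 'I_(msize e),
     (i == j :> nat) ==> (mrow d i <= mrow e j)%N && (mcol d i <= mcol e j)%N].

(* Bitableaux are formal sequences of minors, possibly with trailing empty
   minors; [bt_poly] below is the corresponding product in K[X]. *)
Definition bt_shape m n (D : seq (minor m n)) : seq nat :=
  [seq msize d | d <- D].

Definition is_bitableau m n (D : seq (minor m n)) : bool :=
  sorted geq (bt_shape D).

Definition is_standard m n (D : seq (minor m n)) : bool :=
  is_bitableau D && sorted (@minor_le m n) D.

Definition is_shape (m n : nat) (s : seq nat) : bool :=
  sorted geq s && all (fun k => k <= minn m n)%N s.

(* Equality up to trailing zeros. *)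
Definition same_shape (s s' : seq nat) : Prop :=
  forall i, nth 0%N s i = nth 0%N s' i.

(* With truncated subtraction, [k.+1 - t] is max(0, k - t + 1). *)
Definition gamma (t : nat) (s : seq nat) : nat :=
  (\sum_(k <- s) (k.+1 - t))%N.

Section Ring.

Variables (K : fieldType) (m n : nat).

Notation KX := {mpoly K[m * n]}.

Definition genX : 'M[KX]_(m, n) := \matrix_(i, j) 'X_(mxvec_index i j).

Definition minor_poly (d : minor m n) : KX :=
  \det (mxsub (mrow d) (mcol d) genX).

Definition bt_poly (D : seq (minor m n)) : KX := \prod_(d <- D) minor_poly d.

Definition has_standard_basis (I : KX -> Prop) : Prop :=
  forall p, I p <->
    lin_span (fun q : KX =>
      exists D, [/\ is_standard D, q = bt_poly D & I q]) p.

Definition defined_by_shape (I : KX -> Prop) : Prop :=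
  (exists S : seq (minor m n) -> Prop,
      (forall D, S D -> is_bitableau D) /\
      forall p, I p <-> ideal_gen (fun q => exists D, S D /\ q = bt_poly D) p)
  /\
  (forall D D', is_bitableau D -> is_bitableau D' ->
     same_shape (bt_shape D) (bt_shape D') -> (I (bt_poly D) <-> I (bt_poly D'))).

Definition Ishape (s : seq nat) : KX -> Prop :=
  ideal_gen (fun q => exists D,
    [/\ is_bitableau D,
        forall t, (0 < t)%N -> (gamma t s <= gamma t (bt_shape D))%N
      & q = bt_poly D]).

Definition sum_of_Ishapes (I : KX -> Prop) : Prop :=
  exists S : seq nat -> Prop,
    (forall s, S s -> is_shape m n s) /\
    forall p, I p <-> ideal_sum S Ishape p.

(* [GL_act M N p] substitutes the (i, j) entry of M X N^-1 for X_ij. *)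
Definition GL_act (M : 'M[K]_m) (N : 'M[K]_n) (p : KX) : KX :=
  let Y := map_mx (@mpolyC (m * n) K) M *m genX
           *m map_mx (@mpolyC (m * n) K) (invmx N) in
  comp_mpoly [tuple mxvec Y 0 k | k < m * n] p.

Definition GL_stable (I : KX -> Prop) : Prop :=
  forall M N, M \in unitmx -> N \in unitmx -> forall p, I p -> I (GL_act M N p).

End Ring.

(* Main.v *)
From HB Require Import structures.
Require Import Defs.
From mathcomp Require Import all_fingroup zify ring.

Set Implicit Arguments.
Unset Strict Implicit.
Unset Printing Implicit Defensive.

Import GRing.Theory Num.Theory.
Local Open Scope ring_scope.

(** The proof rests on one degeneration.  Replace X by A J B^T, where A and B are
    generic square matrices and J is the rectangular identity.  A minor
    [a_1,...,a_s | b_1,...,b_s] becomes a polynomial whose least monomial is the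
    product of the A_(a_i,i) and B_(b_i,i), and the degrees of this monomial in the
    last columns of A are the numbers gamma_t; no other monomial has smaller
    degrees there.  Least monomials multiply ([has_lead_bt]), those of distinct
    standard bitableaux are distinct ([bt_poly_lead]), and the polynomials whose
    monomials all have degrees above one of the given shapes form an ideal
    ([supported_ideal]).  Hence the standard bitableaux are linearly
    independent, the shapes in the standard expansion of p are bounded by the
    degrees of the degeneration of p ([supported_terms]), and a bitableau lies in
    a sum of ideals I^(sigma) if and only if its shape is above one of the sigma
    ([bt_in_ideal_sum]).  The last statement gives (b) => (a).  For (b) => (c) the
    standard bitableaux also have to span K[X] ([standard_span]); this is the
    straightening law, proved by antisymmetrizing over m + 1 columns of X with
    unit columns appended.

    The order on shapes given by all gamma_t is generated by adding a box in the
    first column and by exchanges that move a box from a minor to one that is not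
    smaller ([gamma_generated]).  A Laplace type identity
    ([cminor_exchange]) writes the canonical product after the exchange as a
    combination of products of the shape before it.  If I is defined by shape,
    all of these lie in I, and (a) => (b) follows.

    Let I be stable under GL with a standard basis.  As K is infinite, the
    coefficients of p at A X B^T, for p in I and generic A and B, lie in I.  The
    leading coefficient shows that with a bitableau I contains the canonical
    product of its shape, a product of top left minors ([canonical_of_bt]).
    Conversely, the coefficients obtained from this canonical product are
    combinations of products of minors with the same shape; by the Cauchy-Binet
    formula the matrix of their lowest degree parts is, up to a factor, a Gram
    matrix M^T M with rational entries, and this has the same row space as M.
    So every standard bitableau of this shape agrees in lowest degrees with an
    element of I, and it lies in I, as I has a standard basis
    ([std_of_canonical]).  Row operations then put all terms of the exchange
    identity into I ([exchange_mem]), and the argument of (a) => (b) applies. *)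

(** * Determinants of matrix products *)
Section Determinants.

Variable R : comNzRingType.

Lemma det_mulmx_sum s p (A : 'M[R]_(s, p)) (B : 'M[R]_(p, s)) :
  \det (A *m B) =
  \sum_(c : {ffun 'I_s -> 'I_p}) (\prod_i A i (c i)) * \det (rowsub c B).
Proof.
pose AB (t : 'S_s) i j := A i j * B j (t i).
transitivity (\sum_(c : {ffun 'I_s -> 'I_p})
    \sum_(t : 'S_s) (-1) ^+ t * \prod_i AB t i (c i)).
  rewrite exchange_big; apply: eq_bigr => /= t _; rewrite -big_distrr /=.
  congr (_ * _); rewrite -(bigA_distr_bigA (AB t)) /=.
  by apply: eq_bigr => x _; rewrite mxE.
apply: eq_bigr => c _; rewrite big_distrr /=; apply: eq_bigr => t _.
rewrite mulrCA big_split //=; congr (_ * (_ * _)).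
by apply: eq_bigr => i _; rewrite mxE.
Qed.

Lemma det_rowsub_perm s p (B : 'M[R]_(p, s)) (c : 'I_s -> 'I_p) (t : 'S_s) :
  \det (rowsub (c \o t) B) = (-1) ^+ t * \det (rowsub c B).
Proof.
rewrite -det_perm -det_mulmx; congr (\det _).
by rewrite -row_permE; apply/matrixP => i j; rewrite !mxE.
Qed.

(** Averaging the expansion of [det_mulmx_sum] over the permutations of the
    summation index makes it symmetric in the two factors; summing over all
    index functions, not only the increasing ones, avoids a choice of
    representatives at the price of the factor s!. *)
Lemma Cauchy_Binet_sum s p (A : 'M[R]_(s, p)) (B : 'M[R]_(p, s)) :
  (s`!)%:R * \det (A *m B) =
  \sum_(c : {ffun 'I_s -> 'I_p}) \det (colsub c A) * \det (rowsub c B).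
Proof.
have cardS : s`! = #|'S_s| by rewrite card_Sn.
have E (c : {ffun 'I_s -> 'I_p}) : \det (colsub c A) =
    \sum_(t : 'S_s) (-1) ^+ t * \prod_i A i (c (t i)).
  by apply: eq_bigr => t _; congr (_ * _); apply: eq_bigr => i _; rewrite mxE.
under eq_bigr do rewrite E big_distrl /=.
rewrite exchange_big /= mulr_natl cardS -sumr_const; apply: eq_bigr => t _.
rewrite det_mulmx_sum.
pose ht (c : {ffun 'I_s -> 'I_p}) := [ffun i => c (t i)].
have ht_bij : bijective ht.
  exists (fun c : {ffun 'I_s -> 'I_p} => [ffun i => c ((t^-1)%g i)]) => c;
    by apply/ffunP => i; rewrite !ffunE ?permK ?permKV.
rewrite (reindex ht) /=; last exact: onW_bij.
apply: eq_bigr => c _.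
rewrite (_ : rowsub (ht c) B = rowsub (c \o t) B); last first.
  by apply/matrixP => i j; rewrite !mxE ffunE.
rewrite det_rowsub_perm mulrCA mulrA; congr (_ * _ * _).
by apply: eq_bigr => i _; rewrite ffunE.
Qed.

Lemma det_colsub_tr s p (B : 'M[R]_(s, p)) (c : 'I_s -> 'I_p) :
  \det (colsub c B) = \det (rowsub c B^T).
Proof. by rewrite -det_tr; congr (\det _); apply/matrixP => i j; rewrite !mxE. Qed.

(** For generic A and B this is the action of the two linear groups on a
    minor of Y. *)
Lemma det_mulmx_sum2 s p q (A : 'M[R]_(s, p)) (Y : 'M[R]_(p, q))
    (B : 'M[R]_(s, q)) :
  \det (A *m Y *m B^T) =
  \sum_(c : {ffun 'I_s -> 'I_p}) \sum_(c' : {ffun 'I_s -> 'I_q})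
    (\prod_i A i (c i)) * (\prod_i B i (c' i)) * \det (mxsub c c' Y).
Proof.
rewrite -mulmxA det_mulmx_sum; apply: eq_bigr => c _.
rewrite -det_tr [(rowsub c _)^T](_ : _ = B *m (rowsub c Y)^T); last first.
  by rewrite -mul_rowsub_mx trmx_mul trmxK.
rewrite det_mulmx_sum big_distrr; apply: eq_bigr => c' _ /=.
rewrite mulrA; congr (_ * _).
by rewrite -det_tr; congr (\det _); apply/matrixP => i j; rewrite !mxE.
Qed.

Lemma Cauchy_Binet_sum2 s p q (A : 'M[R]_(s, p)) (Y : 'M[R]_(p, q))
    (B : 'M[R]_(s, q)) :
  (s`! * s`!)%:R * \det (A *m Y *m B^T) =
  \sum_(c : {ffun 'I_s -> 'I_p}) \sum_(c' : {ffun 'I_s -> 'I_q})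
    \det (colsub c A) * \det (colsub c' B) * \det (mxsub c c' Y).
Proof.
rewrite natrM -mulrA -mulmxA Cauchy_Binet_sum big_distrr /=.
apply: eq_bigr => c _.
rewrite mulrCA -[\det (rowsub _ _)]det_tr [(rowsub c _)^T](_ : _ = B *m (rowsub c Y)^T); last first.
  by rewrite -mul_rowsub_mx trmx_mul trmxK.
rewrite Cauchy_Binet_sum big_distrr; apply: eq_bigr => c' _ /=.
rewrite mulrA; congr (_ * _).
by rewrite -det_tr; congr (\det _); apply/matrixP => i j; rewrite !mxE.
Qed.

Lemma det_mxsub_noninj_row s p q (Y : 'M[R]_(p, q)) (a : 'I_s -> 'I_p)
    (b : 'I_s -> 'I_q) : ~~ injectiveb a -> \det (mxsub a b Y) = 0.
Proof.
case/injectivePn => i1 [i2 Di12 Ef12].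
by rewrite (determinant_alternate Di12) //= => j; rewrite !mxE Ef12.
Qed.

Lemma det_mxsub_noninj_col s p q (Y : 'M[R]_(p, q)) (a : 'I_s -> 'I_p)
    (b : 'I_s -> 'I_q) : ~~ injectiveb b -> \det (mxsub a b Y) = 0.
Proof.
move=> nb; rewrite -det_tr (_ : _^T = mxsub b a Y^T) ?det_mxsub_noninj_row //.
by apply/matrixP => i j; rewrite !mxE.
Qed.

End Determinants.

(** * Substitutions and the statistics of monomials *)
Section Subst.

Variables (K : fieldType) (m n : nat).

(** Evaluation at a matrix Y with entries in a commutative algebra over K, whose
    structure map is f. *)
Definition subst_mx (S : comNzRingType) (f : {rmorphism K -> S})
    (Y : 'M[S]_(m, n)) (p : {mpoly K[m * n]}) : S :=
  mmap f (fun k => mxvec Y 0 k) p.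

HB.instance Definition _ S f Y :=
  GRing.RMorphism.copy (@subst_mx S f Y) (mmap f (fun k => mxvec Y 0 k)).

Lemma subst_mxX (S : comNzRingType) (f : {rmorphism K -> S}) Y i j :
  subst_mx f Y (genX K m n i j) = Y i j.
Proof. by rewrite mxE /subst_mx mmapX mmap1U mxvecE. Qed.

Lemma subst_mxC (S : comNzRingType) (f : {rmorphism K -> S}) Y c :
  subst_mx f Y c%:MP = f c.
Proof. exact: mmapC. Qed.

Lemma subst_mx_det (S : comNzRingType) (f : {rmorphism K -> S}) Y s
    (a : 'I_s -> 'I_m) (b : 'I_s -> 'I_n) :
  subst_mx f Y (\det (mxsub a b (genX K m n))) = \det (mxsub a b Y).
Proof.
rewrite -det_map_mx; congr (\det _); apply/matrixP => i j.
rewrite [RHS]mxE -(subst_mxX f); first by rewrite [LHS]mxE; congr (subst_mx _ _ _); rewrite mxE.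
Qed.

Lemma subst_mx_minor (S : comNzRingType) (f : {rmorphism K -> S}) Y d :
  subst_mx f Y (minor_poly K d) = \det (mxsub (mrow d) (mcol d) Y).
Proof. exact: subst_mx_det. Qed.

Lemma rmorph_subst_mx (S S' : comNzRingType) (f : {rmorphism K -> S})
    (g : {rmorphism S -> S'}) Y p :
  g (subst_mx f Y p) = subst_mx (g \o f) (map_mx g Y) p.
Proof.
rewrite /subst_mx /mmap rmorph_sum; apply: eq_bigr => u _.
rewrite rmorphM /= /mmap1 rmorph_prod; congr (_ * _).
by apply: eq_bigr => i _; rewrite rmorphXn -map_mxvec mxE.
Qed.

Lemma GL_actE (M : 'M[K]_m) (N : 'M[K]_n) p :
  GL_act M N p = subst_mx (@mpolyC (m * n) K)
    (map_mx (@mpolyC (m * n) K) M *m genX K m n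
     *m map_mx (@mpolyC (m * n) K) (invmx N)) p.
Proof.
by rewrite /GL_act /comp_mpoly /subst_mx; apply: eq_bigr => u _; congr (_ * _);
   apply: mmap1_eq => k; rewrite tnth_mktuple.
Qed.

End Subst.

Lemma mcoeffM_neq0 (S : comNzRingType) N (P Q : {mpoly S[N]}) u :
  (P * Q)@_u != 0 -> exists v w, [/\ P@_v != 0, Q@_w != 0 & u = (v + w)%MM].
Proof.
rewrite -mcoeff_msupp => /msuppM_le /allpairsP [[v w] /= [vP wQ ->]].
by exists v, w; rewrite -!mcoeff_msupp.
Qed.

Section Monomials.

Variables (m n : nat).

Notation N := (m * m + n * n)%N.

(** Coordinates of two generic square matrices A and B, of orders m and n. *)
Definition varA (i k : 'I_m) : 'I_N := lshift _ (mxvec_index i k).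
Definition varB (j k : 'I_n) : 'I_N := rshift _ (mxvec_index j k).

Definition genA (S : comNzRingType) : 'M[{mpoly S[N]}]_m :=
  \matrix_(i, k) 'X_(varA i k).
Definition genB (S : comNzRingType) : 'M[{mpoly S[N]}]_n :=
  \matrix_(j, k) 'X_(varB j k).

Lemma mxvec_index_inj p q (i i' : 'I_p) (j j' : 'I_q) :
  (mxvec_index i j == mxvec_index i' j') = (i == i') && (j == j').
Proof.
by rewrite /mxvec_index (inj_eq (@cast_ord_inj _ _ _)) (inj_eq enum_rank_inj).
Qed.

Lemma eq_varA i k i' k' : (varA i k == varA i' k') = (i == i') && (k == k').
Proof. by rewrite (inj_eq (@lshift_inj _ _)) mxvec_index_inj. Qed.

Lemma eq_varB i k i' k' : (varB i k == varB i' k') = (i == i') && (k == k').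
Proof. by rewrite (inj_eq (@rshift_inj _ _)) mxvec_index_inj. Qed.

Lemma eq_varAB i k j l : (varA i k == varB j l) = false.
Proof. exact: eq_lrshift. Qed.

Lemma eq_varBA i k j l : (varB j l == varA i k) = false.
Proof. exact: eq_rlshift. Qed.

Lemma var_cases (v : 'I_N) :
  (exists i k, v = varA i k) \/ (exists j k, v = varB j k).
Proof.
case: (split_ordP v) => w ->; case/mxvec_indexP: w => i k.
  by left; exists i, k.
by right; exists i, k.
Qed.

(** These counts of the factors of a monomial in the first rows and the last
    columns of A (resp. B) replace a monomial order.  They are additive, they
    determine the monomial, and a minor of A Y B^T has a monomial that is
    minimal for all of them at once.  For x = m, where the row is forgotten,
    [statA] specializes to the numbers gamma_t of a shape. *)
Definition statA (x t : nat) (u : 'X_{1..N}) : nat :=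
  (\sum_(i < m | i < x) \sum_(k < m | t <= k) u (varA i k))%N.
Definition statB (x t : nat) (u : 'X_{1..N}) : nat :=
  (\sum_(i < n | i < x) \sum_(k < n | t <= k) u (varB i k))%N.

Lemma statAD x t u v : statA x t (u + v)%MM = (statA x t u + statA x t v)%N.
Proof.
rewrite -big_split; apply: eq_bigr => i _; rewrite -big_split.
by apply: eq_bigr => k _; rewrite mnmDE.
Qed.

Lemma statBD x t u v : statB x t (u + v)%MM = (statB x t u + statB x t v)%N.
Proof.
rewrite -big_split; apply: eq_bigr => i _; rewrite -big_split.
by apply: eq_bigr => k _; rewrite mnmDE.
Qed.

Lemma statA_sum x t I (r : seq I) P (F : I -> 'X_{1..N}) :
  statA x t (\sum_(i <- r | P i) F i)%MM =
  (\sum_(i <- r | P i) statA x t (F i))%N.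
Proof.
elim/big_rec2: _ => [|i y z _ <-]; last exact: statAD.
by rewrite /statA big1 // => i _; rewrite big1 // => k _; rewrite mnm0E.
Qed.

Lemma statB_sum x t I (r : seq I) P (F : I -> 'X_{1..N}) :
  statB x t (\sum_(i <- r | P i) F i)%MM =
  (\sum_(i <- r | P i) statB x t (F i))%N.
Proof.
elim/big_rec2: _ => [|i y z _ <-]; last exact: statBD.
by rewrite /statB big1 // => i _; rewrite big1 // => k _; rewrite mnm0E.
Qed.


Lemma statA_varA x t i k : statA x t U_(varA i k) = ((i < x) && (t <= k))%N.
Proof.
rewrite /statA; case: (ltnP i x) => [ix|xi] /=; last first.
  rewrite big1 // => i' ix'; rewrite big1 // => k' _; rewrite mnm1E eq_varA.
  by case: eqP => // ii; move: ix'; rewrite -ii ltnNge xi.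
rewrite (bigD1 i) //= [X in (_ + X)%N]big1 ?addn0 => [|i' /andP[_ ii']].
  case: (leqP t k) => [tk|kt].
    rewrite (bigD1 k) //= mnm1E eqxx big1 // => k' /andP[_ kk'].
    by rewrite mnm1E eq_varA eqxx eq_sym (negPf kk').
  rewrite big1 // => k' tk'; rewrite mnm1E eq_varA.
  by case: (k =P k') => [kk|]; rewrite ?andbF //; move: tk'; rewrite -kk leqNgt kt.
by rewrite big1 // => k' _; rewrite mnm1E eq_varA eq_sym (negPf ii').
Qed.

Lemma statB_varB x t i k : statB x t U_(varB i k) = ((i < x) && (t <= k))%N.
Proof.
rewrite /statB; case: (ltnP i x) => [ix|xi] /=; last first.
  rewrite big1 // => i' ix'; rewrite big1 // => k' _; rewrite mnm1E eq_varB.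
  by case: eqP => // ii; move: ix'; rewrite -ii ltnNge xi.
rewrite (bigD1 i) //= [X in (_ + X)%N]big1 ?addn0 => [|i' /andP[_ ii']].
  case: (leqP t k) => [tk|kt].
    rewrite (bigD1 k) //= mnm1E eqxx big1 // => k' /andP[_ kk'].
    by rewrite mnm1E eq_varB eqxx eq_sym (negPf kk').
  rewrite big1 // => k' tk'; rewrite mnm1E eq_varB.
  by case: (k =P k') => [kk|]; rewrite ?andbF //; move: tk'; rewrite -kk leqNgt kt.
by rewrite big1 // => k' _; rewrite mnm1E eq_varB eq_sym (negPf ii').
Qed.

Lemma statA_varB x t j k : statA x t U_(varB j k) = 0%N.
Proof. by rewrite /statA big1 // => i _; rewrite big1 // => l _; rewrite mnm1E eq_varBA. Qed.

Lemma statB_varA x t i k : statB x t U_(varA i k) = 0%N.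
Proof. by rewrite /statB big1 // => j _; rewrite big1 // => l _; rewrite mnm1E eq_varAB. Qed.

(** Exponents are mixed second differences of the counts. *)
Lemma stat_telescope p (h : 'I_p -> 'I_p -> nat) (i k : 'I_p) :
  let S x t := (\sum_(i < p | i < x) \sum_(k < p | t <= k) h i k)%N in
  h i k = (S i.+1 k - S i k - (S i.+1 k.+1 - S i k.+1))%N.
Proof.
move=> S; have step t : S i.+1 t = (\sum_(k < p | (t <= k)%N) h i k + S i t)%N.
  rewrite /S (bigD1 i) //=; congr (_ + _)%N; apply: eq_bigl => i'.
  by rewrite ltnS ltn_neqAle andbC.
rewrite !step !addnK (bigD1 k) //= [X in (_ + X - _)%N](_ : _ =
  \sum_(k' < p | (k < k')%N) h i k')%N ?addnK //.
by apply: eq_bigl => k'; rewrite ltn_neqAle andbC [_ == k]eq_sym.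
Qed.

Lemma stat_inj u v :
  (forall x t, (x <= m)%N -> (t <= m)%N -> statA x t u = statA x t v) ->
  (forall x t, (x <= n)%N -> (t <= n)%N -> statB x t u = statB x t v) -> u = v.
Proof.
move=> eA eB; apply/mnmP => w; case: (var_cases w) => [[i [k ->]]|[j [k ->]]].
  rewrite (stat_telescope (fun i k => u (varA i k))).
  rewrite (stat_telescope (fun i k => v (varA i k))) -!/(statA _ _ _).
  have [li lk] := (ltn_ord i, ltn_ord k).
  by rewrite !eA // ltnW.
rewrite (stat_telescope (fun i k => u (varB i k))).
rewrite (stat_telescope (fun i k => v (varB i k))) -!/(statB _ _ _).
have [lj lk] := (ltn_ord j, ltn_ord k).
by rewrite !eB // ltnW.
Qed.

Definition stat_le (v u : 'X_{1..N}) :=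
  forall x t, (statA x t v <= statA x t u)%N /\ (statB x t v <= statB x t u)%N.

Lemma stat_leD v u v' u' :
  stat_le v u -> stat_le v' u' -> stat_le (v + v')%MM (u + u')%MM.
Proof.
move=> h h' x t; have [a b] := h x t; have [a' b'] := h' x t.
by rewrite !statAD !statBD !leq_add.
Qed.

Definition weight (u : 'X_{1..N}) : nat :=
  (\sum_(x < m.+1) \sum_(t < m.+1) statA x t u
   + \sum_(x < n.+1) \sum_(t < n.+1) statB x t u)%N.

Lemma leq_weight v u : stat_le v u -> (weight v <= weight u)%N.
Proof.
by move=> h; apply: leq_add; apply: leq_sum => x _; apply: leq_sum => t _;
   case: (h x t).
Qed.

Lemma weight_lt v u : stat_le v u -> v != u -> (weight v < weight u)%N.
Proof.
move=> h; apply: contraNltn => /(conj (leq_weight h)) /andP; rewrite -eqn_leq => /eqP e.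
have sum_eq (p : nat) (F G : 'I_p.+1 -> 'I_p.+1 -> nat) :
    (forall x t, F x t <= G x t)%N ->
    (\sum_x \sum_t G x t <= \sum_x \sum_t F x t)%N -> forall x t, F x t = G x t.
  move=> FG; rewrite !pair_big /= => le x t.
  have := leqif_sum (fun (z : 'I_p.+1 * 'I_p.+1) (_ : true) =>
    leqif_geq (FG z.1 z.2)) => -[le' e'].
  have := e'; rewrite [X in X == _](_ : _ = \sum_(z : 'I_p.+1 * 'I_p.+1) G z.1 z.2)%N.
    by rewrite eqxx => /esym/forall_inP /(_ (x, t) isT) /= GF; apply/eqP; rewrite eqn_leq FG.
  by apply/eqP; rewrite eqn_leq le' le.
move: e; rewrite /weight => e.
have leA : (\sum_(x < m.+1) \sum_(t < m.+1) statA x t v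
            <= \sum_(x < m.+1) \sum_(t < m.+1) statA x t u)%N.
  by apply: leq_sum => x _; apply: leq_sum => t _; case: (h x t).
have leB : (\sum_(x < n.+1) \sum_(t < n.+1) statB x t v
            <= \sum_(x < n.+1) \sum_(t < n.+1) statB x t u)%N.
  by apply: leq_sum => x _; apply: leq_sum => t _; case: (h x t).
have key a b c d : (a + b = c + d -> a <= c -> b <= d -> c <= a /\ d <= b)%N by lia.
have [geA geB] := key _ _ _ _ e leA leB.
apply/eqP/stat_inj => x t xm tm.
  apply: (sum_eq m (fun x t => statA x t v) (fun x t => statA x t u) _ _
            (Ordinal (xm : x < m.+1)%N) (Ordinal (tm : t < m.+1)%N)) => [x' t'|].
    by case: (h x' t').
  exact: geA.
apply: (sum_eq n (fun x t => statB x t v) (fun x t => statB x t u) _ _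
          (Ordinal (xm : x < n.+1)%N) (Ordinal (tm : t < n.+1)%N)) => [x' t'|].
  by case: (h x' t').
exact: geB.
Qed.

(** The term c X^v lies below all others in the sense of [stat_le].  This is
    stronger than being extremal for a monomial order, and it is inherited by
    products over any coefficient ring. *)
Definition has_lead (S : comNzRingType) (v : 'X_{1..N}) (c : S)
    (P : {mpoly S[N]}) : Prop :=
  P@_v = c /\ forall u, P@_u != 0 -> stat_le v u.

Lemma has_lead1 (S : comNzRingType) : has_lead 0%MM (1 : S) 1.
Proof.
split=> [|u]; first by rewrite mcoeff1 eqxx.
rewrite mcoeff1; case: (u =P 0%MM) => [-> _ x t|]; first by split.
by rewrite eqxx.
Qed.

(** Monomials above v and v' can only multiply to v + v' if they are v and v':
    otherwise the weight of the product is too large. *)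
Lemma has_leadM (S : comNzRingType) v v' (c c' : S) P P' :
  has_lead v c P -> has_lead v' c' P' -> has_lead (v + v')%MM (c * c') (P * P').
Proof.
move=> [cP sP] [cP' sP']; split=> [|u]; last first.
  by case/mcoeffM_neq0 => w [w' [/sP h /sP' h' ->]]; apply: stat_leD.
have Plead (Q : {mpoly S[N]}) z d : Q@_z = d -> (forall u, Q@_u != 0 -> stat_le z u) ->
    forall u, (Q - d *: 'X_[z])@_u != 0 -> (weight z < weight u)%N.
  move=> Qz sQ u; rewrite mcoeffB mcoeffZ mcoeffX.
  case: (z =P u) => [<-|zu]; first by rewrite Qz mulr1 subrr eqxx.
  by rewrite mulr0 subr0 => /sQ h; apply: weight_lt => //; apply/eqP.
have weightD a b : weight (a + b)%MM = (weight a + weight b)%N.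
  rewrite /weight addnACA -!big_split; congr (_ + _)%N; apply: eq_bigr => x _;
    rewrite -big_split; apply: eq_bigr => t _; [exact: statAD | exact: statBD].
have -> : P * P' = (c *: 'X_[v]) * (c' *: 'X_[v'])
    + ((P - c *: 'X_[v]) * P' + c *: 'X_[v] * (P' - c' *: 'X_[v'])) by ring.
rewrite mcoeffD -scalerAl -scalerAr scalerA mcoeffZ -mpolyXD mcoeffX eqxx mulr1.
apply/eqP; rewrite -[X in _ == X]addr0 (inj_eq (addrI _)) mcoeffD.
rewrite (_ : (_ * P')@_ _ = 0) ?add0r; last first.
  apply/eqP/negPn/negP => /mcoeffM_neq0 [w [w' [/(Plead _ _ _ cP sP) h /sP' h']]].
  move/(congr1 weight); rewrite !weightD; have := leq_weight h'; lia.
apply/negPn/negP => /mcoeffM_neq0 [w [w' [h]]].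
move=> /(Plead _ _ _ cP' sP') h' /(congr1 weight).
move: h; rewrite mcoeffZ mcoeffX; case: (v =P w) => [<- _|_]; last by rewrite mulr0 eqxx.
rewrite !weightD; lia.
Qed.

End Monomials.

(** * Leading monomials of bitableaux *)
Section Increasing.

Lemma incr_ge s p (f : 'I_s -> 'I_p) :
  {homo f : i j / (i < j)%N} -> forall k : 'I_s, (k <= f k)%N.
Proof.
move=> h [k ks] /=; elim: k ks => [//|k IH] ks.
have ks' : (k < s)%N by exact: ltnW.
apply: leq_ltn_trans (IH ks') _; exact: h.
Qed.

Lemma incr_size s p (f : 'I_s -> 'I_p) :
  {homo f : i j / (i < j)%N} -> (s <= p)%N.
Proof.
case: s f => [//|s] f /incr_ge /(_ ord_max) /= h.
exact: leq_ltn_trans h (ltn_ord _).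
Qed.

Lemma incr_inj s p (f : 'I_s -> 'I_p) :
  {homo f : i j / (i < j)%N} -> injective f.
Proof.
move=> h i j e; apply/eqP; rewrite -val_eqE eqn_leq.
by apply/andP; split; rewrite leqNgt; apply/negP => /h; rewrite e ltnn.
Qed.

(** The indices k with a k < x form an initial segment.  An injective c takes at
    most t of its values below t, and the identity takes as many of them there
    as the length of the segment allows. *)
Lemma card_incr_min s p q (a : 'I_s -> 'I_p) (c : 'I_s -> 'I_q) (x t : nat) :
  {homo a : i j / (i < j)%N} -> injective c ->
  (\sum_(k < s) ((a k < x) && (t <= k)) <= \sum_(k < s) ((a k < x) && (t <= c k)))%N.
Proof.
move=> ha cinj.
have cardE (P : pred 'I_s) : (\sum_(k < s) P k = #|P|)%N.
  by rewrite -sum1_card [RHS]big_mkcond; apply: eq_bigr => k _; rewrite -topredE /=; case: (P k).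
rewrite (cardE (fun k => (a k < x) && (t <= k)))%N.
rewrite (cardE (fun k => (a k < x) && (t <= c k)))%N.
have [k0 /andP[k0x tk0]|none] := pickP (fun k => (a k < x) && (t <= k))%N; last first.
  by rewrite (eq_card (B := pred0)) ?card0 // => k; rewrite inE none.
have amono (k k' : 'I_s) : (k <= k')%N -> (a k <= a k')%N.
  by rewrite leq_eqVlt => /orP[/eqP/val_inj -> //|/ha/ltnW].
have le1 : (#|[pred k | (a k < x) && ~~ (t <= c k)]| <= t)%N.
  have -> : #|[pred k | (a k < x) && ~~ (t <= c k)]%N| = #|c @: [pred k | (a k < x) &&
    ~~ (t <= c k)]%N|.
    by rewrite card_imset.
  have [tq|qt] := leqP t q; last by apply: leq_trans (max_card _) _; rewrite card_ord ltnW.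
  have winj : injective (widen_ord tq) by move=> i j /(congr1 val) /= /val_inj.
  rewrite -[X in (_ <= X)%N](card_ord t) -(card_imset _ winj).
  apply/subset_leq_card/subsetP => y /imsetP [k /andP[_ ck] ->]; rewrite -ltnNge in ck.
  by apply/imsetP; exists (Ordinal ck) => //; apply: val_inj.
have ts : (t <= s)%N by apply: leq_trans tk0 (ltnW (ltn_ord k0)).
have le2 : (t <= #|[pred k | (a k < x) && ~~ (t <= k)]|)%N.
  have winj : injective (widen_ord ts) by move=> i j /(congr1 val) /= /val_inj.
  rewrite -[X in (X <= _)%N](card_ord t) -(card_imset _ winj).
  apply/subset_leq_card/subsetP => y /imsetP [k _ ->]; rewrite inE /=.
  rewrite -ltnNge ltn_ord andbT; apply: leq_ltn_trans k0x; apply: amono => /=.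
  exact: leq_trans (ltnW (ltn_ord k)) tk0.
have split1 (Q : pred 'I_s) : (#|[pred k | (a k < x) && Q k]|
     + #|[pred k | (a k < x) && ~~ Q k]| = #|[pred k | a k < x]|)%N.
  rewrite -(cardID Q [pred k | a k < x]%N); congr (_ + _)%N; apply: eq_card => k;
    by rewrite !inE andbC.
have := split1 (fun k => t <= k)%N; have := split1 (fun k => t <= c k)%N.
move=> e1 e2; move: (leq_trans le1 le2) => le.
have := e1; rewrite -e2 => e3.
have key a1 b1 c1 d1 : (a1 + b1 = c1 + d1 -> b1 <= d1 -> c1 <= a1)%N by lia.
exact: key e3 le.
Qed.

End Increasing.

Section NatMinors.

Variables (S : comNzRingType) (m n : nat) (Y : 'M[S]_(m, n)).

(** Total lookup by natural numbers: index sets can then be shifted and altered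
    without carrying bounds along. *)
Definition ent (i j : nat) : S :=
  if insub i is Some i' then if insub j is Some j' then Y i' j' else 0 else 0.

Definition gminor (s : nat) (f g : nat -> nat) : S :=
  \det (\matrix_(i < s, j < s) ent (f i) (g j)).

Definition cminor (s : nat) : S := gminor s id id.

Lemma entE (i : 'I_m) (j : 'I_n) : ent i j = Y i j.
Proof. by rewrite /ent !valK. Qed.

Lemma gminor_mxsub s (f g : nat -> nat) (a : 'I_s -> 'I_m) (b : 'I_s -> 'I_n) :
  (forall k : 'I_s, f k = a k) -> (forall k : 'I_s, g k = b k) ->
  \det (mxsub a b Y) = gminor s f g.
Proof.
move=> ef eg; congr (\det _); apply/matrixP => i j.
by rewrite !mxE ef eg entE.
Qed.

Lemma eq_gminor s f f' g g' :
  (forall k, (k < s)%N -> f k = f' k) -> (forall k, (k < s)%N -> g k = g' k) ->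
  gminor s f g = gminor s f' g'.
Proof.
move=> ef eg; congr (\det _); apply/matrixP => i j.
by rewrite !mxE ef ?eg.
Qed.

Lemma cminor0 : cminor 0 = 1.
Proof. exact: det_mx00. Qed.

End NatMinors.

Section Leading.

Variables (m n : nat).
Notation N := (m * m + n * n)%N.

Lemma msize_le_row (d : minor m n) : (msize d <= m)%N.
Proof. exact: incr_size (@mrow_incr _ _ d). Qed.

Lemma msize_le_col (d : minor m n) : (msize d <= n)%N.
Proof. exact: incr_size (@mcol_incr _ _ d). Qed.

Definition pair_mon s (a c : 'I_s -> 'I_m) (b c' : 'I_s -> 'I_n) : 'X_{1..N} :=
  (\sum_k U_(varA n (a k) (c k)) + \sum_k U_(varB m (b k) (c' k)))%MM.

Definition lead_minor (d : minor m n) : 'X_{1..N} :=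
  pair_mon (mrow d) (widen_ord (msize_le_row d))
           (mcol d) (widen_ord (msize_le_col d)).

Definition lead (D : seq (minor m n)) : 'X_{1..N} := (\sum_(d <- D) lead_minor d)%MM.

Lemma pair_mon_varA s (a c : 'I_s -> 'I_m) (b c' : 'I_s -> 'I_n) i l :
  pair_mon a c b c' (varA n i l) = (\sum_k ((a k == i) && (c k == l)))%N.
Proof.
rewrite mnmDE !mnm_sumE [X in (_ + X)%N]big1 ?addn0 => [|k _]; last first.
  by rewrite mnm1E eq_varBA.
by apply: eq_bigr => k _; rewrite mnm1E eq_varA.
Qed.

Lemma pair_mon_varB s (a c : 'I_s -> 'I_m) (b c' : 'I_s -> 'I_n) i l :
  pair_mon a c b c' (varB m i l) = (\sum_k ((b k == i) && (c' k == l)))%N.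
Proof.
rewrite mnmDE !mnm_sumE [X in (X + _)%N]big1 ?add0n => [|k _]; last first.
  by rewrite mnm1E eq_varAB.
by apply: eq_bigr => k _; rewrite mnm1E eq_varB.
Qed.

Lemma pair_mon_inj s (a c e : 'I_s -> 'I_m) (b c' e' : 'I_s -> 'I_n) :
  injective a -> injective b ->
  pair_mon a c b c' = pair_mon a e b e' -> c =1 e /\ c' =1 e'.
Proof.
move=> ia ib eq; split=> k.
  have := congr1 (fun u : 'X_{1..N} => u (varA n (a k) (c k))) eq.
  rewrite /= !pair_mon_varA (bigD1 k) //= !eqxx big1 => [|k']; last first.
    by rewrite (inj_eq ia) => /negPf ->.
  rewrite (bigD1 k) //= eqxx big1 => [|k']; last first.
    by rewrite (inj_eq ia) => /negPf ->.
  by case: eqP.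
have := congr1 (fun u : 'X_{1..N} => u (varB m (b k) (c' k))) eq.
rewrite /= !pair_mon_varB (bigD1 k) //= !eqxx big1 => [|k']; last first.
  by rewrite (inj_eq ib) => /negPf ->.
rewrite (bigD1 k) //= eqxx big1 => [|k']; last first.
  by rewrite (inj_eq ib) => /negPf ->.
by case: eqP.
Qed.

Lemma statA_pair_mon x t s (a c : 'I_s -> 'I_m) (b c' : 'I_s -> 'I_n) :
  statA x t (pair_mon a c b c') = (\sum_k ((a k < x) && (t <= c k)))%N.
Proof.
rewrite statAD !statA_sum [X in (_ + X)%N]big1 ?addn0 => [|k _]; last first.
  exact: statA_varB.
by apply: eq_bigr => k _; rewrite statA_varA.
Qed.

Lemma statB_pair_mon x t s (a c : 'I_s -> 'I_m) (b c' : 'I_s -> 'I_n) :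
  statB x t (pair_mon a c b c') = (\sum_k ((b k < x) && (t <= c' k)))%N.
Proof.
rewrite statBD !statB_sum [X in (X + _)%N]big1 ?add0n => [|k _]; last first.
  exact: statB_varA.
by apply: eq_bigr => k _; rewrite statB_varB.
Qed.

Definition sandwich (S : comNzRingType) (Y : 'M[S]_(m, n)) :
    'M[{mpoly S[N]}]_(m, n) :=
  genA m n S *m map_mx (@mpolyC N S) Y *m (genB m n S)^T.

Lemma det_sandwich (S : comNzRingType) (Y : 'M[S]_(m, n)) s
    (a : 'I_s -> 'I_m) (b : 'I_s -> 'I_n) :
  \det (mxsub a b (sandwich Y)) =
  \sum_(c : {ffun 'I_s -> 'I_m}) \sum_(c' : {ffun 'I_s -> 'I_n})
    \det (mxsub c c' Y) *: 'X_[pair_mon a c b c'].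
Proof.
have -> : mxsub a b (sandwich Y) =
    rowsub a (genA m n S) *m map_mx (@mpolyC N S) Y *m (rowsub b (genB m n S))^T.
  rewrite mul_rowsub_mx; apply/matrixP => i j; rewrite !mxE.
  by apply: eq_bigr => k _; rewrite !mxE.
rewrite det_mulmx_sum2; apply: eq_bigr => c _; apply: eq_bigr => c' _.
rewrite -map_mxsub det_map_mx mulrC mul_mpolyC /pair_mon mpolyXD.
congr (_ *: (_ * _)).
  rewrite (big_morph _ (@mpolyXD _ _) (mpolyX0 _ _)).
  by apply: eq_bigr => k _; rewrite !mxE.
rewrite (big_morph _ (@mpolyXD _ _) (mpolyX0 _ _)).
by apply: eq_bigr => k _; rewrite !mxE.
Qed.

(** In the expansion of a minor of A Y B^T the row indices of the minor are
    distinct, so a monomial determines the two index functions it comes from,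
    and index functions that are not injective contribute zero.  The identity
    functions give the smallest monomial, by [card_incr_min]. *)
Lemma has_lead_minor (S : comNzRingType) (Y : 'M[S]_(m, n)) (d : minor m n) :
  has_lead (lead_minor d) (cminor Y (msize d))
    (\det (mxsub (mrow d) (mcol d) (sandwich Y))).
Proof.
have [ra rb] := (incr_inj (@mrow_incr _ _ d), incr_inj (@mcol_incr _ _ d)).
rewrite det_sandwich; split=> [|u].
  rewrite raddf_sum /= (bigD1 [ffun k => widen_ord (msize_le_row d) k]) //=.
  rewrite [X in _ + X]big1 ?addr0 => [|c /eqP nc]; last first.
    rewrite raddf_sum big1 //= => c' _; rewrite mcoeffZ mcoeffX.
    case: eqP => [/(pair_mon_inj ra rb)[e _]|_]; last by rewrite mulr0.
    by case: nc; apply/ffunP => k; rewrite ffunE e.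
  rewrite raddf_sum /= (bigD1 [ffun k => widen_ord (msize_le_col d) k]) //=.
  rewrite [X in _ + X]big1 ?addr0 => [|c /eqP nc]; last first.
    rewrite mcoeffZ mcoeffX.
    case: eqP => [/(pair_mon_inj ra rb)[_ e]|_]; last by rewrite mulr0.
    by case: nc; apply/ffunP => k; rewrite ffunE e.
  rewrite mcoeffZ mcoeffX (_ : pair_mon _ _ _ _ = lead_minor d).
    by rewrite eqxx mulr1; apply: gminor_mxsub => k; rewrite ffunE.
  by congr (_ + _)%MM; apply: eq_bigr => k _; rewrite ffunE.
rewrite raddf_sum /= => /eqP ne0.
have [[c c'] /= cc] : exists z : {ffun 'I_(msize d) -> 'I_m} * {ffun 'I_(msize d) -> 'I_n},
    (\det (mxsub z.1 z.2 Y) *: 'X_[pair_mon (mrow d) z.1 (mcol d) z.2])@_u != 0.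
  apply/existsP; apply: contra_notT ne0; rewrite negb_exists => /forallP h.
  apply: big1 => c _; rewrite raddf_sum big1 //= => c' _.
  by move: (h (c, c')); rewrite negbK => /eqP.
move: cc; rewrite mcoeffZ mcoeffX; case: (_ =P u) => [<- |_]; last by rewrite mulr0 eqxx.
rewrite mulr1 => dn0 x t.
rewrite !statA_pair_mon !statB_pair_mon; split; apply: card_incr_min.
- exact: mrow_incr.
- by apply/injectiveP; apply: contraNT dn0 => /det_mxsub_noninj_row ->.
- exact: mcol_incr.
by apply/injectiveP; apply: contraNT dn0 => /det_mxsub_noninj_col ->.
Qed.

Lemma has_lead_bt (K : fieldType) (S : comNzRingType) (f : {rmorphism K -> {mpoly S[N]}})
    (Y : 'M[S]_(m, n)) (D : seq (minor m n)) :
  has_lead (lead D) (\prod_(k <- bt_shape D) cminor Y k)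
    (subst_mx f (sandwich Y) (bt_poly K D)).
Proof.
rewrite /bt_poly /lead; elim: D => [|d D IH].
  by rewrite !big_nil rmorph1; exact: has_lead1.
have h := has_lead_minor Y d; rewrite -(subst_mx_minor f) in h.
rewrite /= !big_cons rmorphM; exact: (has_leadM h IH).
Qed.

Lemma sum_ord_geq t s : (\sum_(k < s) (t <= k) = s - t)%N.
Proof.
elim: s => [|s IH]; first by rewrite big_ord0.
by rewrite big_ord_recr /= IH; lia.
Qed.

Lemma statA_lead t D : statA m t (lead D) = gamma t.+1 (bt_shape D).
Proof.
rewrite /lead statA_sum /gamma big_map; apply: eq_bigr => d _.
rewrite statA_pair_mon subSS -sum_ord_geq.
by apply: eq_bigr => k _; rewrite ltn_ord.
Qed.

End Leading.

(** * Standard bitableaux have distinct leading monomials *)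
Section StandardLeads.

Variables (m n : nat).
Notation N := (m * m + n * n)%N.

Definition row_at (d : minor m n) (k : nat) : nat :=
  if insub k is Some i then mrow d i else 0%N.
Definition col_at (d : minor m n) (k : nat) : nat :=
  if insub k is Some i then mcol d i else 0%N.

Lemma row_atE (d : minor m n) (k : 'I_(msize d)) : row_at d k = mrow d k.
Proof. by rewrite /row_at valK. Qed.

Lemma col_atE (d : minor m n) (k : 'I_(msize d)) : col_at d k = mcol d k.
Proof. by rewrite /col_at valK. Qed.

Lemma minor_polyE (K : fieldType) (d : minor m n) :
  minor_poly K d = gminor (genX K m n) (msize d) (row_at d) (col_at d).
Proof. by apply: gminor_mxsub => k; rewrite ?row_atE ?col_atE. Qed.

Lemma empty_incr (p : nat) (f : 'I_0 -> 'I_p) :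
  {homo f : i j / (i < j)%N}.
Proof. by case. Qed.

Definition empty_minor : minor m n :=
  @Minor m n 0 (fun i => match i with Ordinal _ h => False_rect _ (notF h) end)
    (fun i => match i with Ordinal _ h => False_rect _ (notF h) end)
    (@empty_incr m _) (@empty_incr n _).

Lemma minor_poly_empty K : minor_poly K empty_minor = 1.
Proof. exact: det_mx00. Qed.

Lemma bt_poly_nth K (D : seq (minor m n)) M : (size D <= M)%N ->
  bt_poly K D = \prod_(p < M) minor_poly K (nth empty_minor D p).
Proof.
rewrite /bt_poly; elim: D M => [|d D IH] [|M] //=.
- by rewrite big_ord0 big_nil.
- by rewrite big_nil big1 // => i _; rewrite nth_nil minor_poly_empty.
by move=> h; rewrite big_cons big_ord_recl /= (IH M).
Qed.

(** In a standard bitableau a property that passes down along [minor_le] holds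
    exactly for an initial segment. *)
Lemma count_prefix (D : seq (minor m n)) (P : pred (minor m n)) p :
  sorted (@minor_le m n) D -> (forall d e, minor_le d e -> P e -> P d) ->
  ~~ P empty_minor -> P (nth empty_minor D p) = (p < count P D)%N.
Proof.
move=> sD anti P0; elim: D sD p => [|d D IH] /=; first by move=> _ p; rewrite nth_nil (negPf P0).
move=> pD; case: (boolP (P d)) => [Pd|nPd] [|p] /=; rewrite ?Pd //.
- by rewrite add1n ltnS IH //; exact: path_sorted pD.
- have -> : count P D = 0%N; last by rewrite (negPf nPd).
  elim: D d pD nPd {IH} => [//|e D IH] d /= /andP[de pD] nPd.
  by rewrite (contraNF (anti _ _ de) nPd) (IH e) // (contraNN (anti _ _ de) nPd).
rewrite add0n IH ?(path_sorted pD) //.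
have -> : count P D = 0%N; last by [].
elim: D d pD nPd {IH} => [//|e D IH] d /= /andP[de pD] nPd.
by rewrite (contraNF (anti _ _ de) nPd) (IH e) // (contraNN (anti _ _ de) nPd).
Qed.

Lemma minor_leP (d e : minor m n) : minor_le d e ->
  (msize e <= msize d)%N /\ forall k, (k < msize e)%N ->
    (row_at d k <= row_at e k)%N && (col_at d k <= col_at e k)%N.
Proof.
case/andP => se /forallP h; split=> // k ke.
have kd := leq_trans ke se; move: (h (Ordinal kd)) => /forallP /(_ (Ordinal ke)).
by rewrite eqxx /= -!row_atE -!col_atE.
Qed.

Lemma standard_of_sorted (D : seq (minor m n)) :
  sorted (@minor_le m n) D -> is_standard D.
Proof.
move=> sD; rewrite /is_standard sD andbT /is_bitableau /bt_shape sorted_map.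
by apply: sub_sorted sD => d e /andP[].
Qed.

Definition row_below k x (d : minor m n) := ((k < msize d) && (row_at d k < x))%N.
Definition col_below k x (d : minor m n) := ((k < msize d) && (col_at d k < x))%N.

Lemma sum_split_at s k (P : nat -> bool) :
  (\sum_(i < s) (P i && (k <= i)) =
   ((k < s) && P k) + \sum_(i < s) (P i && (k < i)))%N.
Proof.
elim: s => [|s IH]; first by rewrite !big_ord0.
rewrite !big_ord_recr /= IH ltnS; move: (\sum_(i < s) _)%N => X {IH}.
case: (ltngtP k s) => [|ks|->]; rewrite ?andbF ?andbT; lia.
Qed.

Lemma count_row_below k x (D : seq (minor m n)) :
  (count (row_below k x) D + statA x k.+1 (lead D) = statA x k (lead D))%N.
Proof.
rewrite /lead !statA_sum -sum1_count big_mkcond -big_split; apply: eq_bigr => d _ /=.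
rewrite !statA_pair_mon.
have E t : (\sum_(i < msize d) ((mrow d i < x) && (t <= widen_ord (msize_le_row d) i)) =
     \sum_(i < msize d) ((row_at d i < x) && (t <= i)))%N.
  by apply: eq_bigr => i _; rewrite row_atE.
rewrite !E (sum_split_at _ k (fun i => row_at d i < x)%N) /row_below.
by case: (_ && _).
Qed.

Lemma count_col_below k x (D : seq (minor m n)) :
  (count (col_below k x) D + statB x k.+1 (lead D) = statB x k (lead D))%N.
Proof.
rewrite /lead !statB_sum -sum1_count big_mkcond -big_split; apply: eq_bigr => d _ /=.
rewrite !statB_pair_mon.
have E t : (\sum_(i < msize d) ((mcol d i < x) && (t <= widen_ord (msize_le_col d) i)) =
     \sum_(i < msize d) ((col_at d i < x) && (t <= i)))%N.
  by apply: eq_bigr => i _; rewrite col_atE.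
rewrite !E (sum_split_at _ k (fun i => col_at d i < x)%N) /col_below.
by case: (_ && _).
Qed.

Lemma row_below_nth k x p (D : seq (minor m n)) : is_standard D ->
  row_below k x (nth empty_minor D p) =
  (p < statA x k (lead D) - statA x k.+1 (lead D))%N.
Proof.
case/andP => _ sD; rewrite -(count_row_below k x D) addnK.
apply: count_prefix => // d e /minor_leP[se h] /andP[ke rx].
by rewrite /row_below (leq_trans ke se) (leq_ltn_trans _ rx) //; case/andP: (h k ke).
Qed.

Lemma col_below_nth k x p (D : seq (minor m n)) : is_standard D ->
  col_below k x (nth empty_minor D p) =
  (p < statB x k (lead D) - statB x k.+1 (lead D))%N.
Proof.
case/andP => _ sD; rewrite -(count_col_below k x D) addnK.
apply: count_prefix => // d e /minor_leP[se h] /andP[ke rx].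
by rewrite /col_below (leq_trans ke se) (leq_ltn_trans _ rx) //; case/andP: (h k ke).
Qed.

(** The leading monomial counts, for all k and x, the minors whose k-th row (or
    column) index is below x.  In a standard bitableau these minors come first,
    so that the counts determine all entries. *)
Lemma bt_poly_lead K (D E : seq (minor m n)) : is_standard D -> is_standard E ->
  lead D = lead E -> bt_poly K D = bt_poly K E.
Proof.
move=> sD sE eDE.
rewrite (bt_poly_nth _ (leq_maxl (size D) (size E))).
rewrite (bt_poly_nth _ (leq_maxr (size D) (size E))); apply: eq_bigr => p _.
set d := nth _ D p; set e := nth _ E p.
have rE k x : row_below k x d = row_below k x e by rewrite !row_below_nth ?eDE.
have cE k x : col_below k x d = col_below k x e by rewrite !col_below_nth ?eDE.
have row_lt (f : minor m n) k : (k < msize f)%N -> (row_at f k < m)%N.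
  by move=> kf; rewrite (row_atE (Ordinal kf)).
have sz : msize d = msize e.
  have szE k : (k < msize d)%N = (k < msize e)%N.
    move: (rE k m); rewrite /row_below.
    case kd: (k < msize d)%N; case ke: (k < msize e)%N => //=.
      by rewrite row_lt.
    by rewrite row_lt.
  by apply/eqP; rewrite eqn_leq leqNgt szE ltnn leqNgt -szE ltnn.
rewrite !minor_polyE sz; apply: eq_gminor => k ke.
  apply/eqP; rewrite eqn_leq.
  have := rE k (row_at e k).+1; have := rE k (row_at d k).+1.
  by rewrite /row_below sz ke /= !ltnS !leqnn => <- ->.
apply/eqP; rewrite eqn_leq.
have := cE k (col_at e k).+1; have := cE k (col_at d k).+1.
by rewrite /col_below sz ke /= !ltnS !leqnn => <- ->.
Qed.

End StandardLeads.

(** * Degeneration and shape control *)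
Section Degeneration.

Variables (K : fieldType) (m n : nat).
Notation N := (m * m + n * n)%N.
Notation KX := {mpoly K[m * n]}.

Definition eye : 'M[K]_(m, n) := \matrix_(i, j) ((i : nat) == j)%:R.

(** X is replaced by A J B^T, where J is the rectangular identity matrix: the
    canonical products take the value 1 at J, so that all bitableaux have
    leading coefficient 1. *)
Definition degen (p : KX) : {mpoly K[N]} :=
  subst_mx (@mpolyC N K) (sandwich eye) p.

HB.instance Definition _ :=
  GRing.RMorphism.copy degen (subst_mx (@mpolyC N K) (sandwich eye)).

Lemma degenZ c p : degen (c *: p) = c *: degen p.
Proof. by rewrite -mul_mpolyC rmorphM /= [degen _%:MP]subst_mxC mul_mpolyC. Qed.

Lemma ent_eye i j : (i < m)%N -> (j < n)%N -> ent eye i j = (i == j)%:R.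
Proof.
by move=> im jn; rewrite (entE eye (Ordinal im) (Ordinal jn)) mxE.
Qed.

Lemma cminor_eye s : (s <= minn m n)%N -> cminor eye s = 1.
Proof.
rewrite leq_min => /andP[sm sn]; rewrite /cminor /gminor -[RHS](det1 K s).
congr (\det _); apply/matrixP => i j; rewrite !mxE ent_eye //.
  exact: leq_trans (ltn_ord i) sm.
exact: leq_trans (ltn_ord j) sn.
Qed.

Lemma has_lead_degen (D : seq (minor m n)) :
  has_lead (lead D) (1 : K) (degen (bt_poly K D)).
Proof.
have := has_lead_bt (@mpolyC N K) eye D.
rewrite (_ : \prod_(k <- _) _ = 1) // big_map big1 // => d _.
by rewrite cminor_eye // leq_min msize_le_row msize_le_col.
Qed.

Definition supported (U : 'X_{1..N} -> Prop) (p : KX) : Prop :=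
  forall u, (degen p)@_u != 0 -> U u.

(** Sets of monomials that are closed under going up: the polynomials supported
    on such a set form an ideal, and a bitableau belongs to it if and only if
    its leading monomial does. *)
Definition stat_up (U : 'X_{1..N} -> Prop) : Prop :=
  forall v u, stat_le v u -> U v -> U u.

Lemma stat_le_addl (u v : 'X_{1..N}) : stat_le v (u + v)%MM.
Proof. by move=> x t; rewrite statAD statBD !leq_addl. Qed.

Lemma supported_ideal U : stat_up U -> is_ideal (supported U).
Proof.
move=> up; split=> [u|p q hp hq u|a p hp u].
- by rewrite rmorph0 mcoeff0 eqxx.
- rewrite rmorphD mcoeffD; case: (eqVneq (degen p)@_u 0) => [->|/hp //].
  by rewrite add0r => /hq.
rewrite rmorphM => /mcoeffM_neq0 [v [w [_ /hp Uw ->]]].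
exact: up (stat_le_addl _ _) Uw.
Qed.

Lemma supportedZ U a p : supported U p -> supported U (a *: p).
Proof.
move=> h u; rewrite degenZ mcoeffZ => ne; apply: h; apply: contraNneq ne => ->.
by rewrite mulr0.
Qed.

Lemma supported_bt U D : stat_up U -> U (lead D) -> supported U (bt_poly K D).
Proof. by move=> up UD u /(has_lead_degen D).2 /up; apply. Qed.

Lemma supported_lead U D : supported U (bt_poly K D) -> U (lead D).
Proof. by apply; rewrite (has_lead_degen D).1 oner_neq0. Qed.

(** A family of standard bitableaux is indexed by its leading monomials, hence
    free of repetitions. *)
Definition std_family (s : seq 'X_{1..N}) (rep : 'X_{1..N} -> seq (minor m n)) :=
  forall u, u \in s -> is_standard (rep u) /\ lead (rep u) = u.

(** This contains the linear independence of the standard bitableaux (let U be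
    empty) and controls the shapes in a standard expansion.  After the terms
    of smaller weight, which are supported on U by induction, are removed, the
    leading monomial of a term cannot be cancelled by the other terms. *)
Lemma supported_terms U (s : seq 'X_{1..N}) c rep : stat_up U -> uniq s ->
  std_family s rep -> supported U (\sum_(u <- s) c u *: bt_poly K (rep u)) ->
  forall u, u \in s -> c u != 0 -> U u.
Proof.
move=> up us std Up u; have [w] := ubnP (weight u); elim: w u => // w IH u.
rewrite ltnS => uw us' cu.
have idU := supported_ideal up.
pose low (v : 'X_{1..N}) := (@weight m n v < @weight m n u)%N.
have Ulow : supported U (\sum_(v <- s | low v) c v *: bt_poly K (rep v)).
  rewrite big_seq_cond; elim/big_rec: _ => [|v p]; first exact: ideal0 idU.
  case/andP => vs lv Up'.
  have Uv : supported U (c v *: bt_poly K (rep v)).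
    have [->|cv] := eqVneq (c v) 0; first by rewrite scale0r; exact: ideal0 idU.
    apply: supportedZ; apply: supported_bt => //; rewrite (std v vs).2.
    by apply: IH => //; exact: leq_trans uw.
  exact: (idealD idU Uv Up').
have Uhigh : supported U (\sum_(v <- s | ~~ low v) c v *: bt_poly K (rep v)).
  have := idealD idU Up (supportedZ (a := -1) Ulow).
  by rewrite (bigID low) /= scaleN1r addrAC subrr add0r.
apply: Uhigh; rewrite rmorph_sum raddf_sum /=.
rewrite big_mkcond (bigD1_seq u) //= /low ltnn /= big1_seq => [|v /andP[vu vs]].
  by rewrite addr0 degenZ mcoeffZ -{2}(std u us').2 (has_lead_degen _).1 mulr1.
case: ifP => // lv; rewrite degenZ mcoeffZ; apply/eqP; rewrite mulf_eq0; apply/orP; right.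
apply: contraNT lv => /(has_lead_degen _).2; rewrite (std v vs).2 => h.
exact: weight_lt.
Qed.

Definition std_comb (Q : KX -> Prop) (p : KX) : Prop :=
  exists s c rep, [/\ uniq s, std_family s rep,
    (forall u, u \in s -> Q (bt_poly K (rep u)))
    & p = \sum_(u <- s) c u *: bt_poly K (rep u)].

Lemma std_comb_add (Q : KX -> Prop) p a D : std_comb Q p -> is_standard D ->
  Q (bt_poly K D) -> std_comb Q (p + a *: bt_poly K D).
Proof.
case=> s [c [rep [us std Qs ->]]] sD QD; pose u := lead D.
have [us'|nus] := boolP (u \in s).
  exists s, (fun v => if v == u then c v + a else c v), rep; split=> //.
  rewrite (bigD1_seq u) //= [in RHS](bigD1_seq u) //= eqxx addrAC; congr (_ + _).
    rewrite scalerDl; congr (_ + _ *: _).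
    by apply: bt_poly_lead => //; [exact: (std u us').1 | rewrite (std u us').2].
  by apply: eq_bigr => v /negPf ->.
exists (u :: s), (fun v => if v == u then a else c v),
  (fun v => if v == u then D else rep v); split=> /=.
- by rewrite nus.
- by move=> v; rewrite inE; case: eqP => [-> _|_ /std].
- by move=> v; rewrite inE; case: eqP => [-> _|_ /Qs].
rewrite big_cons eqxx addrC; congr (_ + _).
apply: eq_big_seq => v vs; case: eqP => // vu; by rewrite vu (negPf nus) in vs.
Qed.

Lemma std_comb_span (Q : KX -> Prop) p :
  lin_span (fun q : KX => exists D, [/\ is_standard D, q = bt_poly K D & Q q]) p ->
  std_comb Q p.
Proof.
apply; last first.
  move=> y [D [sD -> QD]].
  have z : std_comb Q 0.
    exists [::], (fun=> 0), (fun=> [::]); split=> //; by rewrite big_nil.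
  by have := std_comb_add 1 z sD QD; rewrite add0r scale1r.
split.
- exists [::], (fun=> 0), (fun=> [::]); split=> //; by rewrite big_nil.
- move=> p1 p2 h1 [s [c [rep [us std Qs ->]]]].
  rewrite big_seq; elim/big_rec: _ => [|u q us' IH]; first by rewrite addr0.
  rewrite addrC -addrA addrC [q + _]addrC; apply: std_comb_add => //; last exact: Qs.
  exact: (std u us').1.
move=> a q [s [c [rep [us std Qs ->]]]].
exists s, (fun u => a * c u), rep; split=> //.
by rewrite scaler_sumr; apply: eq_bigr => u _; rewrite scalerA.
Qed.

End Degeneration.

(** * Exchange relations between maximal minors *)
Section Garnir.

Variables (R : comNzRingType) (m p : nat) (Z : 'M[R]_(m, p)).

Definition maxminor (h : 'I_m -> 'I_p) : R := \det (colsub h Z).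

Lemma eq_maxminor h h' : h =1 h' -> maxminor h = maxminor h'.
Proof. by move=> e; congr (\det _); apply/matrixP => i j; rewrite !mxE e. Qed.

Lemma maxminor_perm h (t : 'S_m) : maxminor (h \o t) = (-1) ^+ t * maxminor h.
Proof.
rewrite /maxminor !det_colsub_tr -det_rowsub_perm.
by congr (\det _); apply/matrixP => i j; rewrite !mxE.
Qed.

Lemma maxminor_noninj h : ~~ injectiveb h -> maxminor h = 0.
Proof. by rewrite /maxminor -[colsub h Z]/(mxsub id h Z) => /det_mxsub_noninj_col ->. Qed.

Lemma maxminorE h :
  maxminor h = \sum_(s : 'S_m) (-1) ^+ s * \prod_j Z (s j) (h j).
Proof.
rewrite /maxminor -det_tr; apply: eq_bigr => s _; congr (_ * _).
by apply: eq_bigr => j _; rewrite !mxE.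
Qed.

Variables (i : 'I_m) (f g : 'I_m -> 'I_p) (e : 'I_m.+1 -> 'I_p).

Definition exch1 (t : 'S_m.+1) (j : 'I_m) : 'I_p :=
  if (j < i)%N then f j else e (t (lift ord0 j)).
Definition exch2 (t : 'S_m.+1) (j : 'I_m) : 'I_p :=
  if (j <= i)%N then e (t (widen_ord (leqnSn m) j)) else g j.

Definition exch (t : 'S_m.+1) : R :=
  (-1) ^+ t * (maxminor (exch1 t) * maxminor (exch2 t)).

Lemma prod_exch_split (F G : 'I_m.+1 -> R) :
  \prod_(j < m | ~~ (j < i)%N) F (lift ord0 j)
    * \prod_(j < m | (j <= i)%N) G (widen_ord (leqnSn m) j) =
  \prod_(l < m.+1) (if (l <= i)%N then G l else F l).
Proof.
rewrite (bigID (fun l : 'I_m.+1 => l <= i)%N) /= mulrC; congr (_ * _).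
  rewrite big_mkcond [RHS]big_mkcond big_ord_recr /= leqNgt ltn_ord mulr1.
  by apply: eq_bigr => j _; case: ifP.
rewrite big_mkcond [RHS]big_mkcond big_ord_recl /= mul1r.
apply: eq_bigr => j _; rewrite /bump /= add1n -leqNgt.
by case: ltnP.
Qed.

(** Antisymmetrizing over m + 1 columns of a matrix with m rows gives zero:
    once the terms of the two determinants that involve the other columns are
    fixed, what is left is a determinant of order m + 1 with two equal rows. *)
Lemma exch_sum0 : \sum_(t : 'S_m.+1) exch t = 0.
Proof.
pose W (s s' : 'S_m) (l c : 'I_m.+1) : R :=
  if (l <= i)%N then Z (s' (odflt i (insub (l : nat)))) (e c)
  else Z (s (odflt i (unlift ord0 l))) (e c).
have rearrange (a b c x1 x2 y1 y2 : R) :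
  c * ((a * (x1 * x2)) * (b * (y1 * y2))) = a * b * x1 * y2 * (c * (x2 * y1)) by ring.
transitivity (\sum_(s : 'S_m) \sum_(s' : 'S_m)
    ((-1) ^+ s * (-1) ^+ s' * \prod_(j < m | (j < i)%N) Z (s j) (f j)
     * \prod_(j < m | ~~ (j <= i)%N) Z (s' j) (g j))
    * \det (\matrix_(l, c) W s s' l c)).
  under eq_bigr do rewrite /exch !maxminorE big_distrlr big_distrr /=.
  rewrite exchange_big; apply: eq_bigr => s _ /=.
  under eq_bigr do rewrite big_distrr /=.
  rewrite exchange_big; apply: eq_bigr => s' _ /=.
  rewrite big_distrr; apply: eq_bigr => t _ /=.
  under [X in _ = _ * (_ * X)]eq_bigr do rewrite mxE /W.
  rewrite -(prod_exch_split (fun l => Z (s (odflt i (unlift ord0 l))) (e (t l)))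
     (fun l => Z (s' (odflt i (insub (l : nat)))) (e (t l)))).
  rewrite (bigID (fun j : 'I_m => (j < i)%N)) /=.
  rewrite [\prod_j Z (s' j) _](bigID (fun j : 'I_m => (j <= i)%N)) /=.
  rewrite [\prod_(_ < m | (_ < i)%N) Z _ (exch1 _ _)](eq_bigr (fun j => Z (s j) (f j)));
    last by move=> j ji; rewrite /exch1 ji.
  rewrite [\prod_(_ < m | ~~ (_ < i)%N) Z _ (exch1 _ _)](eq_bigr
    (fun j => Z (s (odflt i (unlift ord0 (lift ord0 j)))) (e (t (lift ord0 j)))));
    last by move=> j ji; rewrite /exch1 (negPf ji) liftK.
  rewrite [\prod_(_ < m | (_ <= i)%N) Z _ (exch2 _ _)](eq_bigr
    (fun j => Z (s' (odflt i (insub (widen_ord (leqnSn m) j : nat))))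
       (e (t (widen_ord (leqnSn m) j)))));
    last by move=> j ji; rewrite /exch2 ji /= valK.
  rewrite [\prod_(_ < m | ~~ (_ <= i)%N) Z _ (exch2 _ _)](eq_bigr (fun j => Z (s' j) (g j)));
    last by move=> j ji; rewrite /exch2 (negPf ji).
  exact: rearrange.
apply: big1 => s _; apply: big1 => s' _.
pose rho (l : 'I_m.+1) : 'I_m :=
  if (l <= i)%N then s' (odflt i (insub (l : nat))) else s (odflt i (unlift ord0 l)).
have /injectivePn [l1 [l2 l12 r12]] : ~~ injectiveb rho.
  apply/negP => /injectiveP /leq_card; by rewrite !card_ord ltnn.
rewrite (determinant_alternate l12) ?mulr0 // => c; rewrite !mxE /W.
by move: r12; rewrite /rho; do 2 case: ifP => _; move=> ->.
Qed.

Definition keeps_blocks (t : 'S_m.+1) : bool :=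
  [forall l : 'I_m.+1, (t l <= i)%N == (l <= i)%N].

Lemma exch_tperm (t : 'S_m.+1) (x y : 'I_m.+1) : x != y ->
  ((x <= i) = (y <= i))%N -> exch (tperm x y * t)%g = exch t.
Proof.
move=> xy xyi; rewrite /exch odd_permM odd_tperm xy signr_addb expr1.
have widenK (z : 'I_m.+1) : (z <= i)%N -> exists z' : 'I_m, z = widen_ord (leqnSn m) z'.
  by move=> zi; exists (Ordinal (leq_ltn_trans zi (ltn_ord i))); apply: val_inj.
have liftK' (z : 'I_m.+1) : ~~ (z <= i)%N -> exists z' : 'I_m, z = lift ord0 z'.
  case: (unliftP ord0 z) => [z' -> _|-> //]; by exists z'.
case xi: (x <= i)%N; move: xyi; rewrite xi => /esym yi.
  have [[x' ex] [y' ey]] := (widenK _ xi, widenK _ yi).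
  have xy' : x' != y' by apply: contraNneq xy => e'; rewrite ex ey e'.
  have -> : maxminor (exch1 (tperm x y * t)%g) = maxminor (exch1 t).
    apply: eq_maxminor => j; rewrite /exch1; case: ifP => // ji.
    rewrite permM tpermD //.
      by apply: contraTneq xi => ->; rewrite lift0 -ltnNge ltnS leqNgt ji.
    by apply: contraTneq yi => ->; rewrite lift0 -ltnNge ltnS leqNgt ji.
  have -> : maxminor (exch2 (tperm x y * t)%g) = maxminor (exch2 t \o tperm x' y').
    apply: eq_maxminor => j; rewrite /exch2 /=.
    case: (tpermP x' y' j) => [->|->|/eqP jx /eqP jy].
    - by rewrite -/(widen_ord _ x') permM -ex tpermL ey; move: xi yi; rewrite ex ey /= => -> ->.
    - by rewrite -/(widen_ord _ y') permM -ey tpermR ex; move: xi yi; rewrite ex ey /= => -> ->.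
    rewrite permM tpermD // ?ex ?ey; [by rewrite eq_sym -val_eqE | by rewrite eq_sym -val_eqE].
  by rewrite maxminor_perm odd_tperm xy' expr1 mulN1r mulN1r mulrN mulNr mulrN ?mulNr ?opprK.
move/negbT: xi => xi; move/negbT: yi => yi.
have [[x' ex] [y' ey]] := (liftK' _ xi, liftK' _ yi).
have xy' : x' != y' by apply: contraNneq xy => e'; rewrite ex ey e'.
have -> : maxminor (exch2 (tperm x y * t)%g) = maxminor (exch2 t).
  apply: eq_maxminor => j; rewrite /exch2; case: ifP => // ji.
  rewrite permM tpermD //.
    by apply: contraNneq xi => ->.
  by apply: contraNneq yi => ->.
have -> : maxminor (exch1 (tperm x y * t)%g) = maxminor (exch1 t \o tperm x' y').
  have ltE z' : ~~ (lift ord0 z' <= i)%N -> (z' < i)%N = false.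
    by rewrite lift0 -ltnNge ltnS leqNgt => /negPf.
  have x'i : (x' < i)%N = false by apply: ltE; rewrite -ex.
  have y'i : (y' < i)%N = false by apply: ltE; rewrite -ey.
  apply: eq_maxminor => j; rewrite /exch1 /=.
  case: (tpermP x' y' j) => [->|->|/eqP jx /eqP jy].
  - by rewrite permM -ex tpermL ey x'i y'i.
  - by rewrite permM -ey tpermR ex x'i y'i.
  by rewrite permM tpermD // ?ex ?ey (inj_eq lift_inj) eq_sym.
by rewrite maxminor_perm odd_tperm xy' expr1 mulN1r mulN1r mulNr mulNr mulrN ?mulNr ?opprK.
Qed.

(** A permutation that keeps both blocks only reorders the columns within each
    determinant; the two signs make up for its own sign. *)
Lemma exch_keeps (t : 'S_m.+1) : keeps_blocks t -> exch t = exch 1%g.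
Proof.
have [k] := ubnP #|[pred l | t l != l]|; elim: k t => // k IH t; rewrite ltnS => tk kt.
have [l /= tl|fix_t] := pickP [pred l | t l != l]; last first.
  congr exch; apply/permP => l; rewrite perm1; apply/eqP.
  by have /= /negbFE := fix_t l.
pose x := (t^-1)%g l.
have tx : t x = l by rewrite /x permKV.
have xl : x != l by apply: contraNneq tl => e'; rewrite -{1}e' tx.
rewrite -(@exch_tperm t x l) //; last by rewrite -(eqP (forallP kt x)) tx.
apply: IH.
  apply: leq_trans tk; apply: proper_card; apply/properP; split.
    apply/subsetP => z; rewrite !inE permM; case: tpermP => [->|->|//].
      by move=> _; rewrite tx eq_sym.
    by rewrite tx eqxx.
  by exists l; rewrite !inE // permM tpermR tx eqxx.
apply/forallP => z; rewrite permM; case: tpermP => [->|->|_ _]; last exact: forallP kt z.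
  by rewrite (eqP (forallP kt l)) -(eqP (forallP kt x)) tx.
by rewrite (eqP (forallP kt x)) -(eqP (forallP kt x)) tx.
Qed.

Hypothesis e_incr : {homo e : x y / (x < y)%N}.

(** Any other permutation brings into the second block of positions, where the
    larger indices were, some index of the first block. *)
Lemma exch_decreases (t : 'S_m.+1) : ~~ keeps_blocks t ->
  (\sum_(l < m.+1 | i < l) e (t l) < \sum_(l < m.+1 | i < l) e l)%N.
Proof.
move=> nk; pose A := [set l : 'I_m.+1 | (i < l)%N].
pose B := t @: A.
have -> : (\sum_(l < m.+1 | i < l) e (t l) = \sum_(l in B) e l)%N.
  rewrite big_imset /=; last by move=> ? ? _ _; exact: perm_inj.
  by apply: eq_bigl => l; rewrite inE.
have -> : (\sum_(l < m.+1 | i < l) e l = \sum_(l in A) e l)%N.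
  by apply: eq_bigl => l; rewrite inE.
have cAB : #|A :\: B| = #|B :\: A|.
  have := cardsID B A; have := cardsID A B; rewrite setIC (card_imset _ (@perm_inj _ t)).
  by move=> <- /addnI.
have AB0 : (0 < #|A :\: B|)%N.
  rewrite lt0n cards_eq0 setD_eq0; apply: contra nk => sAB.
  have eAB : A = B.
    by apply/eqP; rewrite eqEcard sAB (card_imset _ (@perm_inj _ t)) leqnn.
  apply/forallP => l; have := mem_imset A l (@perm_inj _ t).
  rewrite -/B -eAB !inE => h; by rewrite leqNgt h -leqNgt.
rewrite (big_setID A) /= [in X in (_ < X)%N](big_setID B) /= setIC ltn_add2l.
pose th := e (widen_ord (leqnSn m) i).
have e_le (x y : 'I_m.+1) : (x <= y)%N -> (e x <= e y)%N.
  by rewrite leq_eqVlt => /orP[/eqP/val_inj -> //|/e_incr/ltnW].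
apply: (@leq_ltn_trans (#|B :\: A| * th)).
  rewrite -sum_nat_const; apply: leq_sum => l; rewrite !inE -leqNgt => /andP[li _].
  exact: e_le.
apply: (@leq_trans (#|A :\: B| * th.+1)).
  by rewrite cAB mulnS addnC -{1}[(_ * _)%N]addn0 ltn_add2l -cAB.
rewrite -sum_nat_const; apply: leq_sum => l; rewrite !inE => /andP[_ li].
exact: e_incr.
Qed.

End Garnir.

Section Subspaces.
Variables (K : fieldType) (V : lmodType K).

Lemma lin_span_subspace (S : V -> Prop) : is_subspace (lin_span S).
Proof.
split=> [W WS _|x y hx hy W WS SW|a x hx W WS SW].
- exact: subspace0 WS.
- exact: (subspaceD WS (hx W WS SW) (hy W WS SW)).
exact: (subspaceZ WS a (hx W WS SW)).
Qed.

Lemma lin_span_gen (S : V -> Prop) x : S x -> lin_span S x.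
Proof. by move=> Sx W _; apply. Qed.

Lemma subspace_sum (W : V -> Prop) (WS : is_subspace W) (I : eqType) (r : seq I)
    (P : pred I) (F : I -> V) :
  (forall i, i \in r -> P i -> W (F i)) -> W (\sum_(i <- r | P i) F i).
Proof.
move=> h; rewrite big_seq_cond; elim/big_rec: _ => [|i x /andP[ir Pi] Wx].
  exact: subspace0 WS.
exact: (subspaceD WS (h i ir Pi) Wx).
Qed.

End Subspaces.

Lemma sort_injective s p (h : 'I_s -> 'I_p) : injective h ->
  exists t : 'S_s, {homo (fun x => h (t x)) : x y / (x < y)%N}.
Proof.
move=> inj_h; pose l := sort (fun a b : 'I_p => (a <= b)%N) (codom h).
have szl : size l = s by rewrite size_sort size_codom card_ord.
have sz' : size (codom h) == s by rewrite size_codom card_ord.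
have /tuple_permP [t et] : perm_eq l (Tuple sz') by rewrite /= perm_sort.
have nthl x0 (x : 'I_s) : nth x0 l x = h (t x).
  rewrite et /= (nth_map x) ?size_enum_ord // nth_ord_enum (tnth_nth x0) /=.
  by rewrite codomE (nth_map x) ?size_enum_ord // nth_ord_enum.
have sl : sorted (relpre (@nat_of_ord p) ltn) l.
  have tot : total (relpre (@nat_of_ord p) leq) by move=> a b; exact: leq_total.
  rewrite -sorted_map ltn_sorted_uniq_leq map_inj_uniq ?sort_uniq; last exact: val_inj.
  rewrite codomE map_inj_uniq ?enum_uniq //= sorted_map.
  exact: (sort_sorted tot).
have tr : transitive (relpre (@nat_of_ord p) ltn) by move=> a b c; exact: ltn_trans.
exists t => x y xy; rewrite -(nthl (h x) x) -(nthl (h x) y).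
by have := sorted_ltn_nth tr (h x) sl; rewrite /= => /(_ x y); rewrite !inE szl; apply.
Qed.

Section Straightening.

Variables (K : fieldType) (charK : [pchar K] =i pred0) (N m p : nat).
Variable Z : 'M[{mpoly K[N]}]_(m, p).
Notation KX := {mpoly K[N]}.
Notation idx := {ffun 'I_m -> 'I_p}.

Lemma natr_neq0 k : (0 < k)%N -> k%:R != 0 :> K.
Proof. by rewrite lt0n ((pcharf0P K).1 charK). Qed.

Definition idx_incr (h : idx) : bool :=
  [forall x : 'I_m, forall y : 'I_m, (x < y)%N ==> (h x < h y)%N].
Definition idx_le (h h' : idx) : bool := [forall x, (h x <= h' x)%N].
Definition idx_std (hs : seq idx) : bool := all idx_incr hs && sorted idx_le hs.

Lemma idx_incrP (h : idx) : reflect {homo h : x y / (x < y)%N} (idx_incr h).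
Proof.
apply: (iffP forallP) => [H x y xy|H x].
  by move/forallP: (H x) => /(_ y) /implyP; apply.
by apply/forallP => y; apply/implyP => /H.
Qed.

Definition idx_prod (hs : seq idx) : KX := \prod_(h <- hs) maxminor Z h.
Definition idx_sum (h : idx) : nat := (\sum_x h x)%N.

(** The weights of the factors decrease along the list, so that moving index
    mass from a factor to the next one lowers the measure. *)
Fixpoint idx_meas (hs : seq idx) : nat :=
  if hs is h :: hs' then ((size hs').+1 * idx_sum h + idx_meas hs')%N else 0%N.

Lemma sort_idx (h : idx) : injectiveb h ->
  exists h' (t : 'S_m), [/\ idx_incr h', idx_sum h' = idx_sum h &
    maxminor Z h' = (-1) ^+ t * maxminor Z h].
Proof.
move/injectiveP => /sort_injective [t ht]; exists [ffun x => h (t x)], t; split.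
- by apply/idx_incrP => x y xy; rewrite !ffunE; exact: ht.
- rewrite /idx_sum [RHS](reindex_inj (@perm_inj _ t)) /=.
  by apply: eq_bigr => x _; rewrite ffunE.
rewrite -maxminor_perm; apply: eq_maxminor => x; by rewrite ffunE.
Qed.

Lemma sort_idx_seq (hs : seq idx) : all (fun h : idx => injectiveb h) hs ->
  exists hs' (c : bool), [/\ all idx_incr hs', idx_meas hs' = idx_meas hs,
    size hs' = size hs & idx_prod hs = (-1) ^+ c * idx_prod hs'].
Proof.
elim: hs => [_|h hs IH /= /andP[ih /IH [hs' [c [inc me sz pr]]]]].
  by exists [::], false; rewrite mul1r.
have [h' [t [inc' sum' pl']]] := sort_idx ih.
exists (h' :: hs'), (t (+) c); split=> /=; rewrite ?inc' ?inc ?sz ?sum' ?me //.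
rewrite /idx_prod !big_cons -!/(idx_prod _) pr pl' signr_addb.
rewrite [RHS]mulrACA mulrA -!mulrA [(-1) ^+ t * _]mulrA -signr_addb addbb mul1r.
by rewrite mulrCA.
Qed.

Lemma unsorted_split (hs : seq idx) : ~~ sorted idx_le hs ->
  exists l1 f g l2, hs = l1 ++ f :: g :: l2 /\ ~~ idx_le f g.
Proof.
case: hs => //= h hs; elim: hs h => //= g hs IH h.
rewrite negb_and; case: (boolP (idx_le h g)) => /= [_ /IH [l1 [f [g' [l2 [-> nle]]]]]|nle _].
  by exists (h :: l1), f, g', l2.
by exists [::], h, g, hs.
Qed.

Lemma idx_meas_lt l1 (f g f' g' : idx) l2 :
  (idx_sum f' < idx_sum f)%N -> (idx_sum f' + idx_sum g' = idx_sum f + idx_sum g)%N ->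
  (idx_meas (l1 ++ f' :: g' :: l2) < idx_meas (l1 ++ f :: g :: l2))%N.
Proof.
move=> lt eq; elim: l1 => [|h l1 IH] /=; last by rewrite !size_cat /= ltn_add2l.
rewrite !mulSn; move: (size l2) (idx_sum f') (idx_sum g') (idx_sum f) (idx_sum g) lt eq
  => k a b c d lt eq.
have : (k * (a + b) = k * (c + d))%N by rewrite eq.
rewrite !mulnDr; lia.
Qed.

(** The exchange relation at a position i where g i < f i replaces f g by
    products whose first factor has a smaller index sum: the m + 1 indices
    g 0 < ... < g i < f i < ... < f (m-1) are increasing, and every exchange
    that is not a permutation of the two blocks moves smaller ones to f. *)
Lemma straighten_pair (f g : idx) : idx_incr f -> idx_incr g -> ~~ idx_le f g ->
  exists T : seq (K * (idx * idx)),
    maxminor Z f * maxminor Z g =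
      \sum_(z <- T) z.1 *: (maxminor Z z.2.1 * maxminor Z z.2.2) /\
    forall z, z \in T -> (idx_sum z.2.1 < idx_sum f)%N /\
      (idx_sum z.2.1 + idx_sum z.2.2 = idx_sum f + idx_sum g)%N.
Proof.
move=> /idx_incrP fi /idx_incrP gi; rewrite negb_forall => /existsP [i].
rewrite -ltnNge => gf.
pose e (l : 'I_m.+1) : 'I_p :=
  if (l <= i)%N then g (odflt i (insub (l : nat))) else f (odflt i (unlift ord0 l)).
have eg (j : 'I_m) : (j <= i)%N -> e (widen_ord (leqnSn m) j) = g j.
  by move=> ji; rewrite /e /= ji valK.
have ef (j : 'I_m) : ~~ (j < i)%N -> e (lift ord0 j) = f j.
  by move=> ji; rewrite /e lift0 (negPf ji) liftK.
have widenK (z : 'I_m.+1) : (z <= i)%N -> exists2 z' : 'I_m, z = widen_ord (leqnSn m)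
  z' & (z' <= i)%N.
  by move=> zi; exists (Ordinal (leq_ltn_trans zi (ltn_ord i))); first exact: val_inj.
have liftK' (z : 'I_m.+1) : ~~ (z <= i)%N -> exists2 z' : 'I_m, z = lift ord0 z' & ~~ (z' < i)%N.
  case: (unliftP ord0 z) => [z' -> |-> //]; rewrite lift0 => h.
  by exists z'.
have mono (h : idx) : {homo h : x y / (x < y)%N} -> forall x y : 'I_m, (x <= y)%N -> (h x <= h y)%N.
  by move=> hi x y; rewrite leq_eqVlt => /orP[/eqP/val_inj -> //|/hi/ltnW].
have e_incr : {homo e : x y / (x < y)%N}.
  move=> x y xy; case: (boolP (x <= i)%N) => [/widenK [x' ex xi]|/liftK' [x' ex xi]];
   case: (boolP (y <= i)%N) => [/widenK [y' ey yi]|/liftK' [y' ey yi]].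
  - by rewrite ex ey !eg //; apply: gi; rewrite ex ey in xy.
  - rewrite ex ey eg // ef //; apply: leq_ltn_trans (mono _ gi _ _ xi) _.
    by apply: leq_trans gf (mono _ fi _ _ _); rewrite leqNgt.
  - move: xy; rewrite ex ey lift0 /= ltnNge; rewrite -leqNgt in xi.
    by rewrite (leq_trans yi) // (leq_trans xi).
  by rewrite ex ey !ef //; apply: fi; rewrite ex ey !lift0 ltnS in xy.
have x1 : exch1 i f e 1 =1 f.
  by move=> j; rewrite /exch1 perm1; case: (boolP (j < i)%N) => // /ef.
have x2 : exch2 i g e 1 =1 g.
  by move=> j; rewrite /exch2 perm1; case: ifP => // /eg.
have E1 : exch Z i f g e 1 = maxminor Z f * maxminor Z g.
  by rewrite /exch odd_perm1 mul1r (eq_maxminor Z x1) (eq_maxminor Z x2).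
pose H := [pred t : 'S_m.+1 | keeps_blocks i t].
pose c := #|H|%:R : K.
have c0 : c != 0.
  apply: natr_neq0; apply/card_gt0P; exists 1%g; rewrite inE.
  by apply/forallP => l; rewrite perm1.
have := exch_sum0 Z i f g e; rewrite (bigID H) /=.
rewrite (eq_bigr (fun=> maxminor Z f * maxminor Z g)); last first.
  by move=> t /(exch_keeps Z f g e) ->; rewrite E1.
rewrite sumr_const -/H => /eqP; rewrite addr_eq0 => /eqP sumE.
exists [seq (- c^-1 * (-1) ^+ (t : 'S_m.+1), (finfun (exch1 i f e t), finfun (exch2 i g e t))) |
  t <- [seq t <- index_enum 'S_m.+1 | ~~ H t]]; split.
  rewrite big_map big_filter /=.
  transitivity (c^-1 *: (maxminor Z f * maxminor Z g *+ #|H|)).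
    by rewrite -scaler_nat scalerA mulVf ?scale1r.
  rewrite sumE scalerN -scaleNr scaler_sumr; apply: eq_bigr => t _.
  rewrite /exch -scalerA; congr (_ *: _).
  rewrite (eq_maxminor Z (ffunE (exch1 i f e t))).
  rewrite (eq_maxminor Z (ffunE (exch2 i g e t))).
  move: (maxminor Z _) (maxminor Z _) => x y.
  by case: (odd_perm t); [rewrite !expr1 mulN1r scaleN1r | rewrite !expr0 mul1r scale1r].
move=> z /mapP [t]; rewrite mem_filter => /andP[nH _] ->{z} /=.
have s1 (t' : 'S_m.+1) : idx_sum (finfun (exch1 i f e t')) =
    (\sum_(j < m | (j < i)%N) f j + \sum_(l < m.+1 | (i < l)%N) e (t' l))%N.
  rewrite /idx_sum (bigID (fun j : 'I_m => j < i)%N) /=; congr (_ + _)%N.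
    by apply: eq_bigr => j ji; rewrite ffunE /exch1 ji.
  rewrite [RHS]big_mkcond big_ord_recl /= add0n big_mkcond; apply: eq_bigr => j _.
  rewrite ffunE /exch1 /bump /= add1n ltnS [(i <= j)%N]leqNgt.
  by case: (j < i)%N.
have s2 (t' : 'S_m.+1) : idx_sum (finfun (exch2 i g e t')) =
    (\sum_(l < m.+1 | ~~ (i < l)%N) e (t' l) + \sum_(j < m | ~~ (j <= i)%N) g j)%N.
  rewrite /idx_sum (bigID (fun j : 'I_m => j <= i)%N) /=; congr (_ + _)%N; last first.
    by apply: eq_bigr => j ji; rewrite ffunE /exch2 (negPf ji).
  rewrite [RHS]big_mkcond big_ord_recr /= ltn_ord addn0 big_mkcond; apply: eq_bigr => j _.
  by rewrite ffunE /exch2 /= [(j <= i)%N]leqNgt; case: (i < j)%N.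
have sf : idx_sum f = idx_sum (finfun (exch1 i f e 1)).
  by apply: eq_bigr => j _; rewrite ffunE x1.
have sg : idx_sum g = idx_sum (finfun (exch2 i g e 1)).
  by apply: eq_bigr => j _; rewrite ffunE x2.
split.
  rewrite sf !s1 ltn_add2l; under [X in (_ < X)%N]eq_bigr do rewrite perm1.
  exact: exch_decreases.
rewrite sf sg !s1 !s2.
have tot (t' : 'S_m.+1) : (\sum_(l < m.+1 | i < l) e (t' l) + \sum_(l < m.+1 | ~~ (i < l)) e (t' l)
   = \sum_(l < m.+1) e l)%N.
  by rewrite [RHS](reindex_inj (@perm_inj _ t')) /= [RHS](bigID (fun l : 'I_m.+1 => i < l)%N).
by have := tot t; have := tot 1%g; lia.
Qed.

Lemma straighten (W : KX -> Prop) : is_subspace W ->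
  (forall hs, idx_std hs -> W (idx_prod hs)) -> forall hs, W (idx_prod hs).
Proof.
move=> WS Wstd hs; have [k] := ubnP (idx_meas hs).
elim: k hs => // k IH hs; rewrite ltnS => hk.
have [/sort_idx_seq|] := boolP (all (fun h : idx => injectiveb h) hs); last first.
  case/allPn => h hin /(maxminor_noninj Z) h0.
  have -> : idx_prod hs = 0; last exact: subspace0 WS.
  elim: hs hin {hk} => //= h' hs IH'; rewrite inE /idx_prod big_cons => /orP[/eqP<-|/IH' e].
    by rewrite h0 mul0r.
  by rewrite -/(idx_prod hs) e mulr0.
case=> hs' [c [inc me _ ->]].
suff : W (idx_prod hs').
  case: c => [/(subspaceZ WS (-1))|]; first by rewrite scaleN1r expr1 mulN1r.
  by rewrite mul1r.
have [sd|/unsorted_split] := boolP (sorted idx_le hs'); first by apply: Wstd; rewrite /idx_std inc.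
case=> l1 [f [g [l2 [ehs' nle]]]].
have [fi gi] : idx_incr f /\ idx_incr g.
  by move: inc; rewrite ehs' all_cat /= => /and4P[].
have [T [eT hT]] := straighten_pair fi gi nle.
have -> : idx_prod hs' = \sum_(z <- T) z.1 *: idx_prod (l1 ++ z.2.1 :: z.2.2 :: l2).
  rewrite ehs' /idx_prod big_cat !big_cons /= [maxminor Z f * _]mulrA eT.
  rewrite big_distrl big_distrr /=; apply: eq_bigr => z _.
  rewrite big_cat !big_cons /=.
  move: (\prod_(_ <- l1) _) (\prod_(_ <- l2) _) (maxminor Z _) (maxminor Z _) => A B x y.
  by rewrite -scalerAl -scalerAr -[y * x * B]mulrA.
apply: (subspace_sum WS) => z zT _; apply: (subspaceZ WS); apply: IH.
apply: leq_trans hk; rewrite -me ehs'; have [lt eq] := hT z zT.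
exact: idx_meas_lt.
Qed.

End Straightening.

(** * Minors as maximal minors, and the straightening law *)
Section Prefix.

Lemma card_lt_ord t x : (x <= t)%N -> #|[pred k : 'I_t | (k < x)%N]| = x.
Proof.
move=> xt; have winj : injective (widen_ord xt) by move=> i j /(congr1 val) /= /val_inj.
rewrite -[RHS](card_ord x) -(card_imset _ winj); apply: eq_card => k; rewrite !inE.
apply/idP/imsetP => [kx|[i _ ->] /=]; last exact: ltn_ord.
by exists (Ordinal kx) => //; apply: val_inj.
Qed.

Lemma prefix_card t (P : pred 'I_t) (k : 'I_t) :
  (forall i j : 'I_t, (i <= j)%N -> P j -> P i) -> P k = (k < #|P|)%N.
Proof.
move=> down; apply/idP/idP => [Pk|].
  rewrite -(card_lt_ord (ltn_ord k)); apply: subset_leq_card; apply/subsetP => i.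
  by rewrite !inE ltnS => /down; apply.
apply: contraTT => nPk; rewrite -leqNgt.
rewrite -[X in (_ <= X)%N](card_lt_ord (ltnW (ltn_ord k))).
apply: subset_leq_card; apply/subsetP => i; rewrite !inE => Pi.
by rewrite ltnNge; apply: contra nPk => /down; apply.
Qed.

Lemma det_corner (R : comNzRingType) p t (tp : (t <= p)%N) (Y : 'M[R]_p) :
  (forall i j : 'I_p, (t <= j)%N -> Y i j = (i == j)%:R) ->
  \det Y = \det (mxsub (widen_ord tp) (widen_ord tp) Y).
Proof.
have [q e] : exists q, p = (t + q)%N by exists (p - t)%N; rewrite subnKC.
subst p => YE; rewrite -[in LHS](submxK Y).
have -> : ursubmx Y = 0.
  apply/matrixP => i j; rewrite !mxE YE ?leq_addr //.
  by rewrite eq_lrshift.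
have -> : drsubmx Y = 1%:M.
  apply/matrixP => i j; rewrite !mxE YE ?leq_addr //.
  by rewrite (inj_eq (@rshift_inj _ _)).
rewrite det_lblock det1 mulr1; congr (\det _); apply/matrixP => i j; rewrite !mxE.
by congr (Y _ _); apply: val_inj.
Qed.

End Prefix.

Section Dictionary.

Variables (K : fieldType) (m n : nat).
Notation KX := {mpoly K[m * n]}.

(** With unit columns appended, all minors of X are, up to sign, maximal minors
    of one matrix.  The unit columns come in reverse order, since deleting a
    row with small index has to count as a large column index. *)
Definition extX : 'M[KX]_(m, n + m) :=
  row_mx (genX K m n) (\matrix_(r, k) (r == rev_ord k)%:R).

Lemma extX_l i j : extX i (lshift m j) = genX K m n i j.
Proof. by rewrite row_mxEl. Qed.

Lemma extX_r i k : extX i (rshift n k) = (i == rev_ord k)%:R.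
Proof. by rewrite row_mxEr mxE. Qed.

Notation idx := {ffun 'I_m -> 'I_(n + m)}.

Definition var_idx (i : 'I_m) (j : 'I_n) : idx :=
  [ffun k => if k == i then lshift m j else rshift n (rev_ord k)].

Lemma maxminor_var i j : maxminor extX (var_idx i j) = genX K m n i j.
Proof.
have E r k : extX r (var_idx i j k) = if k == i then genX K m n r j else (r == k)%:R.
  by rewrite ffunE; case: ifP => _; rewrite ?extX_l // extX_r rev_ordK.
rewrite maxminorE (bigD1 1%g) //= odd_perm1 mul1r [X in _ + X]big1 ?addr0 => [|s s1].
  rewrite (bigD1 i) //= [X in _ * X]big1 ?mulr1 => [|k ki]; first by rewrite perm1 E eqxx.
  by rewrite perm1 E (negPf ki) eqxx.
have [k [ki ski]] : exists k, k != i /\ s k != k.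
  have [k0 sk0] : exists k, s k != k.
    apply/existsP; apply: contraNT s1; rewrite negb_exists => /forallP h.
    by apply/eqP/permP => k; rewrite perm1; apply/eqP; rewrite -[_ == _]negbK.
  have [e|] := eqVneq k0 i; last by exists k0.
  exists (s k0); rewrite -{1}e; split=> //; apply: contraNneq sk0 => /perm_inj h.
  by rewrite h.
by rewrite (bigD1 k) //= E (negPf ki) (negPf ski) mul0r mulr0.
Qed.

(** The columns of [extX] with index at least n are unit vectors; they delete
    from the determinant the rows that do not occur in the minor. *)
Definition represents (h : idx) (d : minor m n) : Prop :=
  [/\ forall x : 'I_m, (h x < n)%N = (x < msize d)%N,
      forall x : 'I_m, (x < msize d)%N -> col_at d x = h x &
      forall r : 'I_m, (exists k, mrow d k = r) <->
        (forall x, h x != rshift n (rev_ord r))].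

Definition killed (h : idx) (x : 'I_m) : 'I_m :=
  match split (h x) with inl _ => x | inr k => rev_ord k end.

Lemma split_hi (h : idx) x : (n <= h x)%N -> h x = rshift n (rev_ord (killed h x)).
Proof.
rewrite /killed; case: (split_ordP (h x)) => k -> /=.
  by rewrite leqNgt ltn_ord.
by rewrite rev_ordK.
Qed.

Lemma ltn_incr_le (h : idx) : {homo h : x y / (x < y)%N} ->
  forall x y : 'I_m, (x <= y)%N -> (h x <= h y)%N.
Proof. by move=> hi x y; rewrite leq_eqVlt => /orP[/eqP/val_inj -> //|/hi/ltnW]. Qed.

Lemma killed_inj (h : idx) : {homo h : x y / (x < y)%N} ->
  {in [pred x | (n <= h x)%N] &, injective (killed h)}.
Proof.
move=> hi x y hx hy e; apply: (incr_inj hi).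
by rewrite (split_hi hx) (split_hi hy) e.
Qed.

Lemma represents_exists (h : idx) : idx_incr h -> exists d, represents h d.
Proof.
move/idx_incrP => hi; pose t := #|[pred x | (h x < n)%N]|.
have tP (x : 'I_m) : (h x < n)%N = (x < t)%N.
  apply: (@prefix_card _ (fun x => h x < n)%N) => i j ij.
  exact: leq_ltn_trans (ltn_incr_le hi ij).
pose A := [set r : 'I_m | [forall x, h x != rshift n (rev_ord r)]].
have sz : size (enum A) == t.
  rewrite -cardE -(eqn_add2r #|~: A|) cardsC card_ord eq_sym.
  have -> : ~: A = killed h @: [pred x | (n <= h x)%N].
    apply/setP => r; rewrite !inE negb_forall; apply/existsP/imsetP.
      move=> [x]; rewrite negbK => /eqP hx; exists x; first by rewrite inE hx leq_addr.
      by apply: rev_ord_inj; apply: (@rshift_inj n); rewrite -split_hi // hx leq_addr.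
    by move=> [x hx ->]; exists x; rewrite negbK -split_hi.
  rewrite card_in_imset; last exact: killed_inj.
  rewrite -[X in _ == X](card_ord m) -(cardC [pred x | (h x < n)%N]); apply/eqP; congr (_ + _)%N.
  by apply: eq_card => x; rewrite !inE leqNgt.
have tm : (t <= m)%N by rewrite -[X in (_ <= X)%N](card_ord m); exact: max_card.
have colP (k : 'I_t) : (h (widen_ord tm k) < n)%N by rewrite tP /= ltn_ord.
pose row k := tnth (Tuple sz) k; pose col k := Ordinal (colP k).
have row_incr : {homo row : i j / (i < j)%N}.
  have srt : sorted (relpre (@nat_of_ord m) ltn) (enum A).
    rewrite {1}/enum_mem; apply: sorted_filter; first by move=> a b c; exact: ltn_trans.
    by rewrite -enumT -sorted_map val_enum_ord; exact: iota_ltn_sorted.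
  have tr : transitive (relpre (@nat_of_ord m) ltn) by move=> a b c; exact: ltn_trans.
  move=> i j ij; rewrite /row !(tnth_nth (row i)) /=.
  have := sorted_ltn_nth tr (row i) srt; rewrite /= => /(_ i j).
  by rewrite !inE (eqP sz) !ltn_ord; apply.
have col_incr : {homo col : i j / (i < j)%N} by move=> i j ij; apply: hi.
exists (Minor row_incr col_incr); split=> //=.
  move=> x xt; rewrite (col_atE (d := Minor row_incr col_incr) (Ordinal xt)) /=.
  by congr (h _ : nat); apply: val_inj.
move=> r; have memA : (r \in A) = (r \in enum A) by rewrite mem_enum.
split=> [[k <-] x|h0].
  have : row k \in A by rewrite -mem_enum; exact: mem_tnth.
  by rewrite inE => /forallP.
have : r \in Tuple sz by rewrite /= mem_enum inE; apply/forallP.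
by case/tnthP => k ->; exists k.
Qed.

Lemma represents_minor (h : idx) d : idx_incr h -> represents h d ->
  exists c : bool, maxminor extX h = (-1) ^+ c * minor_poly K d.
Proof.
move=> /idx_incrP hi [hlt hcol hrow].
pose rho0 (x : 'I_m) : 'I_m :=
  match split (h x) with inl _ => odflt x (omap (mrow d) (insub (x : nat))) | inr k =>
    rev_ord k end.
have rho_lo (k : 'I_(msize d)) : rho0 (widen_ord (msize_le_row d) k) = mrow d k.
  rewrite /rho0; case: (split_ordP _) => y hy.
    by rewrite /= valK.
  by have := hlt (widen_ord (msize_le_row d) k); rewrite hy /= ltn_ord ltnNge leq_addr.
have rho_hi (x : 'I_m) : ~~ (x < msize d)%N -> h x = rshift n (rev_ord (rho0 x)).
  rewrite -hlt /rho0; case: (split_ordP _) => y hy; rewrite hy /= ?ltn_ord //.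
  by rewrite rev_ordK.
have lo_widen (x : 'I_m) : (x < msize d)%N -> exists k, x = widen_ord (msize_le_row d) k.
  by move=> xd; exists (Ordinal xd); apply: val_inj.
have rho_inj : injective rho0.
  have mixed (x y : 'I_m) : (x < msize d)%N -> ~~ (y < msize d)%N -> rho0 x != rho0 y.
    move=> /lo_widen [k ->] /rho_hi hy; apply/eqP; rewrite rho_lo => e.
    have := (hrow (mrow d k)).1 (ex_intro _ k erefl) y.
    by rewrite hy e eqxx.
  move=> x y e; case xd: (x < msize d)%N; case yd: (y < msize d)%N.
  - have [[k ex] [l ey]] := (lo_widen _ xd, lo_widen _ yd).
    move: e; rewrite ex ey !rho_lo => /(incr_inj (@mrow_incr _ _ d)) -> //.
  - by have := mixed _ _ xd (negbT yd); rewrite e eqxx.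
  - by have := mixed _ _ yd (negbT xd); rewrite e eqxx.
  by apply: (incr_inj hi); rewrite (rho_hi _ (negbT xd)) (rho_hi _ (negbT yd)) e.
pose rho := perm rho_inj.
exists (odd_perm rho).
have -> : maxminor extX h = (-1) ^+ rho * \det (row_perm rho (colsub h extX)).
  by rewrite row_permE det_mulmx det_perm mulrA -signr_addb addbb mul1r.
have YE i j : row_perm rho (colsub h extX) i j = extX (rho0 i) (h j).
  by rewrite [LHS]mxE [LHS]mxE permE.
congr (_ * _); rewrite (det_corner (msize_le_row d)).
  congr (\det _); apply/matrixP => i j; rewrite [LHS]mxE YE rho_lo.
  rewrite [RHS]mxE -extX_l; congr (fun_of_matrix _ _ _); apply: val_inj => /=.
  by rewrite -col_atE; apply/esym/(hcol (widen_ord (msize_le_row d) j)); rewrite /= ltn_ord.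
move=> i j; rewrite leqNgt => jd; rewrite YE (rho_hi _ jd) extX_r rev_ordK.
by rewrite (inj_eq rho_inj).
Qed.

(** The rows below x are those of the minor and those deleted by the unit columns
    from n + (m - x) on. *)
Lemma card_rows_below (h : idx) d x : idx_incr h -> represents h d -> (x <= m)%N ->
  (#|[pred k : 'I_(msize d) | mrow d k < x]| + #|[pred y | n + (m - x) <= h y]| = x)%N.
Proof.
move=> /idx_incrP hi [hlt _ hrow] xm.
rewrite -[RHS](card_lt_ord xm) -(cardID (mem (mrow d @: [set: 'I_(msize d)])) [pred r :
  'I_m | (r < x)%N]).
have hiP y : (n + (m - x) <= h y)%N -> (n <= h y)%N by apply: leq_trans; rewrite leq_addr.
congr (_ + _)%N.
  rewrite -(card_imset _ (incr_inj (@mrow_incr _ _ d))); apply: eq_card => r; rewrite !inE.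
  apply/imsetP/andP => [[k] |[rx /imsetP [k _ ek]]].
    by rewrite inE => kx ->; split=> //; apply/imsetP; exists k.
  by exists k => //; rewrite inE -ek.
rewrite -(card_in_imset (f := killed h)); last first.
  by move=> y z; rewrite !inE => /hiP hy /hiP hz; apply: killed_inj.
apply: eq_card => r; rewrite !inE; apply/imsetP/andP => [[y hy ->]|[rn rx]].
  have hy' := hiP _ hy; split; last first.
    move: hy; rewrite inE (split_hi hy') /= leq_add2l.
    have := ltn_ord (killed h y); lia.
  apply/negP => /imsetP [k _ e].
  by have := (hrow (killed h y)).1 (ex_intro _ k (esym e)) y; rewrite -split_hi ?eqxx.
have /existsP [y /eqP ey] : [exists y, h y == rshift n (rev_ord r)].
  apply: contraNT rn; rewrite negb_exists => /forallP /(hrow r).2 [k ek].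
  by apply/imsetP; exists k.
exists y.
  rewrite inE ey /= leq_add2l; have := ltn_ord r; lia.
by apply: rev_ord_inj; apply: (@rshift_inj n); rewrite -split_hi ey //= leq_addr.
Qed.

Lemma represents_le (f g : idx) d e : idx_incr f -> idx_incr g ->
  represents f d -> represents g e -> idx_le f g -> minor_le d e.
Proof.
move=> fi gi rd re /forallP fg.
have [flt fcol frow] := rd; have [glt gcol grow] := re.
have ed : (msize e <= msize d)%N.
  rewrite leqNgt; apply/negP => de.
  have dm := leq_trans de (msize_le_row e).
  have := flt (Ordinal dm); rewrite /= ltnn => /negbT; apply/negP; rewrite negbK.
  by apply: leq_ltn_trans (fg _) _; rewrite glt.
rewrite /minor_le ed /=; apply/forallP => i; apply/forallP => j; apply/implyP => /eqP ij.
apply/andP; split; last first.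
  pose x := widen_ord (msize_le_row e) j.
  have h1 : col_at e j = g x := gcol x (ltn_ord j).
  have h2 : col_at d j = f x := fcol x (leq_trans (ltn_ord j) ed).
  by rewrite -!col_atE ij h1 h2.
have below (c : minor m n) (k : 'I_(msize c)) z :
    (mrow c k < z)%N = (k < #|[pred k : 'I_(msize c) | mrow c k < z]|)%N.
  apply: (@prefix_card _ (fun k => mrow c k < z)%N) => a b ab.
  apply: leq_ltn_trans; move: ab; rewrite leq_eqVlt => /orP[/eqP/val_inj -> //|].
  by move/(@mrow_incr _ _ c)/ltnW.
have xm : ((mrow e j).+1 <= m)%N by exact: ltn_ord.
rewrite -ltnS below ij.
have := below e j (mrow e j).+1; rewrite ltnSn => /esym h.
apply: leq_trans h _.
have := card_rows_below fi rd xm; have := card_rows_below gi re xm.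
have : (#|[pred y | n + (m - (mrow e j).+1) <= f y]|
        <= #|[pred y | n + (m - (mrow e j).+1) <= g y]|)%N.
  apply: subset_leq_card; apply/subsetP => y; rewrite !inE => /leq_trans; apply; exact: fg.
move: #|_| #|_| #|_| #|_| => a b c c'; lia.
Qed.

End Dictionary.

Section Spanning.

Variables (K : fieldType) (charK : [pchar K] =i pred0) (m n : nat).
Notation KX := {mpoly K[m * n]}.

Lemma idx_std_bt (hs : seq {ffun 'I_m -> 'I_(n + m)}) : idx_std hs ->
  exists D (c : bool), is_standard D /\ idx_prod (extX K m n) hs = (-1) ^+ c * bt_poly K D.
Proof.
case/andP => inc srt.
have [D [c [sz rep pr]]] : exists D (c : bool), [/\ size D = size hs,
    (forall i, (i < size hs)%N -> represents (nth [ffun x => rshift n x] hs i) (nth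
      (empty_minor m n) D i))
    & idx_prod (extX K m n) hs = (-1) ^+ c * bt_poly K D].
  elim: hs inc {srt} => [_|h hs IH /= /andP[ih /IH [D [c [sz rep pr]]]]].
    by exists [::], false; split=> //; rewrite /idx_prod /bt_poly !big_nil mul1r.
  have [d rd] := represents_exists ih; have [c' e] := represents_minor K ih rd.
  exists (d :: D), (c' (+) c); split=> /=; rewrite ?sz //; first by case.
  rewrite /idx_prod /bt_poly !big_cons -/(idx_prod _ hs) -/(bt_poly K D) pr e signr_addb.
  by rewrite mulrACA.
exists D, c; split=> //.
have le i : (i.+1 < size D)%N -> minor_le (nth (empty_minor m n) D i) (nth (empty_minor
  m n) D i.+1).
  rewrite sz => ih; have ih' := ltnW ih.
  apply: (represents_le _ _ (rep _ ih') (rep _ ih)).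
  - exact: all_nthP inc _ ih'.
  - exact: all_nthP inc _ ih.
  exact: (sortedP _ srt).
by apply: standard_of_sorted; apply/(sortedP (empty_minor m n)).
Qed.

(** A variable is a minor of size 1, so monomials are products of maximal minors
    of [extX], and these can be straightened. *)
Theorem standard_span (p : KX) :
  lin_span (fun q : KX => exists2 D, is_standard D & q = bt_poly K D) p.
Proof.
set W := lin_span _; have WS : is_subspace W := lin_span_subspace _.
have Wprod hs : W (idx_prod (extX K m n) hs).
  apply: (straighten charK WS) => {}hs /idx_std_bt [D [c [sD ->]]].
  have WD : W (bt_poly K D) by apply: lin_span_gen; exists D.
  case: c; last by rewrite mul1r.
  by have := subspaceZ WS (-1) WD; rewrite scaleN1r expr1 mulN1r.
rewrite [p]mpolyE; apply: (subspace_sum WS) => u _ _; apply: (subspaceZ WS).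
suff [hs ->] : exists hs, 'X_[u] = idx_prod (extX K m n) hs by exact: Wprod.
rewrite mpolyXE_id; elim/big_rec: _ => [|k y _ [hs ->]].
  by exists [::]; rewrite /idx_prod big_nil.
case/mxvec_indexP: k => i j; elim: (u _) => [|v [hs' e]].
  by exists hs; rewrite expr0 mul1r.
exists (var_idx i j :: hs'); rewrite exprS -mulrA e /idx_prod big_cons maxminor_var.
by rewrite mxE.
Qed.

End Spanning.

(** * Extracting coefficients from values *)
Section Coefficients.

Variables (K : fieldType) (charK : [pchar K] =i pred0).

Lemma natr_inj_char0 : injective (fun k : nat => k%:R : K).
Proof.
have wlog_le a b : (a <= b)%N -> a%:R = b%:R :> K -> a = b.
  move=> ab /eqP; rewrite eq_sym -subr_eq0 -natrB // ((pcharf0P K).1 charK) subn_eq0 => ba.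
  by apply/eqP; rewrite eqn_leq ab.
by move=> a b /= e; case/orP: (leq_total a b) => h; [|apply/esym]; apply: wlog_le.
Qed.

Lemma poly_nonroots (r : {poly K}) J : r != 0 ->
  exists a : 'I_J -> K, injective a /\ forall i, r.[a i] != 0.
Proof.
move=> r0; pose s := [seq (k%:R : K) | k <- iota 0 (J + size r)].
have us : uniq s by rewrite map_inj_uniq ?iota_uniq //; exact: natr_inj_char0.
pose s1 := [seq x <- s | ~~ root r x].
have sz : (J <= size s1)%N.
  have lt : (size [seq x <- s | root r x] < size r)%N.
    by apply: max_poly_roots => //; [exact: filter_all | exact: filter_uniq].
  have : size s = (size [seq x <- s | root r x] + size s1)%N.
    by rewrite !size_filter count_predC.
  rewrite size_map size_iota; move: lt; move: (size _) (size s1) (size r) => a b c; lia.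
exists (fun i => nth 0 s1 i); split=> [i j /eqP|i].
  rewrite nth_uniq ?(leq_trans (ltn_ord _) sz) ?filter_uniq // => /eqP; exact: val_inj.
have : nth 0 s1 i \in s1 by apply: mem_nth; exact: leq_trans (ltn_ord i) sz.
by rewrite mem_filter => /andP[].
Qed.

(** The coefficients of a polynomial with vector coefficients are linear
    combinations of its values, by inverting a Vandermonde matrix. *)
Lemma subspace_coef (V : lmodType K) (W : V -> Prop) (WS : is_subspace W)
    (r : {poly K}) J (c : 'I_J -> V) : r != 0 ->
  (forall z, r.[z] != 0 -> W (\sum_(j < J) z ^+ j *: c j)) -> forall j, W (c j).
Proof.
move=> r0 H j; have [a [inj_a ra]] := poly_nonroots J r0.
pose M := Vandermonde J (\row_i a i).
have uM : M \in unitmx.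
  rewrite unitmxE unitfE det_Vandermonde; apply/prodf_neq0 => i _; apply/prodf_neq0 => k ik.
  by rewrite !mxE subr_eq0 (inj_eq inj_a) -val_eqE eq_sym (ltn_eqF ik).
have MV (l k : 'I_J) : \sum_i invmx M i k * a i ^+ l = (l == k)%:R.
  have <- : (M *m invmx M) l k = (l == k)%:R by rewrite mulmxV // mxE.
  by rewrite mxE; apply: eq_bigr => i _; rewrite [M l i]mxE mxE mulrC.
have -> : c j = \sum_i (invmx M i j) *: (\sum_(l < J) a i ^+ l *: c l).
  under eq_bigr do rewrite scaler_sumr.
  rewrite exchange_big (bigD1 j) //= [X in _ + X]big1 ?addr0 => [|l lj].
    under eq_bigr do rewrite scalerA.
    by rewrite -scaler_suml MV eqxx scale1r.
  under eq_bigr do rewrite scalerA.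
  by rewrite -scaler_suml MV (negPf lj) scale0r.
by apply: (subspace_sum WS) => i _ _; apply: (subspaceZ WS); apply: H.
Qed.

Lemma digits_inj b N (u v : 'I_N -> nat) :
  (forall k, u k < b)%N -> (forall k, v k < b)%N ->
  (\sum_(k < N) u k * b ^ k = \sum_(k < N) v k * b ^ k)%N -> u =1 v.
Proof.
elim: N u v => [|N IH] u v ub vb; first by move=> _ [].
have E (w : 'I_N.+1 -> nat) : (\sum_(k < N.+1) w k * b ^ k = w ord0 + b * \sum_(k < N)
  w (lift ord0 k) * b ^ k)%N.
  rewrite big_ord_recl expn0 muln1 big_distrr; congr (_ + _)%N.
  by apply: eq_bigr => k _; rewrite lift0 expnS mulnCA.
rewrite !E => e; have b0 : (0 < b)%N by exact: leq_ltn_trans (ub ord0).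
have e0 : u ord0 = v ord0.
  by have := congr1 (modn^~ b) e;
    rewrite /= ![(b * _)%N]mulnC ![(_ ord0 + _)%N]addnC !modnMDl !modn_small.
have e1 : (\sum_(k < N) u (lift ord0 k) * b ^ k = \sum_(k < N) v (lift ord0 k) * b ^ k)%N.
  by move/eqP: e; rewrite e0 eqn_add2l eqn_pmul2l // => /eqP.
move=> k; case: (unliftP ord0 k) => [k' ->|-> //].
by apply: (IH (fun k => u (lift ord0 k)) (fun k => v (lift ord0 k))).
Qed.

Section Kronecker.

Variables (q N : nat).
Notation V := {mpoly K[q]}.

Definition kron (b : nat) (u : 'X_{1..N}) : nat := (\sum_(k < N) u k * b ^ k)%N.

Lemma kron_inj b (u v : 'X_{1..N}) : (mdeg u < b)%N -> (mdeg v < b)%N ->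
  kron b u = kron b v -> u = v.
Proof.
have le (w : 'X_{1..N}) k : (w k <= mdeg w)%N by rewrite mdegE (bigD1 k) //= leq_addr.
move=> ub vb e; apply/mnmP; apply: digits_inj e => k.
  exact: leq_ltn_trans (le _ _) ub.
exact: leq_ltn_trans (le _ _) vb.
Qed.

Lemma kron_prod (S : comNzRingType) (z : S) b (u : 'X_{1..N}) :
  \prod_(k < N) (z ^+ (b ^ k)) ^+ u k = z ^+ kron b u.
Proof.
by rewrite /kron expr_sum; apply: eq_bigr => k _; rewrite -exprM mulnC.
Qed.

(** Kronecker substitution x_k = z^(b^k) reduces to one variable: for large b
    it separates the monomials, and d stays nonzero. *)
Lemma subspace_mcoeff (W : V -> Prop) (WS : is_subspace W) (P : {mpoly V[N]})
    (d : {mpoly K[N]}) : d != 0 ->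
  (forall x : 'I_N -> K, d.@[x] != 0 -> W (P.@[fun k => (x k)%:MP])) ->
  forall u, W (P@_u).
Proof.
move=> d0 H u.
have [uP|/memN_msupp_eq0 ->] := boolP (u \in msupp P); last exact: subspace0 WS.
pose b := (mmeasure mdeg P + mmeasure mdeg d)%N.
have Pb v : v \in msupp P -> (mdeg v < b)%N.
  by move/msize_mdeg_lt => h; exact: leq_trans h (leq_addr _ _).
have db v : v \in msupp d -> (mdeg v < b)%N.
  by move/msize_mdeg_lt => h; exact: leq_trans h (leq_addl _ _).
pose r : {poly K} := \sum_(v <- msupp d) d@_v *: 'X^(kron b v).
have r0 : r != 0.
  have [v0 v0d] : exists v, v \in msupp d.
    case E : (msupp d) => [|v s]; last by exists v; rewrite mem_head.
    by move/eqP: E; rewrite msupp_eq0 (negPf d0).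
  apply: contraTneq v0d => r0; rewrite -mcoeff_eq0.
  have := congr1 (fun q0 : {poly K} => q0`_(kron b v0)) r0.
  rewrite /= coef0 /r coef_sum => /eqP; rewrite mcoeff_eq0; apply: contraLR.
  rewrite negbK => v0d; rewrite (bigD1_seq v0) //= big1_seq => [|v /andP[vv0 vd]].
    by rewrite addr0 coefZ coefXn eqxx mulr1 -mcoeff_msupp.
  rewrite coefZ coefXn; case: eqP => [/(kron_inj (db _ v0d) (db _ vd)) e|_].
    by rewrite e eqxx in vv0.
  by rewrite mulr0.
pose J := (\max_(v <- msupp P) kron b v).+1.
have ltJ v : v \in msupp P -> (kron b v < J)%N by move=> vP; rewrite ltnS; exact: leq_bigmax_seq.
pose c (j : 'I_J) : V := \sum_(v <- msupp P | kron b v == j) P@_v.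
have -> : P@_u = c (Ordinal (ltJ u uP)).
  rewrite /c big_mkcond (bigD1_seq u) //= eqxx big1_seq ?addr0 // => v /andP[vu vP].
  by case: eqP => // /(kron_inj (Pb _ vP) (Pb _ uP)) e; rewrite e eqxx in vu.
apply: (subspace_coef WS r0) => z rz.
pose x (k : 'I_N) : K := z ^+ (b ^ k).
have dx : d.@[x] = r.[z].
  rewrite mevalE /r horner_sum; apply: eq_bigr => v _.
  by rewrite kron_prod hornerZ hornerXn.
have -> : \sum_(j < J) z ^+ j *: c j = P.@[fun k => (x k)%:MP]; last by apply: H; rewrite dx.
rewrite mevalE; under eq_bigr do rewrite /c scaler_sumr.
rewrite (exchange_big_dep predT) //= big_seq [RHS]big_seq; apply: eq_bigr => v vP.
rewrite (big_pred1 (Ordinal (ltJ v vP))) => [|j];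
  last by rewrite /= -[RHS](inj_eq val_inj) /= eq_sym.
rewrite (eq_bigr (fun k : 'I_N => (z%:MP ^+ (b ^ k)) ^+ v k)); last first.
  by move=> k _; rewrite /x rmorphXn.
by rewrite kron_prod -rmorphXn mulrC mul_mpolyC.
Qed.

End Kronecker.
End Coefficients.

(** * Gram matrices *)
Section Gram.

Lemma trmx_mul_eq0 p q (M : 'M[rat]_(p, q)) : M^T *m M = 0 -> M = 0.
Proof.
move=> e; apply/matrixP => i j; rewrite mxE.
have := congr1 (fun A : 'M_q => A j j) e; rewrite !mxE.
under eq_bigr do rewrite mxE -expr2.
move/eqP; rewrite psumr_eq0 => [/allP/(_ i (mem_index_enum i))|k _]; last exact: sqr_ge0.
by rewrite sqrf_eq0 => /eqP.
Qed.

(** Over the rationals M and its Gram matrix have the same row space, since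
    M v = 0 follows from v^T M^T M v = 0. *)
Lemma sub_gram p q (M : 'M[rat]_(p, q)) : (M <= M^T *m M)%MS.
Proof.
rewrite submxE; apply/eqP; set W := cokermx _.
have MW : M^T *m M *m W = 0 by exact: mulmx_coker.
by apply: trmx_mul_eq0; rewrite trmx_mul -mulmxA [M^T *m _]mulmxA MW mulmx0.
Qed.

Lemma clear_denominators q (D : 'I_q -> rat) :
  exists (N0 : int) (l : 'I_q -> int), N0 != 0 /\ forall j, (l j)%:~R = N0%:~R * D j.
Proof.
exists (\prod_j denq (D j)), (fun j => numq (D j) * \prod_(k | k != j) denq (D k)).
split=> [|j]; first by apply/prodf_neq0 => j _; exact: denq_neq0.
rewrite [in RHS](bigD1 j) //= !rmorphM /= numqE.
by rewrite [in RHS]mulrAC [D j * _]mulrC.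
Qed.

(** The matrix M has the coefficients of the members of L as rows.  A member is
    a row of M, so that a nonzero multiple of it is an integral combination of
    the rows of the Gram matrix; the integers carry over to any field of
    characteristic zero. *)
Lemma gram_mpoly N (L : seq {mpoly int[N]}) (u0 : {mpoly int[N]}) : u0 \in L ->
  exists (N0 : int) (T : seq 'X_{1..N}) (l : 'X_{1..N} -> int), N0 != 0 /\
    forall v, N0 * u0@_v = \sum_(t <- T) l t * \sum_(u <- L) u@_t * u@_v.
Proof.
move=> u0L; pose T := undup (flatten [seq msupp u | u <- L]).
have TP u v : u \in L -> v \notin T -> u@_v = 0.
  move=> uL; rewrite mem_undup => vT; apply: memN_msupp_eq0; apply: contra vT => vu.
  by apply/flatten_mapP; exists u.
pose p := size L; pose q := size T.
pose M : 'M[rat]_(p, q) := \matrix_(i, j) ((nth 0 L i)@_(nth 0%MM T j))%:~R.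
have /submxP [D MD] := sub_gram M.
have i0P : (index u0 L < p)%N by rewrite index_mem.
pose i0 := Ordinal i0P.
have [N0 [l0 [N00 l0P]]] := clear_denominators (D i0).
pose l t := if insub (index t T) is Some j then l0 j else 0.
exists N0, T, l; split=> // v.
have [vT|vT] := boolP (v \in T); last first.
  rewrite (TP _ _ u0L vT) mulr0 big1 // => t _; rewrite big1_seq ?mulr0 // => u /= uL.
  by rewrite (TP _ _ uL vT) mulr0.
have jP : (index v T < q)%N by rewrite index_mem.
have := congr1 (fun A : 'M_(p, q) => A i0 (Ordinal jP)) MD.
rewrite [LHS]mxE /= !nth_index // => e.
apply/eqP; rewrite -(eqr_int rat) rmorphM /= e; apply/eqP.
rewrite mxE big_distrr /= rmorph_sum /= (big_nth 0%MM) big_mkord.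
apply: eq_bigr => j _; rewrite mulrA -l0P.
have -> : l (nth 0%MM T j) = l0 j.
  by rewrite /l index_uniq ?undup_uniq // valK.
rewrite rmorphM /=; congr (_ * _); rewrite mxE rmorph_sum /= (big_nth 0) big_mkord.
apply: eq_bigr => i _; rewrite !mxE /= nth_index // rmorphM //.
Qed.

End Gram.

Section Support.

Variables (S : comNzRingType) (N : nat).
Implicit Types P Q : {mpoly S[N]}.

Definition supp_in (U : 'X_{1..N} -> Prop) P := forall u, P@_u != 0 -> U u.

Lemma supp_inD U P Q : supp_in U P -> supp_in U Q -> supp_in U (P + Q).
Proof.
move=> hP hQ u; rewrite mcoeffD; case: (eqVneq P@_u 0) => [->|/hP //].
by rewrite add0r => /hQ.
Qed.

Lemma supp_inZ U a P : supp_in U P -> supp_in U (a *: P).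
Proof.
move=> hP u; rewrite mcoeffZ => ne; apply: hP; apply: contraNneq ne => ->.
by rewrite mulr0.
Qed.

Lemma supp_in_sum (I : Type) (r : seq I) (F : I -> {mpoly S[N]}) (C : pred I) U :
  (forall i, C i -> supp_in U (F i)) -> supp_in U (\sum_(i <- r | C i) F i).
Proof.
move=> h; elim/big_rec: _ => [u|i P Ci hP]; first by rewrite mcoeff0 eqxx.
exact: (supp_inD (h i Ci) hP).
Qed.

Lemma supp_inM (U U' U'' : 'X_{1..N} -> Prop) P Q :
  (forall u v, U u -> U' v -> U'' (u + v)%MM) ->
  supp_in U P -> supp_in U' Q -> supp_in U'' (P * Q).
Proof. by move=> h hP hQ u /mcoeffM_neq0 [v [w [/hP Uv /hQ Uw ->]]]; exact: h. Qed.

Lemma supp_inX U v : U v -> supp_in U ('X_[v] : {mpoly S[N]}).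
Proof. by move=> Uv u; rewrite mcoeffX; case: (v =P u) => [<- //|_]; rewrite eqxx. Qed.

Lemma supp_inW (U U' : 'X_{1..N} -> Prop) P :
  (forall u, U u -> U' u) -> supp_in U P -> supp_in U' P.
Proof. by move=> h hP u /hP /h. Qed.

End Support.

(** * The action of GL on bitableaux *)
Section Points.

Variables (K : fieldType) (m n : nat).
Notation N := (m * m + n * n)%N.

Definition ptA (x : 'I_N -> K) : 'M[K]_m := \matrix_(i, k) x (varA n i k).
Definition ptB (x : 'I_N -> K) : 'M[K]_n := \matrix_(i, k) x (varB m i k).

Definition point (A : 'M[K]_m) (B : 'M[K]_n) (v : 'I_N) : K :=
  match split v with inl k => mxvec A 0 k | inr k => mxvec B 0 k end.

Lemma ptA_point A B : ptA (point A B) = A.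
Proof. by apply/matrixP => i k; rewrite mxE /point (unsplitK (inl _)) mxvecE. Qed.

Lemma ptB_point A B : ptB (point A B) = B.
Proof. by apply/matrixP => i k; rewrite mxE /point (unsplitK (inr _)) mxvecE. Qed.

Lemma meval_genA x : map_mx (meval x) (genA m n K) = ptA x.
Proof. by apply/matrixP => i k; rewrite !mxE mevalXU. Qed.

Lemma meval_genB x : map_mx (meval x) (genB m n K) = ptB x.
Proof. by apply/matrixP => i k; rewrite !mxE mevalXU. Qed.

Definition gen_det : {mpoly K[N]} := \det (genA m n K) * \det (genB m n K).

Lemma meval_gen_det x : gen_det.@[x] = \det (ptA x) * \det (ptB x).
Proof. by rewrite mevalM -!det_map_mx meval_genA meval_genB. Qed.

Lemma gen_det_neq0 : gen_det != 0.
Proof.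
apply/eqP => e; have := meval_gen_det (point 1%:M 1%:M).
by rewrite e meval0 ptA_point ptB_point !det1 mulr1 => /esym/eqP; rewrite oner_eq0.
Qed.

Lemma gen_det_unit x : gen_det.@[x] != 0 -> ptA x \in unitmx /\ ptB x \in unitmx.
Proof. by rewrite meval_gen_det mulf_eq0 negb_or !unitmxE !unitfE => /andP[]. Qed.

End Points.

Section StableIdeals.

Variables (K : fieldType) (charK : [pchar K] =i pred0) (m n : nat).
Notation N := (m * m + n * n)%N.
Notation KX := {mpoly K[m * n]}.
Variables (I : KX -> Prop) (idI : is_ideal I) (GLI : GL_stable I).

Lemma ideal_subspace : is_subspace I.
Proof.
split=> [|x y Ix Iy|a x Ix]; first exact: ideal0 idI.
  exact: (idealD idI Ix Iy).
by rewrite -mul_mpolyC; exact: (idealM idI).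
Qed.

(** The value of p at A X B^T lies in I for all invertible A and B, so the
    coefficients with respect to generic A and B lie in I. *)
Lemma sandwich_coef (p : KX) u : I p ->
  I (subst_mx (@mpolyC N KX \o @mpolyC (m * n) K) (sandwich (genX K m n)) p)@_u.
Proof.
move=> Ip; apply: (subspace_mcoeff charK ideal_subspace (gen_det_neq0 K m n)) => x dx.
have [uA uB] := gen_det_unit dx.
have -> : (subst_mx (@mpolyC N KX \o @mpolyC (m * n) K) (sandwich (genX K m n))
  p).@[fun k => (x k)%:MP]
   = GL_act (ptA x) (invmx (ptB x)^T) p; last by apply: GLI; rewrite ?unitmx_inv ?unitmx_tr.
rewrite GL_actE invmxK [LHS]rmorph_subst_mx.
have -> : map_mx (meval (fun k => (x k)%:MP)) (sandwich (genX K m n)) =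
    map_mx (@mpolyC (m * n) K) (ptA x) *m genX K m n *m map_mx (@mpolyC (m * n) K) (ptB x)^T.
  set ev := meval _.
  have eA : map_mx ev (genA m n KX) = map_mx (@mpolyC (m * n) K) (ptA x).
    by apply/matrixP => i k; rewrite [LHS]mxE [RHS]mxE /ptA /genA !mxE /ev mevalXU.
  have eB : map_mx ev (genB m n KX)^T = map_mx (@mpolyC (m * n) K) (ptB x)^T.
    by apply/matrixP => i k; rewrite [LHS]mxE [RHS]mxE /ptB /genB !mxE /ev mevalXU.
  have eX : map_mx ev (map_mx (@mpolyC N KX) (genX K m n)) = genX K m n.
    by apply/matrixP => i k; rewrite 2!mxE /ev mevalC.
  by rewrite /sandwich 2!map_mxM eA eX eB.
by rewrite /subst_mx /mmap; apply: eq_bigr => v _; rewrite /= mevalC.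
Qed.

(** The product of the top left minors, the highest weight vector of shape s. *)
Definition canonical (s : seq nat) : KX := \prod_(k <- s) cminor (genX K m n) k.

(** The canonical product of the same shape is the leading coefficient of the
    bitableau at A X B^T. *)
Lemma canonical_of_bt (D : seq (minor m n)) :
  I (bt_poly K D) -> I (canonical (bt_shape D)).
Proof.
move=> /(sandwich_coef (lead D)).
by have [-> _] := has_lead_bt (@mpolyC N KX \o @mpolyC (m * n) K) (genX K m n) D.
Qed.

End StableIdeals.

Section TopParts.

Variables (K : fieldType) (m n : nat).
Notation N := (m * m + n * n)%N.
Notation KX := {mpoly K[m * n]}.

Definition shape_ge (s : seq nat) (u : 'X_{1..N}) : Prop :=
  forall t, (gamma t.+1 s <= statA m t u)%N.
Definition shape_gt (s : seq nat) (u : 'X_{1..N}) : Prop :=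
  shape_ge s u /\ exists t, (gamma t.+1 s < statA m t u)%N.

Lemma gamma_cat t s s' : gamma t (s ++ s') = (gamma t s + gamma t s')%N.
Proof. by rewrite /gamma big_cat. Qed.

Lemma gamma_cons t k s : gamma t.+1 (k :: s) = (k - t + gamma t.+1 s)%N.
Proof. by rewrite /gamma big_cons subSS. Qed.

Lemma shape_geD s s' u u' : shape_ge s u -> shape_ge s' u' ->
  shape_ge (s ++ s') (u + u')%MM.
Proof. by move=> h h' t; rewrite gamma_cat statAD leq_add. Qed.

Lemma shape_gtD_l s s' u u' : shape_gt s u -> shape_ge s' u' ->
  shape_gt (s ++ s') (u + u')%MM.
Proof.
move=> [h [t ht]] h'; split; first exact: shape_geD.
by exists t; rewrite gamma_cat statAD -addSn leq_add.
Qed.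

Lemma shape_gtD_r s s' u u' : shape_ge s u -> shape_gt s' u' ->
  shape_gt (s ++ s') (u + u')%MM.
Proof.
move=> h [h' [t ht]]; split; first exact: shape_geD.
by exists t; rewrite gamma_cat statAD -addnS leq_add.
Qed.

Lemma shape_gt_up s : stat_up (shape_gt s).
Proof.
move=> v u h [ge [t lt]]; split=> [t'|]; first exact: leq_trans (ge t') (h m t').1.
by exists t; exact: leq_trans lt (h m t).1.
Qed.

Lemma shape_ge_up s : stat_up (shape_ge s).
Proof. by move=> v u h ge t; exact: leq_trans (ge t) (h m t).1. Qed.

Definition intK (u : {mpoly int[N]}) : {mpoly K[N]} := map_mpoly intr u.

HB.instance Definition _ := GRing.RMorphism.copy intK (map_mpoly intr).

(** The part of the degeneration of q in the lowest degrees that a product of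
    shape s can have.  For products of minors it has integral coefficients. *)
Definition top_part (s : seq nat) (q : KX) (u : {mpoly int[N]}) : Prop :=
  supp_in (shape_gt s) (degen q - intK u) /\ supp_in (shape_ge s) (intK u).

Lemma top_partM s s' q q' u u' : top_part s q u -> top_part s' q' u' ->
  top_part (s ++ s') (q * q') (u * u').
Proof.
move=> [gt ge] [gt' ge']; split; last first.
  by rewrite rmorphM; apply: supp_inM ge ge' => a b; exact: shape_geD.
have geq' : supp_in (shape_ge s') (degen q').
  rewrite -[degen q'](subrK (intK u')).
  have gtge a : shape_gt s' a -> shape_ge s' a by case.
  have h := supp_inW gtge gt'; exact: (supp_inD h ge').
have -> : degen (q * q') - intK (u * u') =
    (degen q - intK u) * degen q' + intK u * (degen q' - intK u').
  rewrite !rmorphM /=; move: (degen q) (degen q') (intK u) (intK u') => a b c d.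
  by rewrite mulrBl mulrBr addrA subrK.
apply: supp_inD.
  by apply: supp_inM gt geq' => a b; exact: shape_gtD_l.
by apply: supp_inM ge gt' => a b; exact: shape_gtD_r.
Qed.

Lemma top_part1 : top_part [::] 1 1.
Proof.
split; first by rewrite !rmorph1 subrr => u; rewrite mcoeff0 eqxx.
rewrite rmorph1 => u; rewrite mcoeff1; case: (u =P 0%MM) => [-> _ t|_]; last by rewrite eqxx.
by rewrite /gamma big_nil.
Qed.

Definition det_pair (R : comNzRingType) s (sm : (s <= m)%N) (sn : (s <= n)%N)
    (A : 'M[R]_m) (B : 'M[R]_n) (f : 'I_s -> 'I_m) (g : 'I_s -> 'I_n) : R :=
  \det (mxsub f (widen_ord sm) A) * \det (mxsub g (widen_ord sn) B).


Lemma prod_varA (R : comNzRingType) s (f c : 'I_s -> 'I_m) :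
  \prod_i genA m n R (f i) (c i) = 'X_[(\sum_i U_(varA n (f i) (c i)))%MM].
Proof.
rewrite (big_morph _ (@mpolyXD _ _) (mpolyX0 _ _)).
by apply: eq_bigr => k _; rewrite !mxE.
Qed.

Lemma statA_sum_varA t s (f c : 'I_s -> 'I_m) :
  statA m t (\sum_i U_(varA n (f i) (c i)))%MM = (\sum_(i < s) (t <= c i))%N.
Proof.
by rewrite statA_sum; apply: eq_bigr => i _; rewrite statA_varA ltn_ord.
Qed.

Lemma shape_ge1 s u : shape_ge [:: s] u <-> forall t, (s - t <= statA m t u)%N.
Proof.
by split=> h t; move: (h t); rewrite gamma_cons /gamma big_nil addn0.
Qed.

Lemma shape_ge_inj s (f c : 'I_s -> 'I_m) v : injective c ->
  shape_ge [:: s] ((\sum_i U_(varA n (f i) (c i)))%MM + v)%MM.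
Proof.
move=> ic; apply/shape_ge1 => t; rewrite statAD statA_sum_varA.
apply: leq_trans (leq_addr _ _); rewrite -sum_ord_geq.
have := @card_incr_min s s m id c s t (fun i j h => h) ic.
under eq_bigr do rewrite ltn_ord; under [X in (_ <= X)%N]eq_bigr do rewrite ltn_ord.
exact.
Qed.

(** In a minor of A J B^T the lowest degrees are those terms that use only the
    first s columns of A, and these form a product of two determinants. *)
Lemma top_part_minor s (sm : (s <= m)%N) (sn : (s <= n)%N)
    (f : 'I_s -> 'I_m) (g : 'I_s -> 'I_n) :
  top_part [:: s] (\det (mxsub f g (genX K m n)))
    (det_pair sm sn (genA m n int) (genB m n int) f g).
Proof.
have intA : map_mx intK (genA m n int) = genA m n K.
  by apply/matrixP => i j; rewrite !mxE /intK map_mpolyX.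
have intB : map_mx intK (genB m n int) = genB m n K.
  by apply/matrixP => i j; rewrite !mxE /intK map_mpolyX.
rewrite /top_part; set uu := intK _.
have -> : uu = det_pair sm sn (genA m n K) (genB m n K) f g.
  have dA : intK (\det (mxsub f (widen_ord sm) (genA m n int))) =
      \det (mxsub f (widen_ord sm) (genA m n K)) by rewrite -intA -map_mxsub det_map_mx.
  have dB : intK (\det (mxsub g (widen_ord sn) (genB m n int))) =
      \det (mxsub g (widen_ord sn) (genB m n K)) by rewrite -intB -map_mxsub det_map_mx.
  by rewrite /uu /det_pair -dA -dB; exact: rmorphM.
pose J := map_mx (@mpolyC N K) (eye K m n) *m (genB m n K)^T.
pose T (c : {ffun 'I_s -> 'I_m}) : {mpoly K[N]} :=
  (\prod_i genA m n K (f i) (c i)) * \det (mxsub c g J).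
have degE : degen (\det (mxsub f g (genX K m n))) = \sum_c T c.
  rewrite [LHS]subst_mx_det.
  have -> : mxsub f g (sandwich (eye K m n)) = rowsub f (genA m n K) *m colsub g J.
    rewrite /sandwich -mulmxA; apply/matrixP => i j.
    rewrite [LHS]mxE [LHS]mxE [RHS]mxE; apply: eq_bigr => k _.
    by rewrite [rowsub _ _ _ _]mxE [colsub _ _ _ _]mxE.
  rewrite det_mulmx_sum; apply: eq_bigr => c _; congr (_ * _).
    by apply: eq_bigr => i _; rewrite mxE.
  by congr (\det _); apply/matrixP => i j; rewrite !mxE.
have Tinj (c : {ffun 'I_s -> 'I_m}) : T c != 0 -> injective c.
  move=> Tc; apply/injectiveP; apply: contraNT Tc => /det_mxsub_noninj_row e.
  by rewrite /T e mulr0.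
pose low (c : {ffun 'I_s -> 'I_m}) := [forall i, (c i < s)%N].
have detE : det_pair sm sn (genA m n K) (genB m n K) f g = \sum_(c | low c) T c.
  rewrite /det_pair.
  have -> : \det (mxsub g (widen_ord sn) (genB m n K)) = \det (mxsub (widen_ord sm) g J).
    rewrite -det_tr; congr (\det _); apply/matrixP => i j; rewrite !mxE.
    rewrite (bigD1 (widen_ord sn i)) //= !mxE eqxx mul1r big1 ?addr0 // => k ki.
    rewrite !mxE /=; have -> : (i == k :> nat) = false; last by rewrite mpolyC0 mul0r.
    by apply: contraNF ki => /eqP ik; apply/eqP/val_inj.
  rewrite -det_mulmx.
  rewrite det_mulmx_sum.
  pose h (c : {ffun 'I_s -> 'I_s}) := [ffun i => widen_ord sm (c i)].
  have hinj : injective h.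
    move=> c c' /ffunP e; apply/ffunP => i; apply: val_inj.
    by have := congr1 val (e i); rewrite !ffunE.
  rewrite (reindex_onto h (fun c : {ffun 'I_s -> 'I_m} => [ffun i => insubd i (c i :
    nat)])) /=; last first.
    move=> c /forallP lc; apply/ffunP => i; rewrite !ffunE; apply: val_inj => /=.
    by rewrite val_insubd lc.
  apply: eq_big => [c|c _]; last first.
    rewrite /T; congr (_ * _); first by apply: eq_bigr => i _; rewrite mxE ffunE.
    congr (\det _); apply/matrixP => i j.
    by rewrite [LHS]mxE [LHS]mxE [RHS]mxE ffunE.
  apply/esym/andP; split.
    by apply/forallP => i; rewrite ffunE /= ltn_ord.
  by apply/eqP; apply/ffunP => i; rewrite !ffunE; apply: val_inj; rewrite val_insubd /= ltn_ord.
have Tge c : supp_in (shape_ge [:: s]) (T c).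
  have [->|/Tinj ic] := eqVneq (T c) 0; first by move=> u; rewrite mcoeff0 eqxx.
  rewrite /T prod_varA;
    apply: (@supp_inM _ _ (fun u => u = (\sum_i U_(varA n (f i) (c i)))%MM) (fun=> True)).
  - by move=> u v -> _; exact: shape_ge_inj.
  - exact: supp_inX.
  by [].
split; last by rewrite detE; apply: supp_in_sum => c _.
rewrite degE detE (bigID low) /= addrAC subrr add0r; apply: supp_in_sum => c nlow.
have [->|/Tinj ic] := eqVneq (T c) 0; first by move=> u; rewrite mcoeff0 eqxx.
rewrite /T prod_varA;
  apply: (@supp_inM _ _ (fun u => u = (\sum_i U_(varA n (f i) (c i)))%MM) (fun=> True)).
- move=> u v -> _; split; first exact: shape_ge_inj.
  exists s; rewrite gamma_cons subnn /gamma big_nil statAD statA_sum_varA.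
  move: nlow; rewrite negb_forall => /existsP [i]; rewrite -leqNgt => ci.
  by rewrite (bigD1 i) //= ci.
- exact: supp_inX.
by [].
Qed.

End TopParts.
Arguments intK K {m n} u.

Section Orbits.

Variables (K : fieldType) (m n : nat).
Notation N := (m * m + n * n)%N.
Notation KX := {mpoly K[m * n]}.

(** The action with A transposed and without an inverse: for this choice the
    coefficients in [orbit_family] are literally the top parts. *)
Definition act (A : 'M[K]_m) (B : 'M[K]_n) (p : KX) : KX :=
  subst_mx (@mpolyC (m * n) K)
    (map_mx (@mpolyC (m * n) K) A^T *m genX K m n *m map_mx (@mpolyC (m * n) K) B) p.

HB.instance Definition _ A B := GRing.RMorphism.copy (act A B)
  (subst_mx (@mpolyC (m * n) K)
    (map_mx (@mpolyC (m * n) K) A^T *m genX K m n *m map_mx (@mpolyC (m * n) K) B)).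

Lemma cminor_genX s (sm : (s <= m)%N) (sn : (s <= n)%N) :
  cminor (genX K m n) s = \det (mxsub (widen_ord sm) (widen_ord sn) (genX K m n)).
Proof. by apply/esym/gminor_mxsub. Qed.

Lemma eval_det_pair s (sm : (s <= m)%N) (sn : (s <= n)%N) (A : 'M[K]_m) (B : 'M[K]_n)
    (f : 'I_s -> 'I_m) (g : 'I_s -> 'I_n) :
  (intK K (det_pair sm sn (genA m n int) (genB m n int) f g)).@[point A B] =
  det_pair sm sn A B f g.
Proof.
have eA : map_mx (meval (point A B) \o intK K) (genA m n int) = A.
  rewrite -[RHS](ptA_point A B) -meval_genA map_mx_comp; congr map_mx.
  by apply/matrixP => i j; rewrite !mxE /intK map_mpolyX.
have eB : map_mx (meval (point A B) \o intK K) (genB m n int) = B.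
  rewrite -[RHS](ptB_point A B) -meval_genB map_mx_comp; congr map_mx.
  by apply/matrixP => i j; rewrite !mxE /intK map_mpolyX.
have dA : (intK K (\det (mxsub f (widen_ord sm) (genA m n int)))).@[point A B] =
    \det (mxsub f (widen_ord sm) A) by rewrite -[in RHS]eA -map_mxsub det_map_mx.
have dB : (intK K (\det (mxsub g (widen_ord sn) (genB m n int)))).@[point A B] =
    \det (mxsub g (widen_ord sn) B) by rewrite -[in RHS]eB -map_mxsub det_map_mx.
rewrite /det_pair [intK K _]rmorphM mevalM -dA -dB; congr (_ * _).
Qed.

(** Products of minors of a given shape that are indexed by arbitrary index
    functions: by the Cauchy-Binet formula the orbit of the canonical product
    is a combination of them, and the coefficients, as integral polynomials in
    the entries of the group elements, are the same polynomials that occur as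
    their top parts. *)
Definition orbit_family (s : seq nat) (L : seq ({mpoly int[N]} * KX)) : Prop :=
  [/\ exists2 c : nat, (0 < c)%N & forall A B,
        c%:R *: act A B (canonical K m n s) =
        \sum_(z <- L) (intK K z.1).@[point A B] *: z.2,
      forall z, z \in L -> top_part s z.2 z.1
    & forall D, bt_shape D = s -> exists u, (u, bt_poly K D) \in L].

Lemma orbit_family1 k : (k <= m)%N -> (k <= n)%N ->
  exists L : seq ({mpoly int[N]} * KX),
  [/\ exists2 c : nat, (0 < c)%N & forall A B,
        c%:R *: act A B (cminor (genX K m n) k) =
        \sum_(z <- L) (intK K z.1).@[point A B] *: z.2,
      forall z, z \in L -> top_part [:: k] z.2 z.1
    & forall d, msize d = k -> exists u, (u, minor_poly K d) \in L].
Proof.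
move=> km kn.
pose F (f : {ffun 'I_k -> 'I_m}) (g : {ffun 'I_k -> 'I_n}) : {mpoly int[N]} * KX :=
  (det_pair km kn (genA m n int) (genB m n int) f g, \det (mxsub f g (genX K m n))).
exists [seq F f g | f <- index_enum {ffun 'I_k -> 'I_m}, g <- index_enum {ffun 'I_k -> 'I_n}].
split.
- exists (k`! * k`!)%N; first by rewrite muln_gt0 !fact_gt0.
  move=> A B; rewrite (cminor_genX km kn) /act [subst_mx _ _ _]subst_mx_det.
  pose A' := map_mx (@mpolyC (m * n) K) (colsub (widen_ord km) A)^T.
  pose B' := map_mx (@mpolyC (m * n) K) (colsub (widen_ord kn) B)^T.
  have -> : mxsub (widen_ord km) (widen_ord kn) (map_mx (@mpolyC (m * n) K) A^T *m
      genX K m n *m map_mx (@mpolyC (m * n) K) B) = A' *m genX K m n *m B'^T.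
    apply/matrixP => i j; rewrite [LHS]mxE [LHS]mxE [RHS]mxE; apply: eq_bigr => l _.
    congr (_ * _); last by rewrite !mxE.
    rewrite [LHS]mxE [RHS]mxE; apply: eq_bigr => l' _.
    by congr (_ * _); rewrite !mxE.
  rewrite -mul_mpolyC mpolyC_nat Cauchy_Binet_sum2 big_allpairs_dep /=.
  apply: eq_bigr => f _; apply: eq_bigr => g _.
  rewrite eval_det_pair -mul_mpolyC; congr (_ * _); rewrite /det_pair rmorphM.
  by congr (_ * _); rewrite -det_tr -det_map_mx; congr (\det _); apply/matrixP => i j; rewrite !mxE.
- by move=> z /allpairsP [[f g] /= [_ _ ->]]; exact: top_part_minor.
move=> d dk; subst k.
exists (det_pair km kn (genA m n int) (genB m n int) [ffun i => mrow d i] [ffun i => mcol d i]).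
apply/allpairsP; exists ([ffun i => mrow d i], [ffun i => mcol d i]).
split=> /=; rewrite ?mem_index_enum // /F; congr (_, _).
by rewrite /minor_poly; congr (\det _); apply/matrixP => i j; rewrite !mxE !ffunE.
Qed.

Lemma orbit_family_exists s : all (fun k => k <= minn m n)%N s ->
  exists L, orbit_family s L.
Proof.
elim: s => [_|k s IH /= /andP[]].
  exists [:: (1, 1)]; split.
  - exists 1%N => // A B; rewrite big_seq1 /canonical big_nil scale1r !rmorph1.
    by rewrite scale1r.
  - by move=> z; rewrite inE => /eqP ->; exact: top_part1.
  by case=> // _; exists 1; rewrite /bt_poly big_nil inE.
rewrite leq_min => /andP[km kn] /IH [L [[c c0 cE] top has]].
have [L1 [[c1 c10 c1E] top1 has1]] := orbit_family1 km kn.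
exists [seq (a.1 * b.1, a.2 * b.2) | a <- L1, b <- L]; split.
- exists (c1 * c)%N; first by rewrite muln_gt0 c10.
  move=> A B; rewrite natrM -scalerA /canonical big_cons [act A B _]rmorphM.
  have -> : c1%:R *: (c%:R *: (act A B (cminor (genX K m n) k)
       * act A B (\prod_(j <- s) cminor (genX K m n) j))) =
     (c1%:R *: act A B (cminor (genX K m n) k)) * (c%:R *: act A B (canonical K m n s)).
    by rewrite -scalerAl -scalerAr.
  rewrite c1E cE big_allpairs_dep big_distrl /=; apply: eq_bigr => a _.
  rewrite big_distrr; apply: eq_bigr => b _ /=.
  by rewrite rmorphM mevalM -scalerAl -scalerAr scalerA.
- move=> z /allpairsP [[a b] /= [aL bL ->]] /=.
  by apply: (@top_partM _ _ _ [:: k] s); [exact: top1 | exact: top].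
case=> // d D [dk Ds]; have [u1 h1] := has1 d dk; have [u h] := has D Ds.
exists (u1 * u); apply/allpairsP; exists ((u1, minor_poly K d), (u, bt_poly K D)); split=> //=.
by rewrite /bt_poly big_cons.
Qed.

End Orbits.

Section Irreducibility.

Variables (K : fieldType) (charK : [pchar K] =i pred0) (m n : nat).
Notation N := (m * m + n * n)%N.
Notation KX := {mpoly K[m * n]}.
Variables (I : KX -> Prop) (idI : is_ideal I) (GLI : GL_stable I).
Hypothesis stdI : has_standard_basis I.

Lemma intr_neq0 (c : int) : c != 0 -> c%:~R != 0 :> K.
Proof.
case: c => c; first by rewrite -pmulrn => c0; rewrite ((pcharf0P K).1 charK).
by move=> _; rewrite NegzE mulrNz oppr_eq0 -pmulrn ((pcharf0P K).1 charK).
Qed.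

Lemma eval_intK (x : 'I_N -> K) (u : {mpoly int[N]}) :
  (map_mpoly (intr : int -> KX) u).@[fun k => (x k)%:MP] = ((intK K u).@[x])%:MP.
Proof.
pose F w := (map_mpoly (intr : int -> KX) w).@[fun k => (x k)%:MP].
pose G w : KX := ((intK K w).@[x])%:MP.
have FD p q : F (p + q) = F p + F q.
  have e : map_mpoly (intr : int -> KX) (p + q) =
    map_mpoly (intr : int -> KX) p + map_mpoly (intr : int -> KX) q := raddfD _ p q.
  by rewrite /F e mevalD.
have GD p q : G (p + q) = G p + G q.
  have e : intK K (p + q) = intK K p + intK K q := rmorphD _ p q.
  by rewrite /G e mevalD mpolyCD.
rewrite -[LHS]/(F u) -[RHS]/(G u) [u]mpolyE.
elim/big_ind: _ => [|p q IHp IHq|v _].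
- by rewrite /F /G !rmorph0.
- by rewrite FD GD IHp IHq.
rewrite /F /G /intK !map_mpolyZ !map_mpolyX !mevalZ !mevalX rmorphM; congr (_ * _).
  by rewrite rmorph_int.
by rewrite rmorph_prod; apply: eq_bigr => k _; rewrite rmorphXn.
Qed.

(** The orbit of the canonical product lies in I, hence so do its coefficients
    as a polynomial in the group elements. *)
Lemma orbit_coef s L : orbit_family s L -> I (canonical K m n s) ->
  forall t, I (\sum_(z <- L) (z.1@_t)%:~R *: z.2).
Proof.
move=> [[c c0 cE] _ _] Is t.
pose P : {mpoly KX[N]} := \sum_(z <- L) z.2%:MP * map_mpoly (intr : int -> KX) z.1.
have -> : \sum_(z <- L) (z.1@_t)%:~R *: z.2 = P@_t.
  rewrite raddf_sum; apply: eq_bigr => z _.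
  by rewrite /= mcoeffCM mcoeff_map_mpoly /= scaler_int -mulrzr.
apply: (subspace_mcoeff charK (ideal_subspace idI) (gen_det_neq0 K m n)) => x dx.
have [uA uB] := gen_det_unit dx.
have -> : P.@[fun k => (x k)%:MP] = c%:R *: act (ptA x) (ptB x) (canonical K m n s).
  have px : point (ptA x) (ptB x) =1 x.
    move=> v; rewrite /point; case: (split_ordP v) => w ->; case/mxvec_indexP: w => i k;
      by rewrite mxvecE mxE.
  rewrite cE raddf_sum; apply: eq_bigr => z _ /=.
  by rewrite mevalM mevalC eval_intK mulrC mul_mpolyC (meval_eq _ px).
apply: (subspaceZ (ideal_subspace idI)).
have -> : act (ptA x) (ptB x) (canonical K m n s) =
    GL_act (ptA x)^T (invmx (ptB x)) (canonical K m n s) by rewrite GL_actE invmxK.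
by apply: GLI; rewrite ?unitmx_tr ?unitmx_inv.
Qed.

(** The combinations of [orbit_coef] have top parts that are, by [gram_mpoly],
    combinations of Gram type of the top parts of the family.  Some
    combination h of them in I has therefore, up to a nonzero factor, the same
    top part as D, and D has a nonzero coefficient in the standard expansion of
    h.  As I has a standard basis, it contains D. *)
Lemma std_of_canonical (D : seq (minor m n)) : is_standard D ->
  I (canonical K m n (bt_shape D)) -> I (bt_poly K D).
Proof.
move=> sD Ican; set s := bt_shape D in Ican.
have s_le : all (fun k => k <= minn m n)%N s.
  by rewrite /s; elim: (D) => //= d D' ->; rewrite leq_min msize_le_row msize_le_col.
have [L fam] := orbit_family_exists K s_le.
have [_ top /(_ D erefl) [u0 u0L]] := fam.
have [|N0 [T [l [N00 gE]]]] := @gram_mpoly _ [seq z.1 | z <- L] u0.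
  by apply/mapP; exists (u0, bt_poly K D).
pose h : KX := \sum_(t <- T) (l t)%:~R *: \sum_(z <- L) (z.1@_t)%:~R *: z.2.
have Ih : I h.
  apply: (subspace_sum (ideal_subspace idI)) => t _ _.
  by apply: (subspaceZ (ideal_subspace idI)); exact: orbit_coef fam Ican t.
have top_h : \sum_(t <- T) (l t)%:~R *: \sum_(z <- L) (z.1@_t)%:~R *: intK K z.1 =
    N0%:~R *: intK K u0.
  apply/mpolyP => v; rewrite mcoeffZ raddf_sum /= [in RHS]mcoeff_map_mpoly /= -rmorphM
    gE rmorph_sum.
  apply: eq_bigr => t _; rewrite mcoeffZ raddf_sum rmorphM /= rmorph_sum /= big_map.
  by congr (_ * _); apply: eq_bigr => z _; rewrite mcoeffZ mcoeff_map_mpoly /= rmorphM.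
have dh : degen (h - N0%:~R *: bt_poly K D) =
    \sum_(t <- T) (l t)%:~R *: \sum_(z <- L) (z.1@_t)%:~R *: (degen z.2 - intK K z.1)
    - N0%:~R *: (degen (bt_poly K D) - intK K u0).
  rewrite rmorphB /= degenZ scalerBr -top_h opprB addrA; congr (_ - _).
  rewrite addrC -big_split /= /h rmorph_sum /=; apply: eq_bigr => t _.
  rewrite degenZ -scalerDr; congr (_ *: _); rewrite -big_split /= rmorph_sum /=.
  by apply: eq_bigr => z _; rewrite degenZ -scalerDr [intK K _ + _]addrC subrK.
have sup : supported (shape_gt s) (h - N0%:~R *: bt_poly K D).
  rewrite /supported -/(supp_in _ _) dh -scaleNr; apply: supp_inD; last first.
    by apply: supp_inZ; exact: (top _ u0L).1.
  rewrite big_seq; apply: supp_in_sum => t _; apply: supp_inZ.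
  rewrite big_seq; apply: supp_in_sum => z zL; apply: supp_inZ.
  exact: (top _ zL).1.
have [S [c [rep [uS std IS eh]]]] := std_comb_span ((stdI h).1 Ih).
have [leadS|leadS] := boolP (lead D \in S).
  rewrite (@bt_poly_lead _ _ _ D (rep (lead D))) ?(std _ leadS).2 //; first exact: IS.
  exact: (std _ leadS).1.
pose c' u := if u == lead D then - N0%:~R else c u.
pose rep' u := if u == lead D then D else rep u.
have uS' : uniq (lead D :: S) by rewrite /= leadS.
have std' : std_family (lead D :: S) rep'.
  by move=> u; rewrite inE /rep'; case: eqP => [-> _|_ /std].
have sup' : supported (shape_gt s) (\sum_(u <- lead D :: S) c' u *: bt_poly K (rep' u)).
  rewrite big_cons /c' /rep' eqxx scaleNr addrC.
  rewrite (_ : \sum_(u <- S) _ = h) // eh; apply: eq_big_seq => u uS''.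
  by case: eqP => // eu; move: leadS; rewrite -eu uS''.
have c'0 : c' (lead D) != 0 by rewrite /c' eqxx oppr_eq0 intr_neq0.
have [_ [t]] := supported_terms (@shape_gt_up m n s) uS' std' sup' (mem_head _ _) c'0.
by rewrite statA_lead ltnn.
Qed.

End Irreducibility.

(** * Exchanging boxes between two minors *)
Section ShapeExchange.

Variables (S : comNzRingType) (m n : nat) (Y : 'M[S]_(m, n)).

Definition last_at (d k i : nat) : nat := if (i < d)%N then i else k.

(** For nested index sets the product of the minors of sizes v + 1 and d is a
    combination of products of minors of sizes v and d + 1: expand the second
    factors along their last rows and sum against the cofactors of the last
    column of the large minor. *)
Lemma cminor_exchange d v : (d <= v)%N ->
  cminor Y v.+1 * cminor Y d =
  \sum_(k < v.+1 | (d <= k)%N) (-1) ^+ (k + v) *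
    (gminor Y v (bump k) id * gminor Y d.+1 (last_at d k) (last_at d v)).
Proof.
move=> dv; pose Z : 'M[S]_v.+1 := \matrix_(i, j) ent Y i j.
pose G (k : 'I_v.+1) : 'M[S]_d.+1 := \matrix_(i, j) ent Y (last_at d k i) (last_at d v j).
have cofE (k : 'I_v.+1) : cofactor Z k ord_max = (-1) ^+ (k + v) * gminor Y v (bump k) id.
  rewrite /cofactor; congr (_ * \det _); apply/matrixP => i j; rewrite !mxE /=.
  by congr (ent _ _ _); rewrite /bump leqNgt ltn_ord.
pose cc (c : 'I_d.+1) : 'I_v.+1 := inord (last_at d v c).
have ccE c : cc c = last_at d v c :> nat.
  rewrite inordK // /last_at; case: ifP => // cd; exact: leq_trans cd (leqW dv).
pose C c := cofactor (G ord_max) ord_max c.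
have GE k : \det (G k) = \sum_c Z k (cc c) * C c.
  rewrite (expand_det_row _ ord_max); apply: eq_bigr => c _.
  congr (_ * _); first by rewrite !mxE ccE /last_at ltnn.
  rewrite /C /cofactor; congr (_ * \det _); apply/matrixP => i j; rewrite !mxE /=.
  by rewrite /bump leqNgt ltn_ord /= add0n {1 3}/last_at ltn_ord.
have adjE (c : 'I_v.+1) : \sum_k Z k c * cofactor Z k ord_max = (c == ord_max)%:R * \det Z.
  have := congr1 (fun A : 'M_v.+1 => A ord_max c) (mul_adj_mx Z).
  rewrite !mxE eq_sym mulr_natl => <-; apply: eq_bigr => k _.
  by rewrite [RHS]mulrC; congr (_ * _); rewrite mxE.
transitivity (\sum_k cofactor Z k ord_max * \det (G k)).
  apply/esym; under eq_bigr do rewrite GE big_distrr /=.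
  rewrite exchange_big (bigD1 ord_max) //= [X in _ + X]big1 ?addr0 => [|c cd].
    transitivity (\sum_k (Z k (cc ord_max) * cofactor Z k ord_max) * C ord_max).
      by apply: eq_bigr => k _; rewrite mulrCA mulrA.
    rewrite -big_distrl /= adjE.
    have -> : cc ord_max == ord_max by rewrite -val_eqE /= ccE /last_at ltnn.
    rewrite mul1r; congr (_ * _); rewrite /C /cofactor -signr_odd oddD addbb mul1r.
    congr (\det _); apply/matrixP => i j; rewrite !mxE /=.
    by rewrite /bump ![(d <= _)%N]leqNgt !ltn_ord /= !add0n /last_at !ltn_ord.
  transitivity (\sum_k (Z k (cc c) * cofactor Z k ord_max) * C c).
    by apply: eq_bigr => k _; rewrite mulrCA mulrA.
  rewrite -big_distrl /= adjE.
  have -> : (cc c == ord_max) = false; last by rewrite !mul0r.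
  rewrite -val_eqE /= ccE /last_at.
  have cd' : (c < d)%N.
    by rewrite ltn_neqAle -ltnS ltn_ord andbT; apply: contraNneq cd => e; apply/eqP/val_inj.
  by rewrite cd'; apply: ltn_eqF; exact: leq_trans cd' dv.
rewrite [RHS]big_mkcond; apply: eq_bigr => k _; case: (leqP d k) => [dk|kd].
  by rewrite cofE -mulrA.
have kd1 : (k < d.+1)%N by exact: leqW.
rewrite (@determinant_alternate _ _ _ (Ordinal kd1) ord_max) ?mulr0 //.
  by rewrite -val_eqE /= (ltn_eqF kd).
by move=> j; rewrite !mxE /last_at /= kd ltnn.
Qed.

(** Both index functions enumerate {0, ..., v} without k. *)
Lemma gminor_bump v k : (k < v)%N -> exists c : bool,
  gminor Y v (bump k) id = (-1) ^+ c * gminor Y v (fun i => if i == k then v else i) id.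
Proof.
case: v => // v kv.
pose s0 (i : 'I_v.+1) : 'I_v.+1 := inord (if (i < k)%N then (i : nat) else if i == k :>
  nat then v else i.-1).
have s0E i : s0 i = (if (i < k)%N then (i : nat) else if i == k :> nat then v else i.-1) :> nat.
  rewrite inordK //; have := ltn_ord i; case: ifP => //; case: ifP => // _ _ _.
  exact: leq_ltn_trans (leq_pred _) (ltn_ord i).
have s0_inj : injective s0.
  move=> i j /(congr1 val) /=; rewrite !s0E => e; apply: val_inj => /=.
  have := ltn_ord i; have := ltn_ord j; move: e.
  case: (ltngtP i k) => hi; case: (ltngtP j k) => hj; lia.
exists (odd_perm (perm s0_inj)).
have -> : gminor Y v.+1 (fun i => if i == k then v.+1 else i) id =
    (-1) ^+ perm s0_inj * gminor Y v.+1 (bump k) id.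
  rewrite /gminor -det_perm -det_mulmx -row_permE; congr (\det _).
  apply/matrixP => i j; rewrite !mxE permE s0E; congr (ent _ _ _).
  rewrite /bump; have := ltn_ord i; case: (ltngtP i k) => hi //=; lia.
by rewrite mulrA -signr_addb addbb mul1r.
Qed.

Definition row_op (z : S) (p l : nat) : 'M[S]_(m, n) :=
  \matrix_(i, j) (Y i j + (if (i : nat) == p then z * ent Y l j else 0)).

Lemma ent_row_op z p l i j : (p < m)%N ->
  ent (row_op z p l) i j = ent Y i j + (if i == p then z * ent Y l j else 0).
Proof.
move=> pm; rewrite /ent; case: (insubP 'I_m i) => [i' _ ei|im] /=; last first.
  rewrite add0r; case: eqP => // ip; by rewrite ip pm in im.
case: (insubP 'I_n j) => [j' _ ej|jn] /=.
  by rewrite mxE ei /ent valK.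
rewrite add0r; case: ifP => // _; case: insubP => [? _ _|_]; by rewrite mulr0.
Qed.

Lemma gminor_row_op_out z p l s f g : (p < m)%N ->
  (forall i, (i < s)%N -> f i != p) ->
  gminor (row_op z p l) s f g = gminor Y s f g.
Proof.
move=> pm h; congr (\det _); apply/matrixP => i j; rewrite !mxE ent_row_op //.
by rewrite (negPf (h i (ltn_ord i))) addr0.
Qed.

Lemma gminor_row_op z p l s f g i0 : (p < m)%N -> (i0 < s)%N -> f i0 = p ->
  (forall i, (i < s)%N -> i != i0 -> f i != p) ->
  gminor (row_op z p l) s f g =
  gminor Y s f g + z * gminor Y s (fun i => if i == i0 then l else f i) g.
Proof.
move=> pm i0s fi0 h; rewrite -[X in X + _]mul1r.
apply: (determinant_multilinear (i0 := Ordinal i0s)).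
- apply/rowP => j; rewrite !mxE ent_row_op //= fi0 !eqxx mul1r.
  by rewrite -fi0.
- apply/matrixP => i j; rewrite !mxE ent_row_op //.
  have ne : lift (Ordinal i0s) i != i0 :> nat by rewrite eq_sym neq_bump.
  by rewrite (negPf (h _ (ltn_ord _) ne)) addr0.
apply/matrixP => i j; rewrite !mxE ent_row_op //.
have ne : lift (Ordinal i0s) i != i0 :> nat by rewrite eq_sym neq_bump.
by rewrite (negPf (h _ (ltn_ord _) ne)) addr0 (negPf ne).
Qed.

Lemma gminor_eq_rows s f g i j : (i < s)%N -> (j < s)%N -> i != j -> f i = f j ->
  gminor Y s f g = 0.
Proof.
move=> si sj ij e; rewrite /gminor.
rewrite (@determinant_alternate _ _ _ (Ordinal si) (Ordinal sj)) //.
by move=> k; rewrite !mxE /= e.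
Qed.

Lemma cminor_row_op z p l x : (p < m)%N -> (x <= p)%N || (p < x)%N && (l < x)%N && (p != l) ->
  cminor (row_op z p l) x = cminor Y x.
Proof.
move=> pm /orP[xp|/andP[/andP[px lx] pl]].
  apply: gminor_row_op_out => // i ix /=.
  by rewrite neq_ltn (leq_trans ix xp).
rewrite /cminor (@gminor_row_op z p l x id id p) //.
by rewrite (@gminor_eq_rows x (fun i => if i == p then l else i) id p l) ?mulr0 ?addr0
  // eqxx; case: ifP.
Qed.

End ShapeExchange.

Section MinorConstruction.

Variables (m n : nat).

Lemma minor_exists s (f g : nat -> nat) :
  (forall i j, (i < j < s)%N -> (f i < f j < m)%N) ->
  (forall i j, (i < j < s)%N -> (g i < g j < n)%N) ->
  ((0 < s)%N -> (f 0%N < m)%N && (g 0%N < n)%N) ->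
  exists d : minor m n, msize d = s /\
    forall k, (k < s)%N -> row_at d k = f k /\ col_at d k = g k.
Proof.
move=> fi gi fg0.
have fb (k : 'I_s) : (f k < m)%N.
  case: k => [[|k] ks] /=; first by case/andP: (fg0 ks).
  by have /andP[] := fi 0%N k.+1 ks.
have gb (k : 'I_s) : (g k < n)%N.
  case: k => [[|k] ks] /=; first by case/andP: (fg0 ks).
  by have /andP[] := gi 0%N k.+1 ks.
have fh : {homo (fun k => Ordinal (fb k)) : i j / (i < j)%N}.
  move=> i j ij; have h : (i < j < s)%N by rewrite ij ltn_ord.
  by have /andP[] := fi _ _ h.
have gh : {homo (fun k => Ordinal (gb k)) : i j / (i < j)%N}.
  move=> i j ij; have h : (i < j < s)%N by rewrite ij ltn_ord.
  by have /andP[] := gi _ _ h.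
exists (Minor fh gh); split=> // k ks.
by rewrite (row_atE (d := Minor fh gh) (Ordinal ks)) (col_atE (d := Minor fh gh) (Ordinal ks)).
Qed.

Lemma minor_leI (d e : minor m n) : (msize e <= msize d)%N ->
  (forall k, (k < msize e)%N -> (row_at d k <= row_at e k)%N && (col_at d k <= col_at e k)%N) ->
  minor_le d e.
Proof.
move=> se h; rewrite /minor_le se /=; apply/forallP => i; apply/forallP => j.
by apply/implyP => /eqP ij; have := h j (ltn_ord j); rewrite -!row_atE -!col_atE ij.
Qed.

(** Truncating sizes makes the canonical minors a total function of the size. *)
Definition cut k := minn k (minn m n).

Lemma cut_m k : (cut k <= m)%N. Proof. by rewrite /cut !geq_min leqnn !orbT. Qed.
Lemma cut_n k : (cut k <= n)%N. Proof. by rewrite /cut !geq_min leqnn !orbT. Qed.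

Lemma widen_incr p q (h : (p <= q)%N) : {homo widen_ord h : i j / (i < j)%N}.
Proof. by []. Qed.

Definition can_minor k : minor m n :=
  Minor (widen_incr (cut_m k)) (widen_incr (cut_n k)).

Lemma row_can k i : (i < cut k)%N -> row_at (can_minor k) i = i.
Proof. by move=> ik; rewrite (row_atE (d := can_minor k) (Ordinal ik)). Qed.

Lemma col_can k i : (i < cut k)%N -> col_at (can_minor k) i = i.
Proof. by move=> ik; rewrite (col_atE (d := can_minor k) (Ordinal ik)). Qed.

Lemma cut_id k : (k <= minn m n)%N -> cut k = k.
Proof. by move=> h; apply/minn_idPl. Qed.

Lemma can_minor_le x y : (y <= x)%N -> minor_le (can_minor x) (can_minor y).
Proof.
move=> yx; have cyx : (cut y <= cut x)%N by rewrite /cut; lia.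
apply: minor_leI => // k ky; rewrite !row_can ?col_can ?leqnn //; exact: leq_trans cyx.
Qed.

Lemma minor_poly_can K k : (k <= minn m n)%N ->
  minor_poly K (can_minor k) = cminor (genX K m n) k.
Proof.
move=> kmn; rewrite minor_polyE /=.
rewrite (@eq_gminor _ _ _ _ _ _ id _ id (@row_can k) (@col_can k)).
by rewrite /cminor cut_id.
Qed.

End MinorConstruction.

Section Canonical.
Variables (K : fieldType) (m n : nat).

Lemma canonical_perm s s' : perm_eq s s' -> canonical K m n s = canonical K m n s'.
Proof. exact: perm_big. Qed.

Lemma canonical_cons k s :
  canonical K m n (k :: s) = cminor (genX K m n) k * canonical K m n s.
Proof. by rewrite /canonical big_cons. Qed.

End Canonical.

Section RowOperations.

Variables (K : fieldType) (m n : nat).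
Notation KX := {mpoly K[m * n]}.
Notation X := (genX K m n).

Definition row_sub (z : K) (p l : nat) : KX -> KX :=
  subst_mx (@mpolyC (m * n) K) (row_op X z%:MP p l).

HB.instance Definition _ z p l := GRing.RMorphism.copy (row_sub z p l)
  (subst_mx (@mpolyC (m * n) K) (row_op X z%:MP p l)).

Lemma row_sub_gminor z p l s f g :
  row_sub z p l (gminor X s f g) = gminor (row_op X z%:MP p l) s f g.
Proof.
rewrite /gminor -det_map_mx; congr (\det _); apply/matrixP => i j.
rewrite [LHS]mxE [in LHS]mxE [RHS]mxE /ent.
case: (insubP 'I_m (f i)) => [i' _ _|_]; last exact: rmorph0.
case: (insubP 'I_n (g j)) => [j' _ _|_]; last exact: rmorph0.
exact: subst_mxX.
Qed.

Lemma row_sub_stable (I : KX -> Prop) (GLI : GL_stable I) z p l q :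
  (p < m)%N -> (l < m)%N -> p != l -> I q -> I (row_sub z p l q).
Proof.
move=> pm lm pl Iq; pose i := Ordinal pm; pose j := Ordinal lm.
have ij : j != i by rewrite -val_eqE eq_sym.
have inv : (1%:M + z *: delta_mx i j) *m (1%:M - z *: delta_mx i j) = 1%:M :> 'M[K]_m.
  rewrite mulmxDl mul1mx mulmxBr mulmx1 -scalemxAl -scalemxAr mul_delta_mx_0 //.
  by rewrite !scaler0 subr0 subrK.
have [uM _] := mulmx1_unit inv.
have -> : row_sub z p l q = GL_act (1%:M + z *: delta_mx i j) 1%:M q; last first.
  by apply: GLI => //; exact: unitmx1.
rewrite GL_actE invmx1 map_mx1 mulmx1 /row_sub.
congr (subst_mx (@mpolyC (m * n) K) _ q).
rewrite map_mxD map_mx1 mulmxDl mul1mx; apply/matrixP => a b.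
rewrite [LHS]mxE [RHS]mxE; congr (_ + _); rewrite mxE (bigD1 j) //= big1 ?addr0.
  rewrite !mxE eqxx andbT -val_eqE /= (entE X j b) mxE.
  by case: eqP => _; rewrite ?mulr1 // mulr0 mpolyC0 mul0r.
by move=> k kj; rewrite !mxE (negPf kj) andbF mulr0 mpolyC0 mul0r.
Qed.

End RowOperations.

Section LinearCoefficient.

Variable S : comNzRingType.

Lemma coef1_prod (Q A B : {poly S}) l :
  (Q * (A * (B * l%:P)))`_1 =
  Q`_0 * (A`_0 * (B`_1 * l) + A`_1 * (B`_0 * l)) + Q`_1 * (A`_0 * (B`_0 * l)).
Proof.
have coefP (C D : {poly S}) : (C * D)`_0 = C`_0 * D`_0 /\ (C * D)`_1 = C`_0 * D`_1 + C`_1 * D`_0.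
  by rewrite !coefM big_ord1 big_ord_recl big_ord1.
rewrite (coefP Q _).2 (coefP A _).1 (coefP A _).2 (coefP B _).1 (coefP B _).2 !coefC /=.
by rewrite mulr0 add0r.
Qed.

Lemma coef_lin (a b : S) :
  (a%:P + b%:P * 'X)`_0 = a /\ (a%:P + b%:P * 'X)`_1 = b.
Proof. by rewrite !coefD !coefC !coefMX !coefC addr0 add0r. Qed.

Lemma collect_linear (q0 q1 a0 a1 b0 b1 l : S) c : a0 * q1 = (q0 * a1) *+ c ->
  q0 * (a0 * (b1 * l) + a1 * (b0 * l)) + q1 * (a0 * (b0 * l)) =
  q0 * (a1 * (b0 * l)) *+ c.+1 + q0 * (a0 * (b1 * l)).
Proof.
move=> e; rewrite [q1 * _]mulrA [q1 * a0]mulrC e mulrnAl mulrDr -[in LHS](mulrA q0 a1).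
by rewrite mulrS -addrA addrC.
Qed.

Lemma collect_coef1 (Q A B : {poly S}) l q0 a0 a1 b0 b1 c :
  Q`_0 = q0 -> a0 * Q`_1 = (q0 * a1) *+ c ->
  A`_0 = a0 -> A`_1 = a1 -> B`_0 = b0 -> B`_1 = b1 ->
  (Q * (A * (B * l%:P)))`_1 = q0 * (a1 * (b0 * l)) *+ c.+1 + q0 * (a0 * (b1 * l)).
Proof.
by move=> hq0 hq1 hA0 hA1 hB0 hB1; rewrite coef1_prod hq0 hA0 hA1 hB0 hB1; exact: collect_linear.
Qed.

End LinearCoefficient.

Section StableExchange.

Variables (K : fieldType) (charK : [pchar K] =i pred0) (m n : nat).
Notation KX := {mpoly K[m * n]}.
Notation X := (genX K m n).
Variables (I : KX -> Prop) (idI : is_ideal I) (GLI : GL_stable I).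
Hypothesis stdI : has_standard_basis I.

Variables (d v : nat) (R : seq nat).
Hypothesis (dv : (d < v)%N) (vmn : (v < minn m n)%N).
Hypothesis R_gap : all (fun x => (x <= d)%N || (v <= x <= minn m n)%N) R.

Let hi := [seq x <- R | (v <= x)%N].
Let lo := [seq x <- R | ~~ (v <= x)%N].
Let Hi : KX := canonical K m n hi.
Let Lo : KX := canonical K m n lo.
Let F k : KX := gminor X d.+1 (last_at d k) (last_at d v).
Let E k : KX := gminor X v (fun i => if i == k then v else i) id.

Let hiP x : x \in hi -> (v <= x <= minn m n)%N.
Proof.
rewrite mem_filter => /andP[vx xR]; move/allP: R_gap => /(_ x xR); rewrite vx.
by case/orP => // xd; move: (leq_trans vx xd); rewrite leqNgt dv.
Qed.

Let loP x : x \in lo -> (x <= d)%N.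
Proof.
rewrite mem_filter => /andP[vx xR]; move/allP: R_gap => /(_ x xR).
by rewrite (negPf vx) orbF.
Qed.

Let HiLo : canonical K m n R = Hi * Lo.
Proof. by rewrite /Hi /Lo /canonical !big_filter (bigID (fun x => v <= x)%N). Qed.

Let vm : (v < m)%N. Proof. by move: vmn; rewrite leq_min => /andP[]. Qed.
Let vn : (v < n)%N. Proof. by move: vmn; rewrite leq_min => /andP[]. Qed.

(** The starting point: a standard product of the given shape whose last minor
    of size d + 1 has rows and columns 0, ..., d-1, v. *)
Let base_mem : I (canonical K m n [:: d.+1, v & R]) ->
  I (Hi * (cminor X v * (F v * Lo))).
Proof.
move=> Ican.
have [f [fsz fE]] : exists f : minor m n, msize f = d.+1 /\
    forall k, (k < d.+1)%N -> row_at f k = last_at d v k /\ col_at f k = last_at d v k.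
  have [vm' vn'] := (vm, vn).
  apply: minor_exists => [i j|i j|_]; rewrite /last_at.
  - by case: (ltnP i d); case: (ltnP j d); lia.
  - by case: (ltnP i d); case: (ltnP j d); lia.
  by case: (ltnP 0 d); lia.
pose sh := sort geq (v :: hi); pose sl := sort geq lo.
pose D := map (@can_minor m n) sh ++ f :: map (@can_minor m n) sl.
have geq_trans : transitive geq by move=> a b c ba ac; exact: leq_trans ac ba.
have geq_total : total geq by move=> a b; exact: leq_total.
have shP x : x \in sh -> (v <= x <= minn m n)%N.
  by rewrite mem_sort inE => /orP[/eqP ->|/hiP //]; rewrite leqnn ltnW.
have slP x : x \in sl -> (x <= d)%N by rewrite mem_sort => /loP.
have slmn x : x \in sl -> (x <= minn m n)%N.
  by move/slP => h; apply: leq_trans h _; apply: ltnW; apply: ltn_trans vmn.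
have pw s : pairwise (@minor_le m n) (map (@can_minor m n) (sort geq s)).
  rewrite pairwise_map; apply: (@sub_pairwise _ geq); first by move=> x y; exact: can_minor_le.
  by rewrite -sorted_pairwise //; exact: sort_sorted.
have sD : is_standard D.
  apply/standard_of_sorted/pairwise_sorted; rewrite pairwise_cat /= !pw andbT /=.
  apply/andP; split.
    rewrite /allrel all_map; apply/allP => x /shP /andP[vx xmn] /=.
    apply/andP; split.
      apply: minor_leI; first by rewrite fsz /= cut_id //; exact: leq_trans dv vx.
      rewrite fsz => k kd; have [-> ->] := fE k kd.
      have kx : (k < cut m n x)%N by rewrite cut_id //; exact: leq_trans kd (leq_trans dv vx).
      rewrite row_can // col_can // /last_at; case: ltnP => // _; rewrite ?leqnn //.
      by have -> : (k <= v)%N by exact: leq_trans (ltnW kd) dv.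
    rewrite all_map; apply/allP => y /slP yd /=; apply: can_minor_le.
    exact: leq_trans yd (leq_trans (ltnW dv) vx).
  rewrite all_map; apply/allP => y ysl /=; have yd := slP y ysl.
  apply: minor_leI; first by rewrite fsz /= cut_id ?slmn //; exact: leqW.
  move=> k /= ky; have kd : (k < d)%N by move: ky; rewrite cut_id ?slmn // => /leq_trans; apply.
  by have [-> ->] := fE k (leqW kd); rewrite row_can // col_can // /last_at kd leqnn.
have canE s : (forall x, x \in s -> (x <= minn m n)%N) ->
    bt_poly K (map (@can_minor m n) s) = canonical K m n s.
  move=> h; rewrite /bt_poly big_map; apply: eq_big_seq => x /h; exact: minor_poly_can.
have shapeE s : (forall x, x \in s -> (x <= minn m n)%N) -> bt_shape (map (@can_minor m n) s) = s.
  move=> h; rewrite /bt_shape -map_comp -[RHS]map_id; apply/eq_in_map => x /h; exact: cut_id.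
have shmn x : x \in sh -> (x <= minn m n)%N by move/shP/andP => [].
have ID : I (bt_poly K D).
  apply: (std_of_canonical charK idI GLI stdI sD).
  rewrite (_ : canonical _ _ _ _ = canonical K m n [:: d.+1, v & R]) //.
  apply: canonical_perm; rewrite /bt_shape map_cat /= fsz -/(bt_shape _) -/(bt_shape _) !shapeE //.
  rewrite -cat1s perm_catCA /= perm_cons;
    apply: (perm_trans (perm_cat (permEl (perm_sort _ _)) (permEl (perm_sort _ _)))).
  by rewrite /= perm_cons; exact: permEl (perm_filterC _ _).
have -> : Hi * (cminor X v * (F v * Lo)) = bt_poly K D; last by [].
rewrite /bt_poly big_cat big_cons /= -!/(bt_poly K _) !canE //.
rewrite [canonical K m n sh](canonical_perm _ _ _ (permEl (perm_sort _ _))).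
rewrite [canonical K m n sl](canonical_perm _ _ _ (permEl (perm_sort _ _))) canonical_cons.
have -> : minor_poly K f = F v.
  by rewrite minor_polyE fsz; apply: eq_gminor => k /fE [].
by rewrite mulrCA !mulrA.
Qed.

Let canonical_row_sub z p l s : (p < m)%N ->
  (forall x, x \in s -> (x <= p)%N || (p < x)%N && (l < x)%N && (p != l)) ->
  row_sub z p l (canonical K m n s) = canonical K m n s.
Proof.
move=> pm h; rewrite /canonical rmorph_prod; apply: eq_big_seq => x /h hx.
by rewrite /cminor [LHS]row_sub_gminor; exact: cminor_row_op.
Qed.

Let last_upd k l : gminor X d.+1 (fun i => if i == d then k else last_at d l i)
    (last_at d v) = F k.
Proof.
apply: eq_gminor => // i; rewrite ltnS /last_at => id.
by case: (ltngtP i d) id.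
Qed.

(** Adding row k to row v leaves all factors but the last minor of size d + 1
    unchanged, as the others contain either both rows or not the row v. *)
Let low_mem k : (d <= k < v)%N -> I (Hi * (cminor X v * (F v * Lo))) ->
  I (Hi * (cminor X v * (F k * Lo))).
Proof.
move=> /andP[dk kv] I0.
have km : (k < m)%N := ltn_trans kv vm.
have vk : v != k by rewrite neq_ltn kv orbT.
have e : row_sub 1 v k (Hi * (cminor X v * (F v * Lo))) =
    Hi * (cminor X v * ((F v + F k) * Lo)).
  rewrite !rmorphM; congr (_ * (_ * (_ * _))).
  - apply: canonical_row_sub => // x /hiP /andP[vx _].
    by rewrite vk andbT (leq_trans kv vx) andbT leqNgt; case: (v < x)%N.
  - by rewrite [LHS]row_sub_gminor; apply: cminor_row_op; rewrite // leqnn.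
  - rewrite [LHS]row_sub_gminor (@gminor_row_op _ _ _ _ _ v k _ _ _ d) //.
    + by rewrite last_upd mpolyC1 mul1r.
    + by rewrite /last_at ltnn.
    move=> i; rewrite ltnS /last_at => id ne; case: ltnP => di; last by lia.
    by rewrite neq_ltn (ltn_trans di dv).
  by apply: canonical_row_sub => // x /loP xd; rewrite (leq_trans xd (ltnW dv)).
have I1 := row_sub_stable GLI 1 vm km vk I0.
rewrite e in I1; have := idealD idI I1 (idealM idI (-1) I0).
rewrite mulN1r; move: Hi (cminor X v) (F v) (F k) Lo => a b c c' l.
by rewrite mulrDl !mulrDr addrAC subrr add0r.
Qed.

(** The factors of size v contribute one term each to the linear coefficient. *)
Let hi_lin (e : KX) (s : seq nat) :
  let P : {poly KX} := \prod_(x <- s) ((cminor X x)%:P + (if x == v then e else 0)%:P * 'X) in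
  P`_0 = canonical K m n s /\
  cminor X v * P`_1 = (canonical K m n s * e) *+ count (pred1 v) s.
Proof.
elim: s => [|x s [IH0 IH1]] P; rewrite /P.
  by rewrite big_nil /canonical big_nil !coef1 /= mulr0n mulr0.
rewrite big_cons canonical_cons; set Q := \prod_(_ <- s) _ in IH0 IH1 *.
have L0 : ((cminor X x)%:P + (if x == v then e else 0)%:P * 'X)`_0 = cminor X x.
  by rewrite coefD coefC coefMX addr0.
have L1 : ((cminor X x)%:P + (if x == v then e else 0)%:P * 'X)`_1 = if x == v then e else 0.
  by rewrite coefD coefC coefMX coefC add0r.
rewrite !coefM big_ord1 big_ord_recl big_ord1 /= L0 L1 IH0; split=> //.
rewrite /bump /= mulrDr mulrCA IH1; case: (x =P v) => [->|_].
  rewrite -[(true + _)%N]/((count (pred1 v) s).+1) mulrS.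
  by rewrite mulrnAr [e * _]mulrC !mulrA addrC.
by rewrite mul0r mulr0 addr0 mulrnAr mulrA.
Qed.

(** Adding z times row v to row k replaces k by v in one factor of size v or in
    the factor of size d + 1.  In the linear coefficient the factors of size v
    contribute equal terms, so the exchanged product occurs with a positive
    integer factor, next to the product of [base_mem]. *)
Let exchange_term k : (d <= k < v)%N -> I (Hi * (cminor X v * (F v * Lo))) ->
  I (Hi * (E k * (F k * Lo))).
Proof.
move=> dkv I0; have Ik := low_mem dkv I0; have /andP[dk kv] := dkv.
have km : (k < m)%N := ltn_trans kv vm.
have vk : k != v by rewrite neq_ltn kv.
pose lin x : {poly KX} := (cminor X x)%:P + (if x == v then E k else 0)%:P * 'X.
pose P : {poly KX} := (\prod_(x <- hi) lin x) * (lin v * (((F k)%:P + (F v)%:P * 'X) * Lo%:P)).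
have lin_row z x : (v <= x)%N -> row_sub z k v (cminor X x) = (lin x).[z%:MP].
  move=> vx; rewrite [LHS]row_sub_gminor /lin !hornerE; case: eqP => [->|xv].
    by rewrite (@gminor_row_op _ _ _ _ _ k v _ _ _ k) // mulrC.
  rewrite mul0r addr0; apply: cminor_row_op => //.
  by rewrite vk (leq_trans kv vx) ltn_neqAle vx eq_sym; move/eqP: xv => ->; rewrite orbT.
have PE z : row_sub z k v (Hi * (cminor X v * (F k * Lo))) = P.[z%:MP].
  rewrite !rmorphM /P !hornerM horner_prod hornerC; congr (_ * (_ * (_ * _))).
  - rewrite /Hi /canonical rmorph_prod; apply: eq_big_seq => x /hiP /andP[vx _].
    exact: lin_row.
  - exact: lin_row.
  - rewrite [LHS]row_sub_gminor !hornerE (@gminor_row_op _ _ _ _ _ k v _ _ _ d) //.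
    + by rewrite last_upd mulrC.
    + by rewrite /last_at ltnn.
    move=> i; rewrite ltnS /last_at => id ne; case: ltnP => di; last by lia.
    by rewrite neq_ltn (leq_trans di dk).
  by apply: canonical_row_sub => // x /loP xd; rewrite (leq_trans xd dk).
have I1 : I P`_1.
  have H z : (1 : {poly K}).[z] != 0 -> I (\sum_(j < (size P).+2) z ^+ j *: P`_j).
    move=> _; have := row_sub_stable GLI z km vm vk Ik; rewrite PE.
    rewrite (horner_coef_wide _ (_ : size P <= (size P).+2)%N); last by apply: leqW.
    by under eq_bigr do rewrite -rmorphXn mulrC mul_mpolyC.
  exact: (subspace_coef charK (ideal_subspace idI) (oner_neq0 _) H (Ordinal (isT : 1 <
    (size P).+2)%N)).
have [h0 h1] := hi_lin (E k) hi.
have [lv0 lv1] : (lin v)`_0 = cminor X v /\ (lin v)`_1 = E k.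
  by rewrite /lin eqxx; exact: coef_lin.
have [lk0 lk1] := coef_lin (F k) (F v).
have P1 := collect_coef1 Lo h0 h1 lv0 lv1 lk0 lk1.
move: I1; rewrite [P`_1]P1 => I1.
have := idealD idI I1 (idealM idI (-1) I0); rewrite mulN1r addrK -scaler_nat => I2.
have := subspaceZ (ideal_subspace idI) ((count (pred1 v) hi).+1%:R^-1) I2.
by rewrite scalerA mulVf ?scale1r // natr_neq0.
Qed.

(** Up to sign the terms of [cminor_exchange] are the products of
    [exchange_term] and, for k = v, the one of [base_mem]. *)
Lemma exchange_mem : I (canonical K m n [:: d.+1, v & R]) ->
  I (canonical K m n [:: d, v.+1 & R]).
Proof.
move=> /base_mem I0; rewrite !canonical_cons HiLo mulrA [_ * cminor X v.+1]mulrC.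
rewrite (cminor_exchange _ (ltnW dv)) big_distrl /=.
apply: (@subspace_sum _ _ _ (ideal_subspace idI)) => k _ dk.
have [kv|vk] := ltnP k v.
  have dkv : (d <= k < v)%N by rewrite dk.
  have [c ->] := gminor_bump X kv.
  have := exchange_term dkv I0; rewrite -/(E k) -/(F k) => Ik.
  have := idealM idI ((-1) ^+ (k + v) * (-1) ^+ c) Ik.
  move: ((-1) ^+ (k + v)) ((-1) ^+ c) Hi (E k) (F k) Lo => s1 s2 h e f l.
  by rewrite (_ : s1 * s2 * _ = s1 * (s2 * e * f) * (h * l)) //; ring.
have ekv : k = v :> nat by apply/eqP; rewrite eqn_leq vk -ltnS ltn_ord.
have -> : gminor X v (bump k) id = cminor X v.
  by rewrite ekv; apply: eq_gminor => // i iv; rewrite /bump leqNgt iv.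
rewrite ekv -/(F v); have := idealM idI ((-1) ^+ (v + v)) I0.
move: ((-1) ^+ (v + v)) Hi (cminor X v) (F v) Lo => s1 h e f l.
by rewrite (_ : s1 * (h * (e * (f * l))) = s1 * (e * f) * (h * l)) //; ring.
Qed.

End StableExchange.

(** * The order on shapes *)
Section GammaOrder.

Variables (r : nat) (T : seq nat -> Prop).

Hypothesis T_perm : forall s s', perm_eq s s' -> T s -> T s'.
Hypothesis T_zero : forall s, T s <-> T (0%N :: s).
Hypothesis T_one : forall s, (0 < r)%N -> T s -> T (1%N :: s).
Hypothesis T_exchange : forall d v R, (d < v)%N -> (v < r)%N ->
  all (fun x => (x <= d)%N || (v <= x <= r)%N) R ->
  T [:: d.+1, v & R] -> T [:: d, v.+1 & R].

Let gam (s : seq nat) t := gamma t.+1 s.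

Let gam_cons k s t : gam (k :: s) t = (k - t + gam s t)%N.
Proof. exact: gamma_cons. Qed.

Let gam_perm s s' t : perm_eq s s' -> gam s t = gam s' t.
Proof. by move=> h; apply: perm_big. Qed.

Let gam_big s t : all (fun k => k <= r)%N s -> (r <= t)%N -> gam s t = 0%N.
Proof.
move=> + rt; elim: s => [_|k s IH /= /andP[kr /IH h]]; first by rewrite /gam /gamma big_nil.
by rewrite gam_cons h addn0; lia.
Qed.

(** The second differences of gamma count the parts. *)
Let gam_count s a b : (a <= b)%N ->
  (count (fun k => a < k <= b.+1) s + gam s a.+1 + gam s b.+1 = gam s a + gam s b.+2)%N.
Proof.
move=> ab; elim: s => [|k s IH] /=; first by rewrite /gam /gamma !big_nil.
rewrite !gam_cons; move: IH;
  move: (count _ s) (gam s a) (gam s b) (gam s a.+1) (gam s b.+1) (gam s b.+2).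
  by move=> c x1 x2 x3 x4 x5; case: (ltnP a k); case: (ltnP k b.+2); lia.
Qed.

Let T_nseq c s : T s <-> T (nseq c 0%N ++ s).
Proof.
elim: c => //= c [h1 h2]; split=> [/h1 h|h]; first exact: (T_zero _).1.
exact: h2 ((T_zero _).2 h).
Qed.

Let T_pos s : T s <-> T [seq x <- s | 0 < x]%N.
Proof.
pose z := [seq x <- s | ~~ (0 < x)%N].
have ez : z = nseq (size z) 0%N.
  by apply/all_pred1P/allP => x; rewrite mem_filter => /andP[]; case: x.
have h : perm_eq s (nseq (size z) 0%N ++ [seq x <- s | 0 < x]%N).
  by rewrite -ez perm_sym perm_catC; exact: permEl (perm_filterC _ _).
split=> [/(T_perm h) h1|h1]; first exact: (T_nseq _ _).2 h1.
have := (T_nseq (size z) _).1 h1.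
by apply: T_perm; rewrite perm_sym.
Qed.

Let T_eq s s' : (forall t, gam s t = gam s' t) -> T s -> T s'.
Proof.
move=> e /T_pos h; apply/T_pos; apply: T_perm h; apply/allP => x _ /=.
rewrite !count_filter; case: x => [|x].
  by rewrite !(eq_count (a2 := pred0)) ?count_pred0 // => -[].
have E s0 : count (predI (pred1 x.+1) (fun y => 0 < y)%N) s0 = count (fun k => x < k <= x.+1)%N s0.
  by apply: eq_count => y /=; case: ltngtP => //; lia.
rewrite !E; apply/eqP; have := gam_count s (leqnn x); have := gam_count s' (leqnn x).
by rewrite !e; lia.
Qed.

(** The order given by all gamma_t is generated by adding a box to the first
    column and by exchanges of boxes.  Let s < s' have the same total size.  On
    the first interval where their gammas differ, the difference rises from zero
    and returns to zero, so that its slope falls by at least two, and s has at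
    least two parts there; exchanging between the two smallest of them stays
    below s'. *)
Lemma gamma_generated s s' : all (fun k => k <= r)%N s -> all (fun k => k <= r)%N s' ->
  (forall t, gam s t <= gam s' t)%N -> T s -> T s'.
Proof.
move=> sr sr'.
have [k] := ubnP (\sum_(t < r) gam s' t - \sum_(t < r) gam s t)%N.
elim: k s sr => // k IH s sr; rewrite ltnS => meas le Ts.
have [/forallP ge|] := boolP [forall t : 'I_r, gam s' t <= gam s t]%N.
  apply: T_eq Ts => t; have [tr|rt] := ltnP t r; last by rewrite !gam_big.
  by apply/eqP; rewrite eqn_leq le (ge (Ordinal tr)).
rewrite negb_forall => /existsP [t0 h0].
have ex : exists t, (gam s t < gam s' t)%N by exists t0; rewrite ltnNge.
case: (ex_minnP ex) => a ha amin.
have step s1 : all (fun k => k <= r)%N s1 -> T s1 -> (forall t, gam s1 t <= gam s' t)%N ->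
    (forall t, gam s t <= gam s1 t)%N -> (exists t, gam s t < gam s1 t)%N -> T s'.
  move=> s1r T1 le1 ge1 [t1 lt1]; apply: (IH s1) => //.
  have ar : (t1 < r)%N by rewrite ltnNge; apply/negP => ra; move: lt1; rewrite !gam_big.
  have : (\sum_(t < r) gam s t < \sum_(t < r) gam s1 t)%N.
    rewrite (bigD1 (Ordinal ar)) //= [X in (_ < X)%N](bigD1 (Ordinal ar)) //= -addSn.
    by apply: leq_add => //; apply: leq_sum.
  have : (\sum_(t < r) gam s1 t <= \sum_(t < r) gam s' t)%N by apply: leq_sum.
  move: meas; move: (\sum_(t < r) gam s t)%N (\sum_(t < r) gam s1 t)%N (\sum_(t < r)
    gam s' t)%N => x y z.
  lia.
case: a ha amin step => [|a] ha amin step.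
  have r0 : (0 < r)%N by rewrite lt0n; apply: contraTneq ha => re; rewrite !gam_big // re.
  apply: (step (1%N :: s)) => /=; rewrite ?r0 //; first exact: T_one.
  - by move=> t; rewrite gam_cons; have := le t; case: t => [|t]; lia.
  - by move=> t; rewrite gam_cons leq_addl.
  by exists 0%N; rewrite gam_cons; lia.
have Da : gam s' a = gam s a.
  apply/eqP; rewrite eqn_leq le andbT leqNgt; apply/negP => /amin; by rewrite ltnn.
have exb : exists b, (a <= b)%N && (gam s' b.+2 <= gam s b.+2)%N.
  by exists (maxn a r); rewrite leq_maxl gam_big //; lia.
case: (ex_minnP exb) => b /andP[ab hb] bmin.
have pos t : (a < t <= b.+1)%N -> (gam s t < gam s' t)%N.
  have [-> //|ta /andP[at' tb]] := eqVneq t a.+1.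
  case: t ta at' tb => [|[|t]] // ta at' tb; first by move: ta; rewrite eqSS; lia.
  rewrite ltnNge; apply/negP => h.
  have at2 : (a <= t)%N by move: ta; rewrite eqSS; lia.
  by have := bmin t; rewrite at2 h => /(_ isT); lia.
have cnt2 : (2 <= count (fun k => a < k <= b.+1)%N s)%N.
  have := gam_count s ab; have := gam_count s' ab; have := le b.+2.
  have := pos a.+1; have := pos b.+1; lia.
pose sub := sort leq [seq x <- s | a < x <= b.+1]%N.
have sub_sorted : sorted leq sub by apply: sort_sorted; exact: leq_total.
have subP x : x \in sub -> (a < x <= b.+1)%N by rewrite mem_sort mem_filter => /andP[].
have sz : (2 <= size sub)%N by rewrite size_sort size_filter.
have perm_s : perm_eq s (sub ++ [seq x <- s | ~~ (a < x <= b.+1)]%N).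
  rewrite perm_sym; apply: (perm_trans _ (permEl (perm_filterC (fun x => a < x <= b.+1)%N s))).
  by rewrite perm_cat2r; exact: permEl (perm_sort _ _).
case: sub sub_sorted subP sz perm_s => [|u [|v sub]] //= /andP[uv vsub] subP _ perm_s.
have /andP[au ub] : (a < u <= b.+1)%N by apply: subP; rewrite mem_head.
have /andP[av vb] : (a < v <= b.+1)%N by apply: subP; rewrite !inE eqxx orbT.
case: u uv subP perm_s au ub => // d dv subP perm_s ad db.
set R := sub ++ _ in perm_s.
have br : (b.+1 < r)%N.
  rewrite ltnNge; apply/negP => rb; have := pos b.+1.
  by rewrite [gam s' _]gam_big // ltn0 ltnSn ltnS ab => /(_ isT).
have allR : all (fun x => x <= r)%N R.
  by have := perm_all (fun x => x <= r)%N perm_s; rewrite sr /= => /esym/and3P[].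
have gapR : all (fun x => (x <= d)%N || (v <= x <= r)%N) R.
  apply/allP => x xR; rewrite (allP allR x xR) andbT.
  move: xR; rewrite mem_cat => /orP[xs|].
    by rewrite (allP (order_path_min leq_trans vsub) x xs) orbT.
  by rewrite mem_filter => /andP[]; lia.
have vr : (v < r)%N by exact: leq_ltn_trans vb br.
have gs t : gam s t = (d.+1 - t + (v - t + gam R t))%N by rewrite (gam_perm t perm_s) !gam_cons.
apply: (step [:: d, v.+1 & R]) => /=.
- by rewrite allR vr andbT; lia.
- by apply: T_exchange => //; exact: T_perm perm_s Ts.
- move=> t; rewrite !gam_cons; have := le t; rewrite gs.
  have [ht|] := boolP (a < t <= b.+1)%N; first by have := pos t ht; rewrite gs; lia.
  lia.
- by move=> t; rewrite !gam_cons gs; lia.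
by exists d.+1; rewrite !gam_cons gs; lia.
Qed.

End GammaOrder.

(** * The equivalence *)
Section ShapeIdeals.

Variables (K : fieldType) (m n : nat).
Notation KX := {mpoly K[m * n]}.
Notation X := (genX K m n).

Lemma is_shape_bt (D : seq (minor m n)) : is_bitableau D -> is_shape m n (bt_shape D).
Proof.
move=> bD; rewrite /is_shape; apply/andP; split; first exact: bD.
by elim: (D) => //= d D' ->; rewrite leq_min msize_le_row msize_le_col.
Qed.

Lemma gamma_nth t s M : (0 < t)%N -> (size s <= M)%N ->
  gamma t s = (\sum_(i < M) ((nth 0 s i).+1 - t))%N.
Proof.
rewrite /gamma; elim: s M => [|k s IH] [|M] t0 //= sM.
- by rewrite big_nil big_ord0.
- by rewrite big_nil big1 // => i _; rewrite nth_nil; lia.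
by rewrite big_cons big_ord_recl (IH M).
Qed.

Lemma same_shape_gamma s s' t : same_shape s s' -> (0 < t)%N -> gamma t s = gamma t s'.
Proof.
move=> h t0; rewrite (gamma_nth t0 (leq_maxl (size s) (size s'))).
rewrite (gamma_nth t0 (leq_maxr (size s) (size s'))).
by apply: eq_bigr => i _; rewrite h.
Qed.

Lemma Ishape_ideal s : is_ideal (@Ishape K m n s).
Proof.
split=> [J JI _|x y hx hy J JI h|a x hx J JI h]; first exact: ideal0 JI.
  exact: (idealD JI (hx J JI h) (hy J JI h)).
exact: (idealM JI a (hx J JI h)).
Qed.

Lemma Ishape_bt s (D : seq (minor m n)) : is_bitableau D ->
  (forall t, (0 < t)%N -> (gamma t s <= gamma t (bt_shape D))%N) ->
  Ishape s (bt_poly K D).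
Proof. by move=> bD h J _; apply; exists D. Qed.

Lemma sum_mem (S : seq nat -> Prop) s p : S s -> Ishape s p ->
  ideal_sum S (@Ishape K m n) p.
Proof.
move=> Ss hp; exists [:: p]; split; first by rewrite big_seq1.
by move=> y; rewrite inE => /eqP ->; exists s.
Qed.

Lemma ideal_sum_ideal (S : seq nat -> Prop) : is_ideal (ideal_sum S (@Ishape K m n)).
Proof.
split.
- by exists [::]; split=> //; rewrite big_nil.
- move=> x y [l [-> hl]] [l' [-> hl']]; exists (l ++ l'); split; first by rewrite big_cat.
  by move=> z; rewrite mem_cat => /orP[/hl|/hl'].
move=> a x [l [-> hl]]; exists [seq a * y | y <- l]; split.
  by rewrite big_map big_distrr.
move=> z /mapP [y yl ->]; have [s [Ss Is]] := hl y yl.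
by exists s; split=> //; exact: (idealM (Ishape_ideal s) a Is).
Qed.

Lemma ideal_sum_min (S : seq nat -> Prop) (J : KX -> Prop) : is_ideal J ->
  (forall s D, S s -> is_bitableau D ->
    (forall t, (0 < t)%N -> (gamma t s <= gamma t (bt_shape D))%N) -> J (bt_poly K D)) ->
  forall p, ideal_sum S (@Ishape K m n) p -> J p.
Proof.
move=> JI h p [l [-> hl]]; rewrite big_seq; elim/big_rec: _ => [|y x yl Jx].
  exact: ideal0 JI.
have Jy : J y.
  have [s [Ss Is]] := hl y yl; apply: Is => // q [D [bD le ->]]; exact: (h s).
exact: (idealD JI Jy Jx).
Qed.

(** The monomials whose degrees in the last columns of A are at least those
    that some shape of S imposes. *)
Definition below_some (S : seq nat -> Prop) (u : 'X_{1..m * m + n * n}) : Prop :=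
  exists2 s, S s & shape_ge s u.

Lemma below_some_up S : stat_up (below_some S).
Proof. by move=> a b ab [s Ss h]; exists s => //; exact: shape_ge_up ab h. Qed.

Lemma below_some_lead S (D : seq (minor m n)) : below_some S (lead D) ->
  exists2 s, S s & forall t, (0 < t)%N -> (gamma t s <= gamma t (bt_shape D))%N.
Proof.
by case=> s Ss h; exists s => // -[//|t] _; have := h t; rewrite statA_lead.
Qed.

Lemma ideal_sum_supported (S : seq nat -> Prop) p :
  ideal_sum S (@Ishape K m n) p -> supported (below_some S) p.
Proof.
pose JI := @supported_ideal K m n _ (@below_some_up S).
move=> hp; refine (ideal_sum_min JI _ hp) => s D Ss _ le.
apply: supported_bt; first exact: below_some_up.
by exists s => // t; rewrite statA_lead; exact: le.
Qed.

(** Whether a bitableau lies in a sum of ideals I^(sigma) can be read off from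
    the leading monomial of its degeneration, hence from its shape. *)
Lemma bt_in_ideal_sum (S : seq nat -> Prop) (D : seq (minor m n)) :
  ideal_sum S (@Ishape K m n) (bt_poly K D) ->
  exists2 s, S s & forall t, (0 < t)%N -> (gamma t s <= gamma t (bt_shape D))%N.
Proof. by move=> /ideal_sum_supported /supported_lead /below_some_lead. Qed.

Lemma sum_defined_by_shape (I : KX -> Prop) (idI : is_ideal I) :
  sum_of_Ishapes I -> defined_by_shape I.
Proof.
case=> S [Sshape IE]; split; last first.
  move=> D D' bD bD' /same_shape_gamma e.
  have imp E E' : is_bitableau E' ->
      (forall t, (0 < t)%N -> gamma t (bt_shape E) = gamma t (bt_shape E')) ->
      I (bt_poly K E) -> I (bt_poly K E').
    move=> bE' eg /IE /bt_in_ideal_sum [s Ss le]; apply/IE; apply: (sum_mem Ss).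
    by apply: Ishape_bt => // t t0; rewrite -eg // le.
  by split; apply: imp => // t t0; rewrite e.
exists (fun D => is_bitableau D /\ exists2 s, S s &
  forall t, (0 < t)%N -> (gamma t s <= gamma t (bt_shape D))%N).
split=> [D []//|p]; split.
  move=> /IE h J JI gen; apply: (ideal_sum_min JI _ h) => s D Ss bD le.
  by apply: gen; exists D; split=> //; split=> //; exists s.
apply=> // q [D [[bD [s Ss le]] ->]]; apply/IE; apply: (sum_mem Ss); exact: Ishape_bt.
Qed.

End ShapeIdeals.

Section UpwardClosure.

Variables (K : fieldType) (m n : nat).
Notation KX := {mpoly K[m * n]}.
Notation X := (genX K m n).
Variables (I : KX -> Prop) (idI : is_ideal I).

Hypothesis exch : forall d v R, (d < v)%N -> (v < minn m n)%N ->
  all (fun x => (x <= d)%N || (v <= x <= minn m n)%N) R ->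
  I (canonical K m n [:: d.+1, v & R]) -> I (canonical K m n [:: d, v.+1 & R]).

(** Adding a box to the first column is multiplication by a variable; the other
    steps of [gamma_generated] are exchanges. *)
Lemma canonical_up s s' : all (fun k => k <= minn m n)%N s ->
  all (fun k => k <= minn m n)%N s' ->
  (forall t, (0 < t)%N -> (gamma t s <= gamma t s')%N) ->
  I (canonical K m n s) -> I (canonical K m n s').
Proof.
move=> sr sr' le; apply: (gamma_generated (T := fun s => I (canonical K m n s)) _ _ _ exch sr sr').
- by move=> l l' /canonical_perm ->.
- by move=> l; rewrite canonical_cons cminor0 mul1r.
- by move=> l _ Il; rewrite canonical_cons; exact: (idealM idI).
by move=> t; exact: le.
Qed.

Lemma sum_of_canonical :
  (forall p, I p -> ideal_sum (fun s => is_shape m n s /\ I (canonical K m n s))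
    (@Ishape K m n) p) ->
  (forall D, is_bitableau D -> (forall s, is_shape m n s -> I (canonical K m n s) ->
     (forall t, (0 < t)%N -> (gamma t s <= gamma t (bt_shape D))%N) -> I (bt_poly K D))) ->
  sum_of_Ishapes I.
Proof.
move=> h1 h2; exists (fun s => is_shape m n s /\ I (canonical K m n s)); split;
  first by move=> s [].
move=> p; split; first exact: h1.
by apply: ideal_sum_min => // s D [sh Is] bD le; exact: (h2 D bD s).
Qed.

End UpwardClosure.

Section DefinedByShape.

Variables (K : fieldType) (m n : nat).
Notation KX := {mpoly K[m * n]}.
Notation X := (genX K m n).
Variables (I : KX -> Prop) (idI : is_ideal I).
Hypothesis shI : forall D D' : seq (minor m n), is_bitableau D -> is_bitableau D' ->
  same_shape (bt_shape D) (bt_shape D') -> (I (bt_poly K D) <-> I (bt_poly K D')).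

Lemma bt_shape_can s : all (fun k => k <= minn m n)%N s ->
  bt_shape (map (@can_minor m n) s) = s.
Proof. by elim: s => //= k s IH /andP[ks /IH ->]; rewrite cut_id. Qed.

Lemma bt_poly_can s : all (fun k => k <= minn m n)%N s ->
  bt_poly K (map (@can_minor m n) s) = canonical K m n s.
Proof.
rewrite /bt_poly /canonical; elim: s => [|k s IH /= /andP[ks /IH h]]; first by rewrite !big_nil.
by rewrite !big_cons h minor_poly_can.
Qed.

Lemma bt_canonical (D : seq (minor m n)) : is_bitableau D ->
  (I (bt_poly K D) <-> I (canonical K m n (bt_shape D))).
Proof.
move=> bD; have /andP[_ le] := is_shape_bt bD.
rewrite -(bt_poly_can le); apply: shI => //; last by rewrite bt_shape_can.
by rewrite /is_bitableau bt_shape_can.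
Qed.

(** Here all terms of [cminor_exchange] are bitableaux of one and the same shape,
    that of a product in I. *)
Lemma shape_exchange d v R : (d < v)%N -> (v < minn m n)%N ->
  all (fun x => (x <= d)%N || (v <= x <= minn m n)%N) R ->
  I (canonical K m n [:: d.+1, v & R]) -> I (canonical K m n [:: d, v.+1 & R]).
Proof.
move=> dv vmn gapR Ican.
have [vm vn] : (v < m)%N /\ (v < n)%N by move: vmn; rewrite leq_min => /andP[].
rewrite !canonical_cons mulrA [_ * cminor X v.+1]mulrC.
rewrite (cminor_exchange _ (ltnW dv)) big_distrl /=.
apply: (@subspace_sum _ _ _ (ideal_subspace idI)) => k _ dk.
rewrite -mulrA; apply: (idealM idI).
have kv : (k <= v)%N by rewrite -ltnS ltn_ord.
have [f [fsz fE]] : exists f : minor m n, msize f = v /\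
    forall i, (i < v)%N -> row_at f i = bump k i /\ col_at f i = i.
  apply: minor_exists => [i j|i j|_]; rewrite /bump ?leqn0; last by case: (k <= 0)%N; lia.
    by case: (leqP k i); case: (leqP k j); lia.
  by lia.
have [g [gsz gE]] : exists g : minor m n, msize g = d.+1 /\
    forall i, (i < d.+1)%N -> row_at g i = last_at d k i /\ col_at g i = last_at d v i.
  apply: minor_exists => [i j|i j|_]; rewrite /last_at.
  - by case: (ltnP i d); case: (ltnP j d); lia.
  - by case: (ltnP i d); case: (ltnP j d); lia.
  by case: (ltnP 0 d); lia.
pose sh := sort geq [seq x <- R | (v <= x)%N]; pose sl := sort geq [seq x <- R | ~~ (v <= x)%N].
pose D := map (@can_minor m n) sh ++ [:: f, g & map (@can_minor m n) sl].
have Rmn x : x \in R -> (x <= minn m n)%N.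
  by move=> /(allP gapR) /orP[xd|/andP[] //]; apply: leq_trans xd (ltnW (ltn_trans dv vmn)).
have shmn : all (fun x => x <= minn m n)%N sh.
  by apply/allP => x; rewrite mem_sort mem_filter => /andP[_ /Rmn].
have slmn : all (fun x => x <= minn m n)%N sl.
  by apply/allP => x; rewrite mem_sort mem_filter => /andP[_ /Rmn].
have slP x : x \in sl -> (x <= d)%N.
  rewrite mem_sort mem_filter => /andP[vx /(allP gapR)]; by rewrite (negPf vx) orbF.
have shapeD : bt_shape D = sh ++ [:: v, d.+1 & sl].
  by rewrite /D /bt_shape map_cat /= fsz gsz -!/(bt_shape _) !bt_shape_can.
have geq_trans : transitive geq by move=> a b c ba ac; exact: leq_trans ac ba.
have geq_total : total geq by move=> a b; exact: leq_total.
have srt s : pairwise geq (sort geq s) by rewrite -sorted_pairwise //; exact: sort_sorted.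
have bD : is_bitableau D.
  rewrite /is_bitableau shapeD; apply: pairwise_sorted; rewrite pairwise_cat srt /= srt andbT.
  have lo : all (geq d.+1) sl by apply/allP => x /slP xd; exact: leqW.
  have lo' : all (geq v) sl by apply/allP => x /slP xd /=; exact: leq_trans xd (ltnW dv).
  rewrite lo lo' dv !andbT; apply/allrelP => x y xs.
  have vx : (v <= x)%N by move: xs; rewrite mem_sort mem_filter => /andP[].
  rewrite !inE => /or3P[/eqP ->|/eqP ->|/slP yd] //=; first exact: leq_trans dv vx.
  exact: leq_trans yd (leq_trans (ltnW dv) vx).
have perm_shape : perm_eq (bt_shape D) [:: d.+1, v & R].
  apply/seq.permP => P; rewrite shapeD count_cat /=.
  have e1 := seq.permP (permEl (perm_sort geq [seq x <- R | (v <= x)%N])) P.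
  have e2 := seq.permP (permEl (perm_sort geq [seq x <- R | ~~ (v <= x)%N])) P.
  have := seq.permP (permEl (perm_filterC (fun x => v <= x)%N R)) P.
  rewrite -/sh in e1; rewrite -/sl in e2; rewrite count_cat -e1 -e2 => <-.
  by move: (count P sh) (count P sl) => a b; lia.
have ID : I (bt_poly K D) by apply/(bt_canonical bD); rewrite (canonical_perm _ _ _ perm_shape).
have fP : minor_poly K f = gminor X v (bump k) id.
  by rewrite minor_polyE fsz; apply: eq_gminor => i /fE [].
have gP : minor_poly K g = gminor X d.+1 (last_at d k) (last_at d v).
  by rewrite minor_polyE gsz; apply: eq_gminor => i /gE [].
have RE : canonical K m n R = canonical K m n sh * canonical K m n sl.
  rewrite /canonical -big_cat; apply: perm_big; rewrite perm_sym.
  apply: perm_trans (permEl (perm_filterC (fun x => v <= x)%N R)).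
  by apply: perm_cat; exact: permEl (perm_sort _ _).
have DE : bt_poly K D = canonical K m n sh * (minor_poly K f * (minor_poly K g *
  canonical K m n sl)).
  rewrite -(bt_poly_can shmn) -(bt_poly_can slmn) /D /bt_poly big_cat !big_cons //.
have swap (a b c e : KX) : a * (c * (e * b)) = c * e * (a * b) by ring.
by move: ID; rewrite DE fP gP RE swap.
Qed.

Lemma shape_sum_of_Ishapes :
  (exists S : seq (minor m n) -> Prop, (forall D, S D -> is_bitableau D) /\
      forall p, I p <-> ideal_gen (fun q => exists D, S D /\ q = bt_poly K D) p) ->
  sum_of_Ishapes I.
Proof.
case=> S [Sbt IE]; apply: (sum_of_canonical idI) => [p /IE h|D bD s /andP[_ sr] Is le].
  apply: h; first exact: ideal_sum_ideal.
  move=> q [D [SD ->]]; have bD := Sbt D SD.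
  have ID : I (bt_poly K D) by apply/IE => J _; apply; exists D.
  apply: (@sum_mem _ _ _ _ (bt_shape D)); last exact: Ishape_bt.
  by split; [exact: is_shape_bt | apply/(bt_canonical bD)].
apply/(bt_canonical bD); have /andP[_ Dr] := is_shape_bt bD.
exact: (canonical_up idI shape_exchange sr Dr le Is).
Qed.

End DefinedByShape.

Section StandardBasis.

Variables (K : fieldType) (charK : [pchar K] =i pred0) (m n : nat).
Notation KX := {mpoly K[m * n]}.
Notation X := (genX K m n).
Variables (I : KX -> Prop) (idI : is_ideal I).

Lemma std_expansion (p : KX) : std_comb (fun=> True) p.
Proof.
apply: std_comb_span => W WS h; apply: (standard_span charK p WS) => q [D sD ->].
by apply: h; exists D.
Qed.

(** A generator of I^(sigma) is a combination of standard bitableaux of shapes at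
    least sigma; the canonical products of these shapes lie in I by
    [canonical_up], the standard bitableaux then by [std_of_canonical]. *)
Lemma stable_sum_of_Ishapes :
  has_standard_basis I -> GL_stable I -> sum_of_Ishapes I.
Proof.
move=> stdI GLI.
have exch := @exchange_mem K charK m n I idI GLI stdI.
apply: (sum_of_canonical idI) => [p /stdI h|D bD s /andP[_ sr] Is le].
  have WS := ideal_subspace (@ideal_sum_ideal K m n (fun s => is_shape m n s /\ I
    (canonical K m n s))).
  apply: (h _ WS).
  move=> q [D [sD -> ID]]; have /andP[bD _] := sD.
  apply: (@sum_mem _ _ _ _ (bt_shape D)); last exact: Ishape_bt.
  by split; [exact: is_shape_bt | exact: canonical_of_bt].
have [l [c [rep [ul std _ eD]]]] := std_expansion (bt_poly K D).
rewrite eD; apply: (subspace_sum (ideal_subspace idI)) => u ul' _.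
have [->|cu] := eqVneq (c u) 0; first by rewrite scale0r; exact: ideal0 idI.
apply: (subspaceZ (ideal_subspace idI)).
have Uu : shape_ge s u.
  apply: (supported_terms (@shape_ge_up m n s) ul std _ ul' cu).
  rewrite -eD; apply: supported_bt; first exact: shape_ge_up.
  by move=> t; rewrite statA_lead; exact: le.
have [sD eu] := std u ul'; have /andP[bD' _] := sD.
apply: (std_of_canonical charK idI GLI stdI sD).
have /andP[_ Dr] := is_shape_bt bD'.
apply: (canonical_up idI exch sr Dr _ Is) => -[//|t] _.
by rewrite -statA_lead eu; exact: Uu.
Qed.

(** The terms of the standard expansion of an element of I have shapes above
    those that define I, by [supported_terms]. *)
Lemma sum_has_standard_basis : sum_of_Ishapes I -> has_standard_basis I.
Proof.
case=> S [Sshape IE] p; split=> [Ip|]; last first.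
  by apply; [exact: ideal_subspace | move=> q [D [_ _]]].
have [l [c [rep [ul std _ ep]]]] := std_expansion p.
have sup : supported (@below_some m n S) p by apply: ideal_sum_supported; apply/IE.
rewrite ep; apply: (subspace_sum (lin_span_subspace _)) => u ul' _.
have [->|cu] := eqVneq (c u) 0; first by rewrite scale0r; exact: subspace0 (lin_span_subspace _).
apply: (subspaceZ (lin_span_subspace _)); apply: lin_span_gen; exists (rep u).
have [sD eu] := std u ul'; split=> //; have /andP[bD _] := sD.
have [s Ss le] : exists2 s, S s & forall t, (0 < t)%N -> (gamma t s <= gamma t
  (bt_shape (rep u)))%N.
  apply: below_some_lead; rewrite eu; rewrite ep in sup.
  exact: (supported_terms (@below_some_up m n S) ul std sup ul' cu).
by apply/IE; apply: (sum_mem Ss); exact: Ishape_bt.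
Qed.

Lemma det_mxsub_minor s (f : 'I_s -> 'I_m) (g : 'I_s -> 'I_n) :
  \det (mxsub f g X) = 0 \/
  exists d (c : bool), msize d = s /\ \det (mxsub f g X) = (-1) ^+ c * minor_poly K d.
Proof.
have [/injectiveP fi|nf] := boolP (injectiveb f); last by left; exact: det_mxsub_noninj_row.
have [/injectiveP gi|ng] := boolP (injectiveb g); last by left; exact: det_mxsub_noninj_col.
right; have [t ht] := sort_injective fi; have [t' ht'] := sort_injective gi.
exists (Minor ht ht'), (odd_perm t (+) odd_perm t'); split=> //.
have -> : minor_poly K (Minor ht ht') = \det (row_perm t (col_perm t' (mxsub f g X))).
  by congr (\det _); apply/matrixP => i j; rewrite !mxE.
rewrite row_permE col_permE !det_mulmx !det_perm odd_permV signr_addb.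
move: (\det _) => x.
by case: (odd_perm t); case: (odd_perm t'); rewrite !(expr1, expr0); ring.
Qed.

Lemma GL_actM M N (p q : KX) : GL_act M N (p * q) = GL_act M N p * GL_act M N q.
Proof. by rewrite !GL_actE rmorphM. Qed.

Lemma GL_actD M N (p q : KX) : GL_act M N (p + q) = GL_act M N p + GL_act M N q.
Proof. by rewrite !GL_actE rmorphD. Qed.

(** A group element maps a minor to a combination of minors of the same size. *)
Lemma GL_act_bt (M : 'M[K]_m) (N : 'M[K]_n) (D : seq (minor m n)) (c : KX) :
  (forall D', bt_shape D' = bt_shape D -> I (bt_poly K D' * c)) ->
  I (GL_act M N (bt_poly K D) * c).
Proof.
elim: D c => [|d D IH] c h.
  by have := h [::] erefl; rewrite /bt_poly !big_nil GL_actE rmorph1.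
rewrite /bt_poly big_cons GL_actM.
rewrite [GL_act M N (minor_poly K d)]GL_actE subst_mx_minor.
pose A := rowsub (mrow d) (map_mx (@mpolyC (m * n) K) M).
pose B := rowsub (mcol d) (map_mx (@mpolyC (m * n) K) (invmx N))^T.
have -> : mxsub (mrow d) (mcol d) (map_mx (@mpolyC (m * n) K) M *m X
    *m map_mx (@mpolyC (m * n) K) (invmx N)) = A *m X *m B^T.
  apply/matrixP => i j; rewrite [LHS]mxE [LHS]mxE [RHS]mxE; apply: eq_bigr => l _.
  congr (_ * _); last by rewrite !mxE.
  by rewrite [LHS]mxE [RHS]mxE; apply: eq_bigr => l' _; congr (_ * _); rewrite !mxE.
rewrite det_mulmx_sum2 !big_distrl /=.
apply: (subspace_sum (ideal_subspace idI)) => f _ _; rewrite !big_distrl /=.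
apply: (subspace_sum (ideal_subspace idI)) => g _ _.
rewrite -!mulrA; apply: (idealM idI); apply: (idealM idI).
have [->|[d' [b [sz ->]]]] := det_mxsub_minor f g; first by rewrite mul0r; exact: ideal0 idI.
rewrite -mulrA; apply: (idealM idI); rewrite mulrCA; apply: IH => D' sD'.
have := h (d' :: D'); rewrite /= sz sD' => /(_ erefl).
rewrite /bt_poly big_cons; move: (minor_poly K d') (\prod_(_ <- D') _) => x y.
by rewrite [x * y]mulrC -mulrA.
Qed.

Lemma sum_GL_stable : sum_of_Ishapes I -> GL_stable I.
Proof.
case=> S [Sshape IE] M N _ _ p /IE; apply: (@ideal_sum_min _ _ _ S (fun q => I (GL_act M N q))).
  split=> [|x y Ix Iy|a x Ix].
  - by rewrite GL_actE rmorph0; exact: ideal0 idI.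
  - by rewrite GL_actD; exact: (idealD idI Ix Iy).
  by rewrite GL_actM; exact: (idealM idI).
move=> s D Ss bD le; rewrite -[GL_act _ _ _]mulr1; apply: GL_act_bt => D' sD'.
rewrite mulr1; apply/IE; apply: (sum_mem Ss); apply: Ishape_bt; last by rewrite sD'.
by rewrite /is_bitableau sD'.
Qed.

End StandardBasis.

Theorem theorem5p2 (K : fieldType) (charK : [pchar K] =i pred0) (m n : nat)
    (I : {mpoly K[m * n]} -> Prop) (idI : is_ideal I) :
  [<-> defined_by_shape I;
       sum_of_Ishapes I;
       has_standard_basis I /\ GL_stable I].
Proof.
tfae.
- case=> gen sh; exact: shape_sum_of_Ishapes.
- by move=> h; split; [exact: sum_has_standard_basis | exact: sum_GL_stable].
by case=> stdI GLI; apply: (sum_defined_by_shape idI); exact: stable_sum_of_Ishapes.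
Qed.
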